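(* Let $\Pi=\Pi(\nu_1,\nu_2)$ be an irreducible principal series representation of $GL_2(F)$ with $\nu_1,\nu_2$ both nontrivial, with conductor exponents $r_1\geq r_2$, and let $\omega=\nu_1\nu_2$ be its central character. Put $\omega'=\nu_1/\nu_2$, assumed ramified, and $\Pi'=\Pi\otimes\nu_2^{-1}=\Pi(\omega',1)$. Let $K/F$ be a quadratic field extension (possibly ramified), $T=K^*$, and let $\chi$ denote any character of $T$ which agrees with $\omega$ on $F^*$. Then a test vector for $\chi$ is given by the vector $w_s=v'_s\otimes\nu_2\in\Pi'\otimes\nu_2=\Pi$, where $v'_s\in u_{P^s}(\omega')\subset\Pi'=\bigoplus_{s}u_{P^s}(\omega')$ is the test vector at level $s$ for $\Pi'$ and the character $\chi'=\chi\cdot(\nu_2\circ N_{K/F})^{-1}$ described in the context.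
   Context: $F$ is a finite extension of $\mathbb{Q}_p$ with ring of integers $\mathcal{O}$, maximal ideal $P=(\varpi)$. $G(\mathcal{O})=GL_2(\mathcal{O})$; $B(s)\subset G(\mathcal{O})$ is the subgroup of matrices with lower left entry in $P^s$. Let $P^{r'}$, $r'\ge1$, be the conductor of $\omega'$. For $s\ge r'$ regard $\omega'$ as a character of $B(s)$ via $\begin{pmatrix}a&b\\c&d\end{pmatrix}\mapsto\omega'(a)$; $u_{P^{r'}}(\omega')=\mathrm{Ind}_{B(r')}^{G(\mathcal{O})}(\omega')$ and, for $s>r'$, $u_{P^s}(\omega')$ is the complement of $\sum_{r'\le t<s}\mathrm{Ind}_{B(t)}^{G(\mathcal{O})}(\omega')$ in $\mathrm{Ind}_{B(s)}^{G(\mathcal{O})}(\omega')$. These are irreducible, $\Pi'|_{G(\mathcal{O})}=\bigoplus_{s\ge r'}u_{P^s}(\omega')$, and each $u_{P^s}(\omega')$ contains a vector $u_s$, unique up to scalar, on which $B(s)$ acts by $\omega'$; $u_{r'}$ is the new vector of $\Pi'$. The representation $\Pi'\otimes\nu_2$ acts on the space of $\Pi'$ by $g\mapsto\nu_2(\det g)\Pi'(g)$, and $v'\otimes\nu_2$ denotes $v'$ viewed in that space. A vector $v$ is a test vector for a character $\chi$ of $T$ if $\ell_\chi(v)\ne0$, where $\ell_\chi$ is a nonzero element of the one-dimensional space of $T$-equivariant functionals $\Pi\to\chi$. The conductor exponent of a character of $K^*$ is the smallest integer $t$ such that it is trivial on $\{u\in\mathcal{O}_K^*:u\equiv1\bmod\varpi_K^t\mathcal{O}_K\}$.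 The test vector $v'_s$ for $\chi'$ is as follows. (i) If $K/F$ is unramified, $K^*$ is embedded in $GL_2(F)$ with $\mathcal{O}_K^*\subset G(\mathcal{O})$, $s$ is the conductor exponent of $\chi'$, and $v'_s=u_s$. (ii) If $K/F$ is ramified, $K$ is embedded in $M_2(F)$ so that $\mathcal{O}_K$ lies in the Eichler order $R(P)$ of matrices in $M_2(\mathcal{O})$ with lower left entry in $P$. The conductor exponent of $\chi'$ is either $2r'-1$, in which case $s=r'$ and $v'_s=u_{r'}$; or $2s$ with $s\ge r'$, in which case $v'_s=k\cdot u_s$ for some $k\in G(\mathcal{O})$ such that the Eichler order $S=kR(P^s)k^{-1}$ satisfies $S\cap K=\mathcal{O}+P^s\mathcal{O}_K$, where $R(P^s)$ is the order of matrices in $M_2(\mathcal{O})$ with lower left entry in $P^s$. *)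

(* Defs.v *)
From HB Require Import structures.
From mathcomp Require Import all_boot all_order all_algebra all_field.
From mathcomp Require Import all_classical all_reals.
From mathcomp Require Import complex ring.

Set Implicit Arguments.
Unset Strict Implicit.
Unset Printing Implicit Defensive.

Import Order.TTheory GRing.Theory Num.Theory.

Local Open Scope classical_set_scope.
Local Open Scope ring_scope.

(* Q_p, as a completion of the rationals for the p-adic absolute value: a
   complete field with a non-archimedean absolute value which extends the p-adic
   one (by multiplicativity its values on positive integers determine it on the
   rationals) and in which the rationals are dense. *)
Structure padicField (R : realType) (p : nat) := PadicField {
  padic_sort :> fieldType;
  padic_prime : prime p;
  padic_abs : padic_sort -> R;
  padic_abs_ge0 : forall x, 0 <= padic_abs x;
  padic_abs_eq0 : forall x, padic_abs x = 0 <-> x = 0;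
  padic_absM : forall x y, padic_abs (x * y) = padic_abs x * padic_abs y;
  padic_absD : forall x y,
    padic_abs (x + y) <= Num.max (padic_abs x) (padic_abs y);
  padic_abs_nat : forall n : nat, (0 < n)%N ->
    padic_abs n%:R = p%:R ^- logn p n;
  padic_dense : forall (x : padic_sort) (e : R), 0 < e ->
    exists q : rat, padic_abs (x - ratr q) < e;
  padic_complete : forall u : nat -> padic_sort,
    (forall e : R, 0 < e -> exists N : nat, forall m n : nat,
       (N <= m)%N -> (N <= n)%N -> padic_abs (u m - u n) < e) ->
    exists l : padic_sort, forall e : R, 0 < e -> exists N : nat,
      forall n : nat, (N <= n)%N -> padic_abs (u n - l) < e }.

Section PadicIntegers.
Variables (R : realType) (p : nat) (Qp : padicField R p).

Definition padic_int_pred : {pred Qp} := fun x => padic_abs x <= 1.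

Lemma padic_abs1 : padic_abs (1 : Qp) = 1.
Proof. by rewrite (padic_abs_nat (p := p) Qp (isT : (0 < 1)%N)) logn1 expr0 invr1. Qed.

Lemma padic_absN1 : padic_abs (-1 : Qp) = 1.
Proof.
apply/eqP; rewrite -(@eqrXn2 _ 2) ?padic_abs_ge0 // expr1n expr2 -padic_absM.
by rewrite mulrNN mulr1 padic_abs1.
Qed.

Lemma padic_int_subring : subring_closed padic_int_pred.
Proof.
split=> [|x y|x y]; rewrite /in_mem /= /padic_int_pred ?padic_abs1 //.
- move=> hx hy; apply: le_trans (padic_absD _ _) _.
  by rewrite ge_max hx -mulN1r padic_absM padic_absN1 mul1r.
- by move=> hx hy; rewrite padic_absM mulr_ile1 ?padic_abs_ge0.
Qed.

HB.instance Definition _ :=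
  GRing.isSubringClosed.Build Qp padic_int_pred padic_int_subring.

Record padic_int :=
  PadicInt { padic_int_val :> Qp; _ : padic_int_val \in padic_int_pred }.
HB.instance Definition _ := [isSub for padic_int_val].
HB.instance Definition _ := [Choice of padic_int by <:].
HB.instance Definition _ := [SubChoice_isSubComNzRing of padic_int by <:].
HB.instance Definition _ := GRing.RMorphism.copy padic_int_val
  (val : padic_int -> Qp).

Definition ring_of_integers (L : fieldType) (j : {rmorphism Qp -> L}) : set L :=
  [set x | integralOver (j \o padic_int_val) x].

End PadicIntegers.

Lemma det_mx22 (L : comNzRingType) (M : 'M[L]_2) :
  \det M = M 0 0 * M 1 1 - M 0 1 * M 1 0.
Proof.
rewrite (expand_det_row _ 0) !big_ord_recl big_ord0 addr0 /cofactor.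
rewrite !det_mx11 !mxE /= expr0 expr1 mul1r mulN1r mulrN.
by congr (M _ _ * M _ _ - M _ _ * M _ _); apply: val_inj.
Qed.

Section GL2.
Variable F : fieldType.

Record GL2 := MkGL2 { GL2_mx :> 'M[F]_2; _ : GL2_mx \in unitmx }.
HB.instance Definition _ := [isSub for GL2_mx].
HB.instance Definition _ := [Choice of GL2 by <:].

Definition GL2_one : GL2 := MkGL2 (unitmx1 F 2).
Fact GL2_mul_subproof (g h : GL2) : g *m h \in unitmx.
Proof. by rewrite unitmx_mul (valP g) (valP h). Qed.
Definition GL2_mul (g h : GL2) : GL2 := MkGL2 (GL2_mul_subproof g h).
Fact GL2_inv_subproof (g : GL2) : invmx g \in unitmx.
Proof. by rewrite unitmx_inv (valP g). Qed.
Definition GL2_inv (g : GL2) : GL2 := MkGL2 (GL2_inv_subproof g).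

Fact GL2_mulA : associative GL2_mul.
Proof. by move=> x y z; apply: val_inj; rewrite /= mulmxA. Qed.
Fact GL2_mul1 : left_id GL2_one GL2_mul.
Proof. by move=> x; apply: val_inj; rewrite /= mul1mx. Qed.
Fact GL2_mulr1 : right_id GL2_one GL2_mul.
Proof. by move=> x; apply: val_inj; rewrite /= mulmx1. Qed.
Fact GL2_mulV : left_inverse GL2_one GL2_inv GL2_mul.
Proof. by move=> x; apply: val_inj; rewrite /= mulVmx ?(valP x). Qed.
Fact GL2_mulrV : right_inverse GL2_one GL2_inv GL2_mul.
Proof. by move=> x; apply: val_inj; rewrite /= mulmxV ?(valP x). Qed.
HB.instance Definition _ :=
  isGroup.Build GL2 GL2_mulA GL2_mul1 GL2_mulr1 GL2_mulV GL2_mulrV.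
End GL2.

(* O is the ring of integers of a local field L and w generates its maximal
   ideal. *)
Section LocalField.
Variables (L : fieldType) (O : set L) (w : L).

Definition integer_units : set L := [set x | [/\ O x, x != 0 & O x^-1]].

Definition maximal_ideal : set L := [set x | O x /\ ~ integer_units x].

Definition ideal_power (n : nat) : set L := [set x | exists2 y, O y & x = w ^+ n * y].

Definition uniformizer : Prop := w != 0 /\ maximal_ideal = ideal_power 1.

Definition unit_filtration (n : nat) : set L :=
  [set u | integer_units u /\ ideal_power n (u - 1)].

Variable C : fieldType.

Definition trivial_on (U : set L) (mu : L -> C) : Prop :=
  forall u, U u -> mu u = 1.

Definition conductor_exponent (mu : L -> C) (t : nat) : Prop :=
  trivial_on (unit_filtration t) mu /\
  forall t', trivial_on (unit_filtration t') mu -> (t <= t')%N.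

Definition ramified_char (mu : L -> C) : Prop := ~ trivial_on integer_units mu.

End LocalField.

(* The norm of L / k, as the determinant of multiplication by x. *)
Definition field_norm (k : fieldType) (L : fieldExtType k) (x : L) : k :=
  \det (passmx.mxof (vbasis {:L}) (vbasis {:L}) (amulr x)).

Section Representations.
Variables (G : groupType) (C : fieldType).

Record representation := Representation {
  rep_space :> lmodType C;
  rep_act : G -> rep_space -> rep_space;
  rep_linear : forall g, linear (rep_act g);
  rep_act1 : forall v, rep_act 1%g v = v;
  rep_actM : forall g h v, rep_act (g * h)%g v = rep_act g (rep_act h v) }.

Definition subspace (V : lmodType C) (W : set V) : Prop :=
  W 0 /\ forall (a : C) u v, W u -> W v -> W (a *: u + v).

Definition stable_under (rho : representation) (H : set G) (W : set rho) : Prop :=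
  forall h v, H h -> W v -> W (rep_act h v).

Definition irreducible_rep (rho : representation) : Prop :=
  (exists v : rho, v != 0) /\
  forall W : set rho, subspace W -> stable_under setT W ->
    W = [set 0] \/ W = setT.

End Representations.


Section PadicExtension.
Variables (R : realType) (p : nat) (Qp : padicField R p).
Variables (L : fieldType) (j : {rmorphism Qp -> L}).
Let O := ring_of_integers j.

Lemma ring_of_integersB x y : O x -> O y -> O (x - y).
Proof. exact: integral_sub. Qed.
Lemma ring_of_integersD x y : O x -> O y -> O (x + y).
Proof. exact: integral_add. Qed.
Lemma ring_of_integersM x y : O x -> O y -> O (x * y).
Proof. exact: integral_mul. Qed.
Lemma ring_of_integers_nat n : O n%:R.
Proof. exact: integral_nat. Qed.
Lemma ring_of_integers_embed (z : Qp) : padic_abs z <= 1 -> O (j z).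
Proof.
move=> hz; have := integral_id (j \o @padic_int_val R p Qp) (PadicInt hz).
by [].
Qed.

Lemma padic_bounded (z : Qp) : exists a : nat, padic_abs (p%:R ^+ a * z) <= 1.
Proof.
have p_gt0 := prime_gt0 (padic_prime Qp).
have absX a : padic_abs (p%:R ^+ a : Qp) = p%:R ^- a.
  by rewrite -natrX padic_abs_nat ?expn_gt0 ?p_gt0// pfactorK // (padic_prime Qp).
exists (Num.bound (padic_abs z)).
rewrite padic_absM absX mulrC ler_pdivrMr ?exprn_gt0 ?ltr0n// mul1r.
apply: (le_trans (ltW (archi_boundP (padic_abs_ge0 z)))).
by rewrite -natrX ler_nat ltnW // ltn_expl // prime_gt1 // (padic_prime Qp).
Qed.

End PadicExtension.

(* The powers of p, rather than those of a uniformizer, are used to describe the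
   topology: both generate the same neighbourhoods of 0. *)
Record character (L : fieldType) (O : set L) (p : nat) (C : fieldType) := Character {
  char_fun :> L -> C;
  char0 : char_fun 0 = 0;
  char1 : char_fun 1 = 1;
  charM : {morph char_fun : x y / x * y};
  char_smooth : exists n : nat, trivial_on (unit_filtration O p%:R n) char_fun }.

Section PrincipalSeries.
Variables (R : realType) (p : nat) (Qp : padicField R p) (F : fieldExtType Qp).

Definition integers : set F := ring_of_integers (in_alg F : {rmorphism Qp -> F}).

(* The normalized absolute value of F, for which a uniformizer has absolute
   value the inverse of the cardinality of the residue field. *)
Definition normalized_abs (x : F) : R := padic_abs (field_norm x).

Definition GL2O : set (GL2 F) :=
  [set g | forall i j, integers (GL2_mx g i j) /\ integers (GL2_mx g^-1%g i j)].

Definition congruence_subgroup (n : nat) : set (GL2 F) :=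
  [set k | GL2O k /\
           forall i j, ideal_power integers p%:R n ((GL2_mx k - 1%:M) i j)].

Definition principal_series_pred (nu1 nu2 : F -> R[i]) : {pred GL2 F -> R[i]} :=
  fun f => `[<
    (forall b g : GL2 F, b 1 0 = 0 ->
       f (b * g)%g = nu1 (b 0 0) * nu2 (b 1 1) *
         (Num.sqrt (normalized_abs (b 0 0 / b 1 1)))%:C%C * f g) /\
    (exists n : nat, forall k g : GL2 F, congruence_subgroup n k ->
       f (g * k)%g = f g) >].

Lemma congruence_subgroup_le (m n : nat) :
  (m <= n)%N -> congruence_subgroup n `<=` congruence_subgroup m.
Proof.
move=> le_mn k [kO kn]; split=> // i j; have [y Oy ->] := kn i j.
exists (p%:R ^+ (n - m) * y); last by rewrite mulrA -exprD subnKC.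
apply: ring_of_integersM => //; rewrite -natrX; exact: ring_of_integers_nat.
Qed.

Fact principal_series_submod (nu1 nu2 : F -> R[i]) :
  submod_closed (principal_series_pred nu1 nu2).
Proof.
split=> [|a u v].
  apply/asboolP; split; first by move=> b g _ /=; rewrite mulr0.
  by exists 0%N.
move=> /asboolP[uB [m um]] /asboolP[vB [n vn]]; apply/asboolP; split.
  move=> b g b0; rewrite /= !fctE /= uB // vB // mulrDr; congr (_ + _).
  by rewrite /GRing.scale /= mulrCA.
exists (maxn m n) => k g kK; rewrite !fctE /= um ?vn //.
  exact: congruence_subgroup_le (leq_maxr _ _) _ kK.
exact: congruence_subgroup_le (leq_maxl _ _) _ kK.
Qed.

HB.instance Definition _ nu1 nu2 := GRing.isSubmodClosed.Build R[i] (GL2 F -> R[i])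
  (principal_series_pred nu1 nu2) (principal_series_submod nu1 nu2).

(* Normalized induction from the upper triangular Borel subgroup, on which
   GL_2(F) acts by right translation. *)
Record principal_series_space (nu1 nu2 : F -> R[i]) := PrincipalSeriesVector {
  ps_fun :> GL2 F -> R[i];
  _ : ps_fun \in principal_series_pred nu1 nu2 }.
HB.instance Definition _ nu1 nu2 := [isSub for @ps_fun nu1 nu2].
HB.instance Definition _ nu1 nu2 :=
  [Choice of principal_series_space nu1 nu2 by <:].
HB.instance Definition _ nu1 nu2 :=
  [SubChoice_isSubLmodule of principal_series_space nu1 nu2 by <:].

Lemma integers_bounded (x : F) : exists a : nat, integers (p%:R ^+ a * x).
Proof.
have [/polyOver1P[q Dq] mon_q] := (minPolyOver 1 x, monic_minPoly 1 x).
rewrite Dq map_monic in mon_q.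
have q0 : root (map_poly (in_alg F) q) x by rewrite -Dq root_minPoly.
pose N := \max_(i < size q) xchoose (padic_bounded q`_i).
pose d := (size q).-1.
have sq : size q = d.+1 by rewrite prednK // lt0n size_poly_eq0 monic_neq0.
exists N; set u := _ * x.
pose r : {poly F} := \poly_(i < d.+1) (in_alg F q`_i * p%:R ^+ (N * (d - i))).
have rd : r`_d = 1.
  rewrite coef_poly ltnS leqnn subnn muln0 expr0 mulr1.
  by rewrite -lead_coefE (monicP mon_q) rmorph1.
have sr : size r = d.+1.
  apply/eqP; rewrite eqn_leq size_poly /= ltnNge; apply/negP => ler.
  by have := nth_default 0 ler; rewrite rd => /eqP; rewrite oner_eq0.
apply: (@integral_root_monic _ _ _ u r).
- by apply/monicP; rewrite lead_coefE sr.
- rewrite /root horner_poly; apply/eqP.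
  have := rootP q0; rewrite horner_coef size_map_poly sq => e0.
  transitivity (p%:R ^+ (N * d) *
    \sum_(i < d.+1) (map_poly (in_alg F) q)`_i * x ^+ i); last by rewrite e0 mulr0.
  rewrite mulr_sumr; apply: eq_bigr => -[i ltid] _ /=.
  rewrite coef_map /= /u exprMn -exprM -{2}(subnK (ltnSE ltid)) mulnDr exprD.
  rewrite -(mulrA _%:A) (mulrA (_ * _) (_%:A)) !mulrA; congr (_ * _).
  by rewrite -mulrA mulrC.
- apply/integral_poly => i; rewrite coef_poly; case: ltnP => [ltid|_]; last first.
    by rewrite -(rmorph0 (in_alg F)); apply: ring_of_integers_embed;
       rewrite (proj2 (padic_abs_eq0 _)).
  have [->|ned] := eqVneq i d.
    rewrite subnn muln0 expr0 mulr1 -lead_coefE (monicP mon_q).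
    by apply: ring_of_integers_embed; rewrite padic_abs1.
  have [k Dk] : exists k, (N * (d - i) = k + xchoose (padic_bounded q`_i))%N.
    exists (N * (d - i) - xchoose (padic_bounded q`_i))%N; rewrite subnK //.
    have ltiq : (i < size q)%N by rewrite sq.
    have := leq_bigmax (F := fun i : 'I_(size q) => xchoose (padic_bounded q`_i))
      (Ordinal ltiq).
    move=> /= /leq_trans-> //; rewrite leq_pmulr // subn_gt0.
    by rewrite ltn_neqAle ned -ltnS.
  rewrite Dk exprD mulrCA mulrC; apply: ring_of_integersM; last first.
    by rewrite -natrX; apply: ring_of_integers_nat.
  rewrite -(rmorph_nat (in_alg F)) -rmorphXn -rmorphM mulrC.
  exact: ring_of_integers_embed (xchooseP (padic_bounded q`_i)).
Qed.

Lemma GL2_bounded (g : GL2 F) :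
  exists a : nat, forall i j, integers (p%:R ^+ a * g i j).
Proof.
pose a (ij : 'I_2 * 'I_2) := sval (cid (integers_bounded (g ij.1 ij.2))).
exists (\max_ij a ij) => i j.
have le_a : (a (i, j) <= \max_ij a ij)%N := leq_bigmax (i, j).
rewrite -(subnK le_a) exprD -mulrA; apply: ring_of_integersM.
  by rewrite -natrX; apply: ring_of_integers_nat.
exact: (svalP (cid (integers_bounded (g i j)))).
Qed.

Lemma ideal_powerD n (x y : F) : ideal_power integers p%:R n x ->
  ideal_power integers p%:R n y -> ideal_power integers p%:R n (x + y).
Proof.
move=> [a Oa ->] [b Ob ->]; exists (a + b); last by rewrite mulrDr.
exact: ring_of_integersD.
Qed.

Lemma ideal_power_mx n (A M B : 'M[F]_2) a b :
  (forall i j, integers (p%:R ^+ a * A i j)) ->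
  (forall i j, integers (p%:R ^+ b * B i j)) ->
  (forall i j, ideal_power integers p%:R (a + n + b) (M i j)) ->
  forall i j, ideal_power integers p%:R n ((A *m M *m B) i j).
Proof.
move=> OA OB OM i j; rewrite mxE.
have sumP (f : 'I_2 -> F) : (forall k, ideal_power integers p%:R n (f k)) ->
    ideal_power integers p%:R n (\sum_k f k).
  by move=> Hf; rewrite big_ord_recl big_ord1; apply: ideal_powerD.
apply: (sumP) => k; rewrite mxE mulr_suml; apply: (sumP) => l.
have [y Oy ->] := OM l k.
exists ((p%:R ^+ a * A i l) * y * (p%:R ^+ b * B k j)).
  exact: ring_of_integersM (ring_of_integersM (OA i l) Oy) (OB k j).
by rewrite !exprD; ring.
Qed.

Lemma congruence_subgroup_conj n (g : GL2 F) : exists m : nat, forall k : GL2 F,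
  congruence_subgroup m k -> congruence_subgroup n (g^-1 * k * g)%g.
Proof.
have [a Oa] := GL2_bounded g^-1%g; have [b Ob] := GL2_bounded g.
have conjB (h : GL2 F) : GL2_mx (g^-1 * h * g)%g - 1%:M =
    GL2_mx g^-1%g *m (GL2_mx h - 1%:M) *m GL2_mx g.
  rewrite mulmxBr mulmxBl mulmx1.
  by have /(congr1 (@GL2_mx F)) /= -> := mulVg g.
exists (a + n + b)%N => k [kO kn].
have kVn i j : ideal_power integers p%:R (a + n + b)
    ((GL2_mx k^-1%g - 1%:M) i j).
  have -> : GL2_mx k^-1%g - 1%:M = - GL2_mx k^-1%g *m (GL2_mx k - 1%:M) *m 1%:M.
    rewrite mulmx1 mulNmx mulmxBr mulmx1 opprB.
    by have /(congr1 (@GL2_mx F)) /= -> := mulVg k.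
  move: i j; apply: (@ideal_power_mx _ _ _ _ 0 0).
  - move=> i j; rewrite expr0 mul1r mxE -sub0r.
    by apply: ring_of_integersB; [exact: (ring_of_integers_nat _ 0) | case: (kO i j)].
  - move=> i j; rewrite expr0 mul1r mxE; exact: ring_of_integers_nat.
  - by move=> i j; rewrite add0n addn0.
have near (h : GL2 F) : (forall i j, ideal_power integers p%:R (a + n + b)
    ((GL2_mx h - 1%:M) i j)) -> forall i j, ideal_power integers p%:R n
    ((GL2_mx (g^-1 * h * g)%g - 1%:M) i j).
  by move=> hn i j; rewrite conjB; apply: ideal_power_mx.
have int_near (h : GL2 F) : (forall i j, ideal_power integers p%:R n
    ((GL2_mx h - 1%:M) i j)) -> forall i j, integers (GL2_mx h i j).
  move=> hn i j; have [y Oy] := hn i j; rewrite !mxE => /eqP.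
  rewrite subr_eq => /eqP ->; apply: ring_of_integersD.
    apply: ring_of_integersM => //; rewrite -natrX; exact: ring_of_integers_nat.
  exact: ring_of_integers_nat.
split=> [i j|]; last exact: near.
split; first exact: int_near (near _ kn) i j.
have -> : ((g^-1 * k * g)^-1 = g^-1 * k^-1 * g)%g by rewrite !invgM invgK mulgA.
exact: int_near (near _ kVn) i j.
Qed.

Section Action.
Variables nu1 nu2 : F -> R[i].

Fact ps_act_subproof (g : GL2 F) (f : principal_series_space nu1 nu2) :
  (fun x => f (x * g)%g) \in principal_series_pred nu1 nu2.
Proof.
have /asboolP[fB [n fn]] := valP f; apply/asboolP; split.
  by move=> b x b0; rewrite -mulgA fB.
have [m Km] := congruence_subgroup_conj n g; exists m => k x kK.
rewrite -[RHS](fn (g^-1 * k * g)%g) //; last exact: Km.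
by congr (ps_fun f _); rewrite !mulgA mulgK.
Qed.

Definition ps_act (g : GL2 F) (f : principal_series_space nu1 nu2) :
    principal_series_space nu1 nu2 :=
  PrincipalSeriesVector (ps_act_subproof g f).

Fact ps_act_linear g : linear (ps_act g).
Proof. by move=> a u v; apply: val_inj. Qed.
Fact ps_act1 v : ps_act 1%g v = v.
Proof. by apply: val_inj; apply/funext => x /=; rewrite mulg1. Qed.
Fact ps_actM g h v : ps_act (g * h)%g v = ps_act g (ps_act h v).
Proof. by apply: val_inj; apply/funext => x /=; rewrite mulgA. Qed.

Definition principal_series : representation (GL2 F) R[i] :=
  Representation ps_act_linear ps_act1 ps_actM.
End Action.

Section Twist.
Variables (nu1 : F -> R[i]) (nu2 : character integers p R[i]).

Lemma character_neq0 (x : F) : x != 0 -> nu2 x != 0.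
Proof.
move=> x0; apply/eqP => nx0; have := char1 nu2.
by rewrite -(divff x0) charM nx0 mul0r => /esym/eqP; rewrite oner_eq0.
Qed.

Lemma GL2_det_neq0 (g : GL2 F) : \det g != 0.
Proof. by rewrite -unitfE -unitmxE (valP g). Qed.

Lemma congruence_subgroup_det n k : congruence_subgroup n k ->
  unit_filtration integers p%:R n (\det k).
Proof.
move=> [kO kn].
have det_int (h : GL2 F) : (forall i j, integers (GL2_mx h i j)) ->
    integers (\det h).
  move=> hO; rewrite det_mx22.
  exact: ring_of_integersB (ring_of_integersM (hO 0 0) (hO 1 1))
    (ring_of_integersM (hO 0 1) (hO 1 0)).
split.
  split; [by apply: det_int => i j; case: (kO i j) | exact: GL2_det_neq0 |].
  by rewrite -det_inv; apply: (det_int k^-1%g) => i j; case: (kO i j).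
have Ok i j := proj1 (kO i j); rewrite det_mx22.
have [a Oa ea] := kn 0 0; have [b Ob eb] := kn 0 1.
have [d Od ed] := kn 1 1.
move: ea eb ed; rewrite !mxE /= !(mulr1n, mulr0n) subr0 => ea eb ed.
exists (a * GL2_mx k 1 1 + d - b * GL2_mx k 1 0).
  exact: ring_of_integersB
    (ring_of_integersD (ring_of_integersM Oa (Ok 1 1)) Od)
    (ring_of_integersM Ob (Ok 1 0)).
rewrite mulrBr mulrDr !mulrA -ea -eb -ed; ring.
Qed.

Fact twist_subproof
    (v : principal_series (fun x => nu1 x / nu2 x) (fun=> 1)) :
  (fun g : GL2 F => nu2 (\det g) * ps_fun v g) \in principal_series_pred nu1 nu2.
Proof.
have /asboolP[vB [n vn]] := valP v; apply/asboolP; split.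
  move=> b g b0; rewrite vB // det_mulmx [\det b]det_mx22 b0 mulr0 subr0 !charM.
  have n0 : nu2 (b 0 0) != 0.
    apply: character_neq0; apply/eqP => b00; have := GL2_det_neq0 b.
    by rewrite det_mx22 b0 b00 mul0r mulr0 subrr eqxx.
  rewrite /= mulr1. by field.
have [m nm] := char_smooth nu2.
exists (maxn m n) => k g kK; rewrite vn; last first.
  exact: congruence_subgroup_le (leq_maxr _ _) _ kK.
rewrite det_mulmx charM [nu2 (\det k)]nm ?mulr1 //.
apply: congruence_subgroup_det.
exact: congruence_subgroup_le (leq_maxl _ _) _ kK.
Qed.

(* The isomorphism of Pi(nu1 / nu2, 1) twisted by nu2 with Pi(nu1, nu2), which
   multiplies functions by nu2 composed with the determinant. *)
Definition twist (v : principal_series (fun x => nu1 x / nu2 x) (fun=> 1)) :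
    principal_series nu1 nu2 :=
  PrincipalSeriesVector (twist_subproof v).

Lemma twist_is_linear : linear twist.
Proof.
move=> a u v; apply: val_inj; apply/funext => g /=.
by rewrite !fctE /= mulrDr; congr (_ + _); rewrite /GRing.scale /= mulrCA.
Qed.

Lemma twist_act g v :
  rep_act g (twist v) = twist (nu2 (\det g) *: rep_act g v).
Proof.
apply: val_inj; apply/funext => x /=.
by rewrite !fctE det_mulmx charM mulrA.
Qed.
End Twist.

Section LevelSpaces.
Variables (w : F) (omega : F -> R[i]).

Definition Eichler_order (s : nat) : set 'M[F]_2 :=
  [set M | (forall i j, integers (M i j)) /\ ideal_power integers w s (M 1 0)].

Definition Bgroup (s : nat) : set (GL2 F) :=
  [set g | GL2O g /\ ideal_power integers w s (GL2_mx g 1 0)].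

Local Notation Pi' := (principal_series omega (fun=> 1)).

(* By the Iwasawa decomposition, restriction to GL_2(O) identifies Pi' with the
   representation of GL_2(O) induced from its upper triangular subgroup; this is
   the subspace of the functions whose restriction lies in the representation
   induced from B(s). *)
Definition IndB (s : nat) : set Pi' :=
  [set f : Pi' | forall b g : GL2 F, Bgroup s b -> GL2O g ->
     ps_fun f (b * g)%g = omega (GL2_mx b 0 0) * ps_fun f g].

Definition IndB_sum (r s : nat) : set Pi' :=
  [set f : Pi' | exists2 h : nat -> Pi',
     (forall t, (r <= t < s)%N -> IndB t (h t)) & f = \sum_(r <= t < s) h t].

(* The representations involved are multiplicity free, so that the complement
   is unique; for s = r the sum is 0 and W is all of IndB r. *)
Definition level_space (r s : nat) (W : set Pi') : Prop :=
  [/\ subspace W, stable_under GL2O W,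
      W `&` IndB_sum r s = [set 0] &
      IndB s = [set f : Pi' | exists x y : Pi',
                  [/\ W x, IndB_sum r s y & f = x + y]]].

(* The vector u_s of u_{P^s}, which is unique up to a scalar. *)
Definition level_vector (r s : nat) (u : Pi') : Prop :=
  exists W : set Pi', [/\ level_space r s W, W u, u != 0 &
    forall b, Bgroup s b -> rep_act b u = omega (GL2_mx b 0 0) *: u].

End LevelSpaces.

Section Torus.
Variables (K : fieldExtType F) (iota : {lrmorphism K -> 'M[F]_2}).

Definition ext_integers : set K :=
  ring_of_integers (in_alg K \o in_alg F : {rmorphism Qp -> K}).

Definition equivariant_functional (rho : representation (GL2 F) R[i])
    (chi : K -> R[i]) (l : {linear rho -> R[i]^o}) : Prop :=
  forall (t : K) (g : GL2 F) (v : rho),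
    GL2_mx g = iota t -> l (rep_act g v) = chi t * l v.

(* l spans the space of equivariant functionals, which is part of what is
   asserted, and does not vanish at v. *)
Definition test_vector (rho : representation (GL2 F) R[i]) (chi : K -> R[i])
    (v : rho) : Prop :=
  exists l : {linear rho -> R[i]^o},
    [/\ equivariant_functional chi l,
        forall l' : {linear rho -> R[i]^o}, equivariant_functional chi l' ->
          exists c : R[i], forall x, l' x = c * l x &
        l v != 0].

Variable w : F.

(* A uniformizer w of F remains one in K; residue fields are finite, so that the
   residue extension is separable. *)
Definition unramified_ext : Prop := uniformizer ext_integers (in_alg K w).

(* In the unramified case the units of the integers of K are to embed in
   GL_2(O), in the ramified case the integers of K in the Eichler order R(P). *)
Definition torus_compatible : Prop :=
  (unramified_ext -> forall (x : K) (g : GL2 F),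
     integer_units ext_integers x -> GL2_mx g = iota x -> GL2O g) /\
  (~ unramified_ext -> forall x : K, ext_integers x -> Eichler_order w 1 (iota x)).

Variables (wK : K) (omega : F -> R[i]) (chi : K -> R[i]).
Local Notation Pi' := (principal_series omega (fun=> 1)).

Definition conj_Eichler_order (k : GL2 F) (s : nat) : set 'M[F]_2 :=
  [set GL2_mx k *m M *m GL2_mx k^-1%g | M in Eichler_order w s].

(* The order O + P^s O_K. *)
Definition conductor_order (s : nat) : set K :=
  [set x | exists (a : F) (y : K), [/\ integers a,
     ideal_power ext_integers (in_alg K w) s y & x = in_alg K a + y]].

Definition level_test_vector (r s : nat) (v : Pi') : Prop :=
  (unramified_ext /\ conductor_exponent ext_integers wK chi s /\
     level_vector w r s v) \/
  (~ unramified_ext /\ conductor_exponent ext_integers wK chi (2 * r - 1)%N /\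
     s = r /\ level_vector w r r v) \/
  (~ unramified_ext /\ conductor_exponent ext_integers wK chi (2 * s)%N /\
     (r <= s)%N /\
     exists (k : GL2 F) (u : Pi'), [/\ GL2O k, level_vector w r s u,
       iota @^-1` conj_Eichler_order k s = conductor_order s &
       v = rep_act k u]).

End Torus.
End PrincipalSeries.

Arguments integers {R p Qp} F.
Arguments ext_integers {R p Qp F} K.

(* Main.v *)
From HB Require Import structures.
From mathcomp Require Import all_boot all_order all_algebra all_field.
From mathcomp Require Import all_classical all_reals.
From mathcomp Require Import complex zify ring lra.
Require Import Defs.

Set Implicit Arguments.
Unset Strict Implicit.
Unset Printing Implicit Defensive.

Import Order.TTheory GRing.Theory Num.Theory.

Local Open Scope classical_set_scope.
Local Open Scope ring_scope.

(** The line of T-equivariant functionals is realised by an integral. As K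
    is a field, its nonzero elements embed in GL_2(F) with bottom rows
    filling F^2 minus 0, so that GL_2(F) = B T for the upper triangular
    subgroup B (torus_borel), and a vector f of the principal series is
    determined by its restriction to T. The group T / F^* is compact, and
    f(iota x) / chi(x) is a locally constant function on it; its mean value
    is an equivariant functional (torus_integral). Any other equivariant
    functional l' factors through it, because averaging f over T inside the
    representation gives a vector whose restriction to T is determined by
    that mean (equivariant_kernel). It remains to see that the integral
    does not vanish at the given vector, and since nu_2 o det restricted to
    T is nu_2 o N (det_iota), this may be checked for Pi' and chi'
    (twist_torus_integral).

    Let u be the vector of level s, let r be the conductor exponent of
    omega' and let g be in GL_2(O) with lower row (c, d) and upper left
    entry a. Since B(s) acts on both sides by omega', u(g) = 0 unless g
    lies in B(r), by comparing two ways of writing an element of a double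
    coset (level_lower_eq0, level_support); on B(r) one has u(g) =
    omega'(a) phi(v(c)), with phi constant from s on. If s = r then phi(s)
    is nonzero, as u is. If s > r then phi(s) and phi(s - 1) differ:
    otherwise u would already transform by omega' under B(s - 1) on the
    left, hence lie in the part of Ind_B(s) which comes from lower levels
    and from which the space of u is complementary (level_drop,
    level_vector_properties).

    The character psi(x) = omega'(a(iota x)) / chi'(x) of the elements of T
    which lie in B(s - 1) is trivial on those lying in B(s), and if s > r
    it is nontrivial, exactly because the conductor of chi' is the expected
    one (psi_trivial, psi_nontrivial). Write h(x) = u(iota x) / chi'(x) as
    (phi(s) - phi(s - 1)) times the indicator function of the elements of
    level s, plus a remainder. Translation by an element y of level s - 1
    with psi(y) <> 1 multiplies the remainder by psi(y), so that the
    remainder has mean 0 and the mean of h is a nonzero multiple of the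
    measure of a nonempty open set (nonvanishing_drop; for s = r the
    remainder itself is zero, nonvanishing_minimal).

    Levels are computed from an element theta with O_K = O + O theta for
    which the lower left entry of iota theta has minimal valuation. This
    entry is a unit if K/F is unramified, and also after conjugating by k
    if the conductor is 2s; in the remaining case theta is a uniformizer of
    K and the entry has valuation 1 (unramified_generator,
    conductor_order_generator, iota_uniformizer). The translation by k is
    harmless: for the conjugate torus, k = b t with b in B and t in T, so
    it multiplies the integral by a nonzero scalar
    (nonvanishing_translate).

    For the existence of test vectors, the conductor exponent of chi' has
    the required form since chi' restricts to omega' on F^* and, if K/F is
    ramified, units of K congruent to 1 modulo P_K^(2j) become congruent to
    1 modulo P_K^(2j+1) after division by such units of F (trivial_on_base,
    no_odd_conductor); the Weyl element may serve as k
    (weyl_conductor_order). A vector of level s is obtained from the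
    function supported on B(s), by subtracting its average over B(s) \ B(s
    - 1); the kernel of that average is the required complement
    (exists_level_vector). *)

(** * Residues of p-adic integers *)

Section PadicAbs.
Variables (R : realType) (p : nat) (Qp : padicField R p).
Implicit Types x y z : Qp.

Let p_pr : prime p := padic_prime Qp.
Let p_gt0 : (0 < p%:R :> R). Proof. by rewrite ltr0n prime_gt0. Qed.

Lemma padic_abs0 : padic_abs (0 : Qp) = 0.
Proof. by apply/padic_abs_eq0. Qed.

Lemma padic_absN x : padic_abs (- x) = padic_abs x.
Proof. by rewrite -mulN1r padic_absM padic_absN1 mul1r. Qed.

Lemma padic_absB x y : padic_abs (x - y) <= Num.max (padic_abs x) (padic_abs y).
Proof. by rewrite -(padic_absN y) padic_absD. Qed.

Lemma padic_absX x n : padic_abs (x ^+ n) = padic_abs x ^+ n.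
Proof.
by elim: n => [|n IH]; rewrite ?padic_abs1 // !exprS padic_absM IH.
Qed.

Lemma padic_abs_p : padic_abs (p%:R : Qp) = p%:R^-1.
Proof.
rewrite padic_abs_nat ?prime_gt0 // -[X in logn p X]expn1 pfactorK //.
Qed.

Lemma padic_p_neq0 : (p%:R : Qp) != 0.
Proof.
apply/eqP => p0; have := padic_abs_p; rewrite p0 padic_abs0 => /eqP.
by rewrite eq_sym invr_eq0 (gt_eqF p_gt0).
Qed.

Lemma invp_lt1 : (p%:R^-1 < 1 :> R).
Proof. by rewrite invf_lt1 // ltr1n prime_gt1. Qed.

Lemma padic_abs_nat_le1 n : padic_abs (n%:R : Qp) <= 1.
Proof.
case: n => [|n]; first by rewrite padic_abs0.
rewrite padic_abs_nat // invf_le1 ?exprn_gt0 //.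
by rewrite exprn_ege1 // ler1n prime_gt0.
Qed.

Lemma padic_abs_nat1 n : ~~ (p %| n)%N -> padic_abs (n%:R : Qp) = 1.
Proof.
case: n => [|n]; first by rewrite dvdn0.
by move=> pn; rewrite padic_abs_nat // lognE p_pr /= (negPf pn) expr0 invr1.
Qed.

Lemma padic_abs_natp n : (p %| n)%N -> padic_abs (n%:R : Qp) <= p%:R^-1.
Proof.
move=> /dvdnP[m ->]; rewrite natrM padic_absM padic_abs_p.
by rewrite ler_piMl ?invr_ge0 ?padic_abs_nat_le1 // ltW.
Qed.

Lemma padic_abs_lep x : padic_abs x <= p%:R^-1 ->
  exists2 y, padic_abs y <= 1 & x = p%:R * y.
Proof.
move=> xp; exists (x / p%:R); last by rewrite mulrC divfK ?padic_p_neq0.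
rewrite -(ler_pM2r (x := p%:R^-1)) ?invr_gt0 // -{1}padic_abs_p -padic_absM.
by rewrite divfK ?padic_p_neq0 // mul1r.
Qed.

Lemma padic_abs_sum (I : Type) (r : seq I) (P : pred I) (f : I -> Qp) (M : R) :
  0 <= M -> (forall i, P i -> padic_abs (f i) <= M) ->
  padic_abs (\sum_(i <- r | P i) f i) <= M.
Proof.
move=> M0 fM; elim/big_ind: _ => [|x y xM yM|//]; first by rewrite padic_abs0.
by apply: le_trans (padic_absD _ _) _; rewrite ge_max xM yM.
Qed.

(** The residue field has p elements: by density x is close to a rational of
    absolute value at most 1, whose denominator is then prime to p and can be
    inverted modulo p. *)
Lemma padic_residue x : padic_abs x <= 1 ->
  exists2 n : nat, (n < p)%N & padic_abs (x - n%:R) <= p%:R^-1.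
Proof.
move=> x1; have pV0 : 0 < p%:R^-1 :> R by rewrite invr_gt0.
have [q qx] := padic_dense x pV0.
have q1 : padic_abs (ratr q : Qp) <= 1.
  have -> : ratr q = x - (x - ratr q) by ring.
  apply: le_trans (padic_absB _ _) _.
  by rewrite ge_max x1; apply/ltW/(lt_trans qx)/invp_lt1.
suff [n np nq] : exists2 n : nat, (n < p)%N & padic_abs (ratr q - n%:R : Qp) <= p%:R^-1.
  exists n => //; rewrite -(subrKA (ratr q)).
  by apply: le_trans (padic_absD _ _) _; rewrite ge_max nq ltW.
have nz (m : nat) : (0 < m)%N -> padic_abs (m%:R : Qp) != 0.
  by move=> m0; rewrite padic_abs_nat // invr_eq0 expf_neq0 // gt_eqF.
set b := `|denq q|%N; have b0 : (0 < b)%N by rewrite absz_gt0 denq_neq0.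
have bE : (denq q)%:~R = b%:R :> Qp.
  by rewrite /b -[in LHS](gez0_abs (ltW (denq_gt0 q))).
have bnz : (b%:R : Qp) != 0.
  by apply/eqP => bq0; have := nz _ b0; rewrite bq0 padic_abs0 eqxx.
pose a := `|numq q|%N.
have aE : ratr q = (-1) ^+ (numq q < 0)%R * (a%:R / b%:R) :> Qp.
  rewrite /ratr bE mulrA; congr (_ / _).
  by rewrite [in LHS](intEsign (numq q)) intrM rmorph_sign.
have absa : padic_abs (a%:R / b%:R : Qp) <= 1.
  have := q1; rewrite aE padic_absM padic_absX padic_absN1 expr1n mul1r //.
(* Numerator and denominator are coprime, so that p cannot divide the latter
   without making the absolute value exceed 1. *)
have pb : ~~ (p %| b)%N.
  apply/negP => pb; have pa : ~~ (p %| a)%N.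
    apply/negP => pa; have := coprime_num_den q.
    have : (p %| gcdn a b)%N by rewrite dvdn_gcd pa pb.
    rewrite /coprime => /[swap] /eqP ->; rewrite dvdn1 => /eqP p1.
    by move: p_pr; rewrite p1.
  have := absa; rewrite padic_absM padic_abs_nat1 // mul1r => bi.
  have bb : padic_abs (b%:R : Qp)^-1 * padic_abs (b%:R : Qp) = 1.
    by rewrite -padic_absM mulVf // padic_abs1.
  have := padic_abs_natp pb; have := invp_lt1.
  move=> h1 h2; have := le_lt_trans h2 h1 => h3.
  have : padic_abs (b%:R : Qp)^-1 * padic_abs (b%:R : Qp) < 1.
    apply: le_lt_trans h3; rewrite ler_piMl // padic_abs_ge0 //.
  by rewrite bb ltxx.
have [c cb] : exists c : nat, (b * c = 1 %[mod p])%N.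
  have : coprime b p by rewrite coprime_sym prime_coprime.
  move=> /eqP cbp; case: (egcdnP p b0) => c d e _.
  by exists c; rewrite mulnC e cbp modnMDl.
(* The numerator is taken up to sign; p - 1 stands for -1 modulo p. *)
pose sn := if (numq q < 0)%R then (p.-1 * a * c)%N else (a * c)%N.
exists (sn %% p)%N; first by rewrite ltn_mod prime_gt0.
have key (m : nat) : padic_abs ((m%:R : Qp) - (m %% p)%:R) <= p%:R^-1.
  rewrite {1}(divn_eq m p) natrD addrK; exact/padic_abs_natp/dvdn_mull.
have key2 (m n : nat) : m = n %[mod p] -> padic_abs ((m%:R : Qp) - n%:R) <= p%:R^-1.
  move=> mn; rewrite -(subrKA (m %% p)%:R) {2}mn.
  apply: le_trans (padic_absD _ _) _; rewrite ge_max key /=.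
  by rewrite -padic_absN opprB key.
apply: (@le_trans _ _ (padic_abs (b%:R * (ratr q - (sn %% p)%:R) : Qp))).
  by rewrite padic_absM padic_abs_nat1 // mul1r.
have -> : b%:R * (ratr q - (sn %% p)%:R) =
   (-1) ^+ (numq q < 0)%R * a%:R - (b * (sn %% p))%:R :> Qp.
  by rewrite mulrBr natrM aE; field.
rewrite /sn; case: ifP => _.
  rewrite expr1 mulN1r -padic_absN opprB opprK -natrD.
  apply: padic_abs_natp; rewrite /dvdn -modnDml modnMmr.
  have -> : (b * (p.-1 * a * c) = (b * c) * (p.-1 * a))%N by ring.
  rewrite -modnMml cb modnMml mul1n modnDml -{2}(mul1n a) -mulnDl addn1 prednK ?prime_gt0 //.
  by rewrite modnMr.
rewrite expr0 mul1r; apply: key2; rewrite modnMmr.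
have -> : (b * (a * c) = (b * c) * a)%N by ring.
by rewrite -[in RHS]modnMml cb modnMml mul1n.
Qed.
End PadicAbs.

(** * Integers of a finite extension of the p-adic numbers *)

Section FiniteExtension.
Variables (R : realType) (p : nat) (Qp : padicField R p) (L : fieldExtType Qp).
Local Notation O := (integers L).

Let p_pr : prime p := padic_prime Qp.

Lemma integers_nat n : O n%:R. Proof. exact: ring_of_integers_nat. Qed.
Lemma integers0 : O 0. Proof. exact: integers_nat 0. Qed.
Lemma integers1 : O 1. Proof. exact: integers_nat 1. Qed.
Lemma integersD x y : O x -> O y -> O (x + y).
Proof. exact: ring_of_integersD. Qed.
Lemma integersB x y : O x -> O y -> O (x - y).
Proof. exact: ring_of_integersB. Qed.
Lemma integersM x y : O x -> O y -> O (x * y).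
Proof. exact: ring_of_integersM. Qed.
Lemma integersZ a x : padic_abs a <= 1 -> O x -> O (a *: x).
Proof.
by move=> a1 Ox; rewrite -mulr_algl; apply: integersM => //; apply: ring_of_integers_embed.
Qed.
Lemma integersX x n : O x -> O (x ^+ n).
Proof.
move=> Ox; elim: n => [|n IH]; first exact: integers1.
by rewrite exprS; apply: integersM.
Qed.
Lemma integers_sum (I : Type) (r : seq I) (P : pred I) (f : I -> L) :
  (forall i, P i -> O (f i)) -> O (\sum_(i <- r | P i) f i).
Proof. by move=> Of; elim/big_ind: _ => //; [exact: integers0 | exact: integersD]. Qed.

Lemma p_neq0 : (p%:R : L) != 0.
Proof.
have := padic_p_neq0 Qp; rewrite -(inj_eq (fmorph_inj (in_alg L))) rmorph0.
by rewrite rmorph_nat.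
Qed.

(** A monic equation of degree d for 1/p, multiplied by p^d, would show that 1
    is divisible by p in the p-adic integers. *)
Lemma pinv_not_integer : ~ O p%:R^-1.
Proof.
move=> [q mon_q]; set x := p%:R^-1 : Qp.
have -> : p%:R^-1 = in_alg L x by rewrite fmorphV rmorph_nat.
rewrite map_poly_comp /root horner_map fmorph_eq0.
set q1 := map_poly _ q => q10.
have mon1 : q1 \is monic.
  by apply: monic_map; rewrite ?inE //.
have absq i : padic_abs q1`_i <= 1.
  rewrite coef_map; exact: (valP (q`_i)).
pose d := (size q1).-1.
have sq : size q1 = d.+1 by rewrite prednK // lt0n size_poly_eq0 monic_neq0.
move: q10; rewrite horner_coef sq big_ord_recr /= -[d in q1`_d]/(size q1).-1.
rewrite -lead_coefE (monicP mon1) mul1r addrC addr_eq0 => /eqP e.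
have : padic_abs (1 : Qp) <= p%:R^-1.
  have -> : 1 = - \sum_(i < d) q1`_i * p%:R ^+ (d - i) :> Qp.
    transitivity (p%:R ^+ d * x ^+ d).
      by rewrite -exprMn mulfV ?padic_p_neq0 // expr1n.
    rewrite e mulrN; congr (- _); rewrite mulr_sumr; apply: eq_bigr => i _.
    rewrite mulrCA; congr (_ * _).
    have -> : p%:R ^+ d = p%:R ^+ (d - i) * p%:R ^+ i :> Qp.
      by rewrite -exprD subnK // ltnW.
    by rewrite exprVn mulfK // expf_neq0 // padic_p_neq0.
  rewrite padic_absN; apply: padic_abs_sum => [|i _]; first by rewrite invr_ge0.
  rewrite padic_absM -[X in _ <= X]mul1r ler_pM ?padic_abs_ge0 //.
  rewrite -natrX; apply: padic_abs_natp; apply: dvdn_exp => //.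
  by rewrite subn_gt0.
by rewrite padic_abs1 leNgt (invp_lt1 Qp).
Qed.

(** If x were divisible by all powers of p, then multiplying a quotient by a
    denominator of 1/x would make 1/p integral. *)
Lemma integers_p_separated (x : L) : x != 0 -> ~ forall n, O (x / p%:R ^+ n).
Proof.
move=> x0 Ox; have [a Oa] := integers_bounded x^-1.
apply: pinv_not_integer; have := integersM Oa (Ox a.+1).
congr integers; rewrite exprS; field.
by rewrite p_neq0 x0 expf_neq0 // p_neq0.
Qed.

(** Linear independence in O / pO over the field with p elements, whose
    elements are represented by natural numbers. *)
Definition indep_mod_p (X : seq L) := forall n : nat -> nat,
  (exists2 z, O z & \sum_(i < size X) (n i)%:R * X`_i = p%:R * z) ->
  forall i, (i < size X)%N -> (p %| n i)%N.

(** A nontrivial relation over the p-adic numbers can be scaled so that its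
    largest coefficient is 1; modulo p it remains a nontrivial relation. *)
Lemma indep_mod_p_free (X : seq L) :
  (forall x, x \in X -> O x) -> indep_mod_p X -> free X.
Proof.
move=> OX iX; rewrite -[X]/(tval (in_tuple X)); apply/freeP => k k0.
apply: contrapT => /existsNP[i0 /eqP ki0].
have [im _ kmax] := @arg_maxP _ R 'I_(size X) i0 predT (fun i => padic_abs (k i)) isT.
have km j : padic_abs (k j) <= padic_abs (k im) by apply: kmax.
have km0 : k im != 0.
  apply/eqP => km0; have := km i0; rewrite km0 padic_abs0.
  by rewrite le_eqVlt ltNge padic_abs_ge0 orbF => /eqP/padic_abs_eq0/eqP; rewrite (negPf ki0).
pose k' i := k i / k im.
have k'1 i : padic_abs (k' i) <= 1.
  rewrite -(ler_pM2r (x := padic_abs (k im))).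
    by rewrite -padic_absM divfK // mul1r km.
  by rewrite lt_neqAle padic_abs_ge0 andbT eq_sym; apply/eqP => /padic_abs_eq0/eqP; rewrite (negPf km0).
have /choice[n nP] i : exists n : nat, padic_abs (k' i - n%:R) <= p%:R^-1.
  by have [n _ nP] := padic_residue (k'1 i); exists n.
have /choice[z zP] i : exists z, padic_abs z <= 1 /\ k' i - (n i)%:R = p%:R * z.
  by have [z] := padic_abs_lep (nP i); exists z.
have k'0 : \sum_(i < size X) k' i *: X`_i = 0.
  rewrite -[RHS](scaler0 _ (k im)^-1) -[in RHS]k0 scaler_sumr.
  by apply: eq_bigr => i _; rewrite scalerA mulrC.
pose N i := if insub i is Some j then n j else 0%N.
have NE (i : 'I_(size X)) : N i = n i by rewrite /N valK.
have OXi (i : 'I_(size X)) : O X`_i by apply/OX/mem_nth.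
have /dvdnP[m pm] : (p %| N im)%N.
  apply: iX (ltn_ord im).
  exists (- \sum_(i < size X) z i *: X`_i).
    rewrite -sub0r; apply: integersB; first exact: integers0.
    by apply: integers_sum => i _; apply: integersZ => //; case: (zP i).
  rewrite mulrN; apply/eqP; rewrite -addr_eq0 mulr_sumr -big_split /= -[X in _ == X]k'0.
  apply/eqP/eq_bigr => i _; rewrite NE -[in RHS](subrK (n i)%:R (k' i)) (proj2 (zP i)).
  by rewrite scalerDl addrC -scalerA; congr (_ + _); rewrite scaler_nat mulr_natl.
have := nP im; rewrite -NE pm natrM -/(k' im) /k' divff //.
move=> h; have : padic_abs (1 : Qp) <= p%:R^-1.
  rewrite -(subrK (m%:R * p%:R) 1); apply: le_trans (padic_absD _ _) _.
  by rewrite ge_max h -natrM padic_abs_natp ?dvdn_mull.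
by rewrite padic_abs1 leNgt (invp_lt1 Qp).
Qed.

(** Families independent modulo p have at most [L : Q_p] elements, and one with
    the largest number of elements generates O / pO over the field with p
    elements. *)
Lemma finite_residue_p : exists c : seq L,
  forall x, O x -> exists2 y, y \in c & exists2 z, O z & x = y + p%:R * z.
Proof.
pose P m := `[< exists X : seq L,
   [/\ size X = m, forall x, x \in X -> O x & indep_mod_p X] >].
have P0 : exists m, P m.
  by exists 0%N; apply/asboolP; exists [::].
have Pb m : P m -> (m <= \dim {:L})%N.
  move=> /asboolP[X [<- OX iX]]; have := indep_mod_p_free OX iX.
  by rewrite /free => /eqP <-; apply/dimvS/subvf.
have /asboolP[X [sX OX iX]] : P (ex_maxn P0 Pb) by case: ex_maxnP.
have maxX m : P m -> (m <= size X)%N by rewrite sX; case: ex_maxnP => ? _; apply.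
exists [seq \sum_(i < size X) ((f i : 'I_p) : nat)%:R * X`_i |
          f : {ffun 'I_(size X) -> 'I_p}] => x Ox.
have [n [[z Oz e] [i ix ni]]] : exists n : nat -> nat,
   (exists2 z, O z & \sum_(i < (size X).+1) (n i)%:R * (rcons X x)`_i = p%:R * z) /\
   exists2 i, (i < (size X).+1)%N & ~ (p %| n i)%N.
  apply: contrapT => nix; suff : P (size X).+1 by move/maxX; rewrite ltnn.
  apply/asboolP; exists (rcons X x); split; first by rewrite size_rcons.
    by move=> y; rewrite mem_rcons inE => /orP[/eqP ->|/OX].
  rewrite /indep_mod_p size_rcons => n nz i ix; apply: contrapT => ni.
  by apply: nix; exists n; split => //; exists i.
move: e; rewrite big_ord_recr /= nth_rcons ltnn eqxx.
rewrite (eq_bigr (fun i : 'I_(size X) => (n i)%:R * X`_i)); last first.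
  by move=> j _; rewrite /= nth_rcons ltn_ord.
set m := n (size X) => e.
have OXi (k : 'I_(size X)) : O X`_k by apply/OX/mem_nth.
have pm : ~~ (p %| m)%N.
  apply/negP => /dvdnP[m' Dm]; apply: ni.
  have iX' := iX n; move: ix; rewrite ltnS leq_eqVlt => /orP[/eqP ->|ix].
    by apply/dvdnP; exists m'.
  apply: iX' => //; exists (z - m'%:R * x).
    by apply: integersB => //; apply: integersM => //; apply: integers_nat.
  by rewrite mulrBr -e Dm natrM; ring.
have [c cm] : exists c : nat, exists b, (c * m = 1 + b * p)%N.
  have : coprime m p by rewrite coprime_sym prime_coprime.
  move=> /eqP cbp; have m0 : (0 < m)%N by case: (m) pm; rewrite ?dvdn0.
  by case: (egcdnP p m0) => c d e' _; exists c, d; rewrite e' cbp addnC.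
case: cm => b cm.
(* In the relation n_0 X_0 + ... + m x = p z the coefficient m is prime to p;
   multiplying by -c, where c is an inverse of m modulo p, expresses x. *)
pose N i := (p.-1 * c * n i)%N.
have ltp k : (k %% p < p)%N by rewrite ltn_mod prime_gt0.
pose f := [ffun i : 'I_(size X) => Ordinal (ltp (N i))].
exists (\sum_(i < size X) ((f i : 'I_p) : nat)%:R * X`_i).
  by apply/mapP; exists f; rewrite ?mem_enum.
pose z' := \sum_(i < size X) ((N i %/ p)%:R * X`_i).
exists (c%:R * z - b%:R * x + z' - c%:R * \sum_(i < size X) (n i)%:R * X`_i).
  apply: integersB; last first.
    apply: integersM; first exact: integers_nat.
    by apply: integers_sum => j _; apply: integersM => //; apply: integers_nat.
  apply: integersD; last first.
    by apply: integers_sum => j _; apply: integersM => //; apply: integers_nat.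
  by apply: integersB; apply: integersM => //; apply: integers_nat.
have E1 : \sum_(i < size X) ((f i : 'I_p) : nat)%:R * X`_i + p%:R * z' =
   (p.-1 * c)%:R * \sum_(i < size X) (n i)%:R * X`_i.
  rewrite !mulr_sumr -big_split /=; apply: eq_bigr => j _.
  rewrite ffunE /= !mulrA -!natrM -mulrDl -natrD; congr (_%:R * _).
  by rewrite addnC mulnC -divn_eq.
set S := \sum_(i < size X) (n i)%:R * X`_i in e E1 *.
have E2 : p%:R = 1 + p.-1%:R :> L by rewrite addrC natr1 prednK ?prime_gt0.
have E3 : c%:R * m%:R = 1 + b%:R * p%:R :> L by rewrite -!natrM cm natrD.
rewrite natrM in E1.
set A := \sum_(i < _) _ in E1 *.
transitivity (A + p%:R * z' + c%:R * (p%:R * z) - b%:R * p%:R * x - p%:R * c%:R * S).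
  rewrite E1 -e {2}E2.
  have -> : (1 + p.-1%:R) * c%:R * S = c%:R * S + p.-1%:R * c%:R * S by ring.
  rewrite (_ : c%:R * (S + m%:R * x) = c%:R * S + c%:R * m%:R * x); last by ring.
  rewrite E3; ring.
ring.
Qed.

Lemma finite_residue_pX n : exists c : seq L,
  forall x, O x -> exists2 y, y \in c & exists2 z, O z & x = y + p%:R ^+ n * z.
Proof.
elim: n => [|n [c IH]].
  exists [:: 0] => x Ox; exists 0; rewrite ?inE //; exists x => //.
  by rewrite expr0 mul1r add0r.
have [c1 c1P] := finite_residue_p.
exists [seq y + p%:R ^+ n * z | y <- c, z <- c1] => x /IH[y yc [z Oz ->]].
have [y1 y1c [z1 Oz1 ->]] := c1P z Oz.
exists (y + p%:R ^+ n * y1); first exact: allpairs_f.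
by exists z1 => //; rewrite exprSr; ring.
Qed.

Section Uniformizer.
Variable w : L.
Hypothesis uw : uniformizer O w.

Lemma uniformizer_neq0 : w != 0. Proof. by case: uw. Qed.

Lemma nonunitP x : (O x /\ ~ integer_units O x) <-> exists2 y, O y & x = w * y.
Proof.
case: uw => _ /seteqP[h1 h2]; split.
  by move/h1 => [y Oy ->]; exists y; rewrite ?expr1.
by move=> [y Oy ->]; apply: h2; exists y; rewrite ?expr1.
Qed.

Lemma integer_units1 : integer_units O 1.
Proof. by split; rewrite ?invr1 ?oner_neq0 //; apply: integers1. Qed.

Lemma uniformizer_integer : O w.
Proof.
by case: (proj2 (nonunitP w)) => //; exists 1; rewrite ?mulr1 //; apply: integers1.
Qed.

(** Otherwise 1 would be a multiple of w, hence not a unit. *)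
Lemma one_sub_nonunit y : O y -> integer_units O (1 - w * y).
Proof.
move=> Oy; apply: contrapT => nu.
have [|z Oz e] := proj1 (nonunitP (1 - w * y)).
  split=> //; apply: integersB; first exact: integers1.
  by apply: integersM => //; apply: uniformizer_integer.
case: (proj2 (nonunitP 1)) => [|_]; last by apply; exact: integer_units1.
exists (y + z); first exact: integersD.
by rewrite mulrDr -e addrC subrK.
Qed.

(** As O / pO is finite, two powers of w are congruent modulo p, and their
    difference is w^i times the unit 1 - w^(j - i). *)
Lemma uniformizer_pow_p : exists i, exists2 z, O z & w ^+ i = p%:R * z.
Proof.
have [c cP] := finite_residue_p.
have /choice[k kP] (i : 'I_(size c).+1) : exists k : 'I_(size c),
    exists2 z, O z & w ^+ i = c`_k + p%:R * z.
  have [y yc e] := cP _ (integersX i uniformizer_integer).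
  by have := yc; rewrite -index_mem => lt; exists (Ordinal lt); rewrite /= nth_index.
have [i [j [ij kij]]] : exists i j : 'I_(size c).+1, (i < j)%N /\ k i = k j.
  have : ~~ injectiveb k.
    apply/negP => /injectiveP/leq_card; rewrite !card_ord ltnn //.
  move=> /injectivePn[i [j ij e]].
  have [lt|lt|e'] := ltngtP i j; first by exists i, j.
    by exists j, i.
  by move: ij; rewrite (val_inj e') eqxx.
have [z Oz e] := kP i; have [z' Oz' e'] := kP j.
have dij : w ^+ i * (1 - w * w ^+ (j - i).-1) = p%:R * (z - z').
  rewrite mulrBr mulr1 -exprS prednK ?subn_gt0 // -exprD subnKC; last exact: ltnW.
  by rewrite e e' kij; ring.
have [_ u0 Ou] := one_sub_nonunit (integersX (j - i).-1 uniformizer_integer).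
exists i, ((z - z') / (1 - w * w ^+ (j - i).-1)).
  by apply: integersM => //; apply: integersB.
by rewrite mulrA -dij mulfK.
Qed.

(** A nonunit is divisible by w, and the division by w has to stop: a power of
    w being divisible by p, x would otherwise be divisible by all powers of p.
    *)
Lemma integer_decomposition x : O x -> x != 0 ->
  exists n, exists2 u, integer_units O u & x = w ^+ n * u.
Proof.
move=> Ox x0; apply: contrapT => H.
have div n : exists2 y, O y & x = w ^+ n * y.
  elim: n => [|n [y Oy e]]; first by exists x; rewrite ?expr0 ?mul1r.
  have [|z Oz ez] := proj1 (nonunitP y).
    by split=> // uy; apply: H; exists n, y.
  by exists z => //; rewrite e ez exprSr mulrA.
have [i [z Oz e]] := uniformizer_pow_p.
apply: (integers_p_separated x0) => m.
have [y Oy ->] := div (i * m)%N.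
rewrite exprM e exprMn (_ : _ / _ = z ^+ m * y).
  by apply: integersM => //; apply: integersX.
by rewrite mulrC -mulrA mulKf // expf_neq0 // p_neq0.
Qed.

Lemma integer_unitsM u v : integer_units O u -> integer_units O v ->
  integer_units O (u * v).
Proof.
move=> [Ou u0 Ou'] [Ov v0 Ov']; split; rewrite ?mulf_neq0 ?invfM //; exact: integersM.
Qed.
Lemma integer_unitsV u : integer_units O u -> integer_units O u^-1.
Proof. by move=> [Ou u0 Ou']; split; rewrite ?invr_eq0 ?invrK. Qed.
(** Some multiple of x by a power of p is integral. *)
Lemma uniformizer_decomposition x : x != 0 ->
  exists n : int, exists2 u, integer_units O u & x = w ^ n * u.
Proof.
move=> x0; have [a Oa] := integers_bounded x.
have pa0 : (p%:R : L) ^+ a != 0 by rewrite expf_neq0 // p_neq0.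
have [n [u Uu e]] := integer_decomposition Oa (mulf_neq0 pa0 x0).
have [m [v Uv e']] := integer_decomposition (integersX a (integers_nat p)) pa0.
exists (n%:Z - m%:Z), (u / v); first exact/integer_unitsM/integer_unitsV.
rewrite expfzDr ?uniformizer_neq0 // -invr_expz -!exprnP.
apply: (mulfI pa0); rewrite e e'; case: Uv => _ v0 _; field.
by rewrite v0 expf_neq0 ?uniformizer_neq0.
Qed.

End Uniformizer.
End FiniteExtension.

(** * The norm and the normalized absolute value *)

Section Norm.
Variables (k : fieldType) (L : fieldExtType k).
Local Notation e := (vbasis {:L}).
Local Notation mulmat x := (passmx.mxof e e (amulr x)).
Let eb : basis_of {:L} e := vbasisP {:L}.

Lemma mulmatM (x y : L) : mulmat (x * y) = mulmat x *m mulmat y.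
Proof.
rewrite -(passmx.mxof_comp e e eb); congr passmx.mxof.
by apply/lfunP => z; rewrite comp_lfunE !lfunE /= mulrA.
Qed.

Lemma mulmat1 : mulmat (1 : L) = 1%:M.
Proof.
rewrite -(passmx.mxof1 (basis_free eb)); congr passmx.mxof.
by apply/lfunP => z; rewrite !lfunE /= mulr1.
Qed.

Lemma field_normM (x y : L) : field_norm (x * y) = field_norm x * field_norm y.
Proof. by rewrite /field_norm mulmatM det_mulmx. Qed.

Lemma field_norm1 : field_norm (1 : L) = 1.
Proof. by rewrite /field_norm mulmat1 det1. Qed.

Lemma field_normX (x : L) n : field_norm (x ^+ n) = field_norm x ^+ n.
Proof.
elim: n => [|n IH]; first exact: field_norm1.
by rewrite !exprS field_normM IH.
Qed.

Lemma field_norm_eq0 (x : L) : x != 0 -> field_norm x != 0.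
Proof.
move=> x0; apply/eqP => n0; have := field_norm1.
by rewrite -(mulfV x0) field_normM n0 mul0r => /esym/eqP; rewrite oner_eq0.
Qed.
End Norm.

Section NormAbs.
Import passmx.
Variables (R : realType) (p : nat) (Qp : padicField R p) (L : fieldExtType Qp).
Local Notation O := (integers L).
Local Notation e := (vbasis {:L}).
Local Notation mulmat x := (passmx.mxof e e (amulr x)).

(** The ultrametric inequality applied to the Leibniz formula. *)
Lemma padic_abs_det n (M : 'M[Qp]_n) (C : R) : 0 <= C ->
  (forall i j, padic_abs (M i j) <= C) -> padic_abs (\det M) <= C ^+ n.
Proof.
move=> C0 MC; apply: padic_abs_sum => [|s _]; first exact: exprn_ge0.
rewrite padic_absM padic_absX padic_absN1 expr1n mul1r.
rewrite (big_morph _ (@padic_absM _ _ Qp) (padic_abs1 Qp)).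
rewrite -[n in C ^+ n]card_ord -prodr_const; apply: ler_prod => i _.
by rewrite padic_abs_ge0 MC.
Qed.

(** The powers of x stay in a finitely generated module: x^m is the value at x
    of the remainder of X^m modulo a monic equation of x. *)
Lemma integer_powers (x : L) : O x -> exists n, forall m, exists2 c : nat -> Qp,
  (forall i, padic_abs (c i) <= 1) & x ^+ m = \sum_(i < n) c i *: x ^+ i.
Proof.
move=> [q mon_q qx]; exists (size q).-1 => m.
pose r := Pdiv.Ring.rmodp 'X^m q.
exists (fun i => padic_int_val r`_i) => [i|]; first exact: (valP r`_i).
have e1 := Pdiv.RingMonic.rdivp_eq mon_q 'X^m.
have := congr1 (fun s => (map_poly (in_alg L \o @padic_int_val R p Qp) s).[x]) e1.
rewrite rmorphD rmorphM /= hornerD hornerM (rootP qx) mulr0 add0r.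
rewrite rmorphXn /= map_polyX hornerXn => ->.
rewrite (horner_coef_wide (n := (size q).-1)); last first.
  apply: leq_trans (size_poly _ _) _; rewrite -ltnS prednK.
    by rewrite Pdiv.Ring.ltn_rmodpN0 // monic_neq0.
  by rewrite lt0n size_poly_eq0 monic_neq0.
apply: eq_bigr => i _; rewrite -mulr_algl; congr (_ * _).
by rewrite coef_map.
Qed.

(** Bernoulli's inequality. *)
Lemma pow_unbounded (a C : R) : 1 < a -> exists n, C < a ^+ n.
Proof.
move=> a1; have b n : 1 + n%:R * (a - 1) <= a ^+ n.
  elim: n => [|n IH]; first by rewrite mul0r addr0 expr0.
  rewrite exprS; apply: le_trans (_ : a * (1 + n%:R * (a - 1)) <= _); last first.
    by rewrite ler_pM2l // (lt_trans ltr01).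
  rewrite -natr1; have n0 : 0 <= n%:R :> R by [].
  have := mulr_ge0 n0 (sqr_ge0 (a - 1)); rewrite expr2; lra.
exists (Num.bound (`|C| / (a - 1))).+1; apply: lt_le_trans (b _).
set N := Num.bound _; have := archi_boundP (divr_ge0 (normr_ge0 C) (ltW (_ : 0 < a - 1))).
rewrite subr_gt0 -/N => /(_ a1); rewrite ltr_pdivrMr ?subr_gt0 // -natr1.
have := ler_norm C; nra.
Qed.

Lemma normalized_abs_ge0 (x : L) : 0 <= normalized_abs x.
Proof. exact: padic_abs_ge0. Qed.

Lemma normalized_absM (x y : L) :
  normalized_abs (x * y) = normalized_abs x * normalized_abs y.
Proof. by rewrite /normalized_abs field_normM padic_absM. Qed.

Lemma normalized_abs1 : normalized_abs (1 : L) = 1.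
Proof. by rewrite /normalized_abs field_norm1 padic_abs1. Qed.

Lemma normalized_abs_gt0 (x : L) : x != 0 -> 0 < normalized_abs x.
Proof.
move=> /field_norm_eq0 x0; rewrite lt_neqAle normalized_abs_ge0 andbT eq_sym.
by apply/eqP => /padic_abs_eq0/eqP; rewrite (negPf x0).
Qed.

(** By the preceding lemma the matrices of multiplication by x^m have bounded
    entries, so that the determinants N(x)^m are bounded; hence |N(x)| is at
    most 1. *)
Lemma normalized_abs_integer (x : L) : O x -> normalized_abs x <= 1.
Proof.
move=> Ox; rewrite leNgt; apply/negP => x1.
have [n xn] := integer_powers Ox.
pose C := \big[Num.max/0]_(i < n) \big[Num.max/0]_(st : 'I__ * 'I__)
  padic_abs (mulmat (x ^+ i) st.1 st.2).
have C0 : 0 <= C by apply: bigmax_ge_id.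
have [m] := pow_unbounded (C ^+ \dim {:L}) x1; apply/negP; rewrite -leNgt.
rewrite /normalized_abs -padic_absX -field_normX.
apply: padic_abs_det => // s t; have [c c1 ->] := xn m.
rewrite !linear_sum /= summxE; apply: padic_abs_sum => // i _.
rewrite !linearZ mxE padic_absM -[C]mul1r ler_pM ?padic_abs_ge0 //.
apply: (le_trans _ (le_bigmax_cond _ _ (isT : xpredT i))) => //=.
exact: (le_bigmax_cond _ (fun st => padic_abs (mulmat (x ^+ i) st.1 st.2)) (isT : xpredT (s, t))).
Qed.

Lemma normalized_abs_unit (u : L) : integer_units O u -> normalized_abs u = 1.
Proof.
move=> [Ou u0 Ou']; apply/eqP; rewrite eq_le normalized_abs_integer //=.
rewrite -(ler_pM2l (normalized_abs_gt0 (_ : u^-1 != 0))) ?invr_eq0 //.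
by rewrite -normalized_absM mulVf // normalized_abs1 mulr1 normalized_abs_integer.
Qed.
End NormAbs.

(** * Discrete valuations with finite residue rings *)

(** The facts about the ring of integers on which everything below relies; they
    are collected in one predicate since they are used both for F and for K,
    where the ring of integers is defined from different embeddings of Q_p. *)
Record dvr (L : fieldType) (O : set L) (w : L) (p : nat) : Prop := Dvr {
  dvr_one : O 1;
  dvrB : forall x y, O x -> O y -> O (x - y);
  dvrM : forall x y, O x -> O y -> O (x * y);
  dvr_neq0 : w != 0;
  dvr_w : O w;
  dvr_wV : ~ O w^-1;
  dvr_dec : forall x, x != 0 ->
    exists n : int, exists2 u, integer_units O u & x = w ^ n * u;
  dvr_p_neq0 : p%:R != 0 :> L;
  dvr_p : O p%:R;
  dvr_pV : ~ O p%:R^-1;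
  dvr_finite : forall n, exists c : seq L, forall x, O x ->
    exists2 y, y \in c & exists2 z, O z & x = y + w ^+ n * z }.

Section Dvr.
Variables (L : fieldType) (O : set L) (w : L) (p : nat) (D : dvr O w p).
Implicit Types (x y z u : L) (n m : int).

(** The exponent of w in a decomposition, with the arbitrary value 0 at 0. *)
Definition dval x : int :=
  if pselect (x != 0) is left h then sval (cid (dvr_dec D h)) else 0.

Let w0 : w != 0 := dvr_neq0 D.
Let O1 : O 1 := dvr_one D.
Lemma dvr0 : O 0. Proof. by rewrite -(subrr 1); apply: (dvrB D). Qed.
Lemma dvrN x : O x -> O (- x).
Proof. by move=> Ox; rewrite -sub0r; apply: (dvrB D) => //; apply: dvr0. Qed.
Lemma dvrD x y : O x -> O y -> O (x + y).
Proof. by move=> Ox Oy; rewrite -(opprK y); apply: (dvrB D) => //; apply: dvrN. Qed.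
Lemma dvrX x k : O x -> O (x ^+ k).
Proof. by move=> Ox; elim: k => [|k IH]; rewrite ?expr0 // exprS; apply: (dvrM D). Qed.

Lemma unitsM u v : integer_units O u -> integer_units O v -> integer_units O (u * v).
Proof.
move=> [Ou u0 Ou'] [Ov v0 Ov']; split; rewrite ?mulf_neq0 ?invfM //; exact: (dvrM D).
Qed.
Lemma unitsV u : integer_units O u -> integer_units O u^-1.
Proof. by move=> [Ou u0 Ou']; split; rewrite ?invr_eq0 ?invrK. Qed.

Lemma valE x : x != 0 -> exists2 u, integer_units O u & x = w ^ dval x * u.
Proof. by move=> x0; rewrite /dval; case: pselect => // h; case: cid. Qed.

Lemma unit_pow n : integer_units O (w ^ n) -> n = 0.
Proof.
have pos k : ~ integer_units O (w ^+ k.+1).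
  move=> [_ _ Ok]; apply: (dvr_wV D).
  have -> : w^-1 = w ^+ k * w ^- k.+1 by rewrite exprS invfM mulrCA mulfV ?mulr1 ?expf_neq0.
  by apply: (dvrM D) => //; apply: dvrX (dvr_w D).
case: n => [[//|k]|k]; first by move/pos.
by rewrite NegzE -invr_expz => /unitsV; rewrite invrK => /pos.
Qed.

Lemma val_uniq n u : integer_units O u -> dval (w ^ n * u) = n.
Proof.
move=> Uu; have [_ u0 _] := Uu; have x0 : w ^ n * u != 0 by rewrite mulf_neq0 ?expfz_neq0.
have [v Uv] := valE x0; move: (dval _) => m e; have [_ v0 _] := Uv.
apply/eqP; rewrite -subr_eq0; apply/eqP/unit_pow.
rewrite expfzDr // -invr_expz -(mulfK v0 (w ^ m)) -e mulrAC [_ * u]mulrC.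
rewrite mulfK ?expfz_neq0 //; exact/unitsM/unitsV.
Qed.

Lemma valM x y : x != 0 -> y != 0 -> dval (x * y) = dval x + dval y.
Proof.
move=> /valE[u Uu e] /valE[v Uv f]; rewrite {1}e {1}f mulrACA -expfzDr //.
by rewrite val_uniq //; apply: unitsM.
Qed.

Lemma units1 : integer_units O 1.
Proof. by split; rewrite ?invr1 ?oner_neq0. Qed.

Lemma val1 : dval 1 = 0. Proof. by rewrite -(mulr1 1) -(expr0z w) val_uniq //; apply: units1. Qed.
Lemma valw : dval w = 1. Proof. by rewrite -{1}(mulr1 w) -{1}(expr1z w) val_uniq //; apply: units1. Qed.
Lemma valwz n : dval (w ^ n) = n. Proof. by rewrite -(mulr1 (_ ^ _)) val_uniq //; apply: units1. Qed.
Lemma valwX k : dval (w ^+ k) = k%:Z. Proof. exact: (valwz k). Qed.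
Lemma valV x : x != 0 -> dval x^-1 = - dval x.
Proof.
move=> x0; apply/eqP; rewrite -addr_eq0 -valM ?invr_eq0 //.
by rewrite mulVf // val1.
Qed.
Lemma valX x k : x != 0 -> dval (x ^+ k) = k%:Z * dval x.
Proof.
move=> x0; elim: k => [|k IH]; first by rewrite expr0 val1 mul0r.
by rewrite exprS valM ?expf_neq0 // IH; lia.
Qed.
Lemma val_unit u : integer_units O u -> dval u = 0.
Proof. by move=> Uu; rewrite -(mul1r u) -(expr0z w) val_uniq. Qed.

Lemma unitE x : x != 0 -> dval x = 0 -> integer_units O x.
Proof. by move=> /valE[u Uu e] v0; rewrite e v0 expr0z mul1r. Qed.

Lemma integer_val x : x != 0 -> O x <-> 0 <= dval x.
Proof.
move=> x0; have [u Uu e] := valE x0; have [Ou u0 Ou'] := Uu; split.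
  move=> Ox; rewrite leNgt; apply/negP => xneg; apply: (dvr_wV D).
  have Ov : O (w ^ dval x) by rewrite -(mulfK u0 (w ^ _)) -e; apply: (dvrM D).
  have -> : w^-1 = w ^+ (`|dval x|%N).-1 * w ^ dval x.
    rewrite -[w^-1]/(w ^ (-1)) -[w ^+ _]/(w ^ (_ : nat)%:Z) -expfzDr //; congr (_ ^ _); lia.
  by apply: (dvrM D) => //; apply: dvrX (dvr_w D).
rewrite [X in O X]e; case: (dval x) => // n _; rewrite -exprnP; apply: (dvrM D) => //; exact: dvrX (dvr_w D).
Qed.

(** Membership in w^n O for a possibly negative n; the premise makes 0 belong
    to all of these ideals in spite of its arbitrary valuation. *)
Definition vge n x := x != 0 -> n <= dval x.

Lemma vge0 n : vge n 0. Proof. by rewrite /vge eqxx. Qed.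
Lemma vge_neq0 n x : x != 0 -> vge n x -> n <= dval x. Proof. by move=> x0; apply. Qed.

Lemma vge_integer x : vge 0 x <-> O x.
Proof.
have [->|x0] := eqVneq x 0; first by split=> // _; [apply: dvr0|apply: vge0].
by split=> [/(_ x0) /(integer_val x0)|Ox _] //; apply/integer_val.
Qed.

Lemma vge_shift n x : vge n x <-> O (x / w ^ n).
Proof.
rewrite -vge_integer /vge; have [->|x0] := eqVneq x 0; first by rewrite mul0r eqxx.
have v : dval (x / w ^ n) = dval x - n by rewrite valM ?invr_eq0 ?expfz_neq0 // valV ?expfz_neq0 // valwz.
rewrite mulf_neq0 ?invr_eq0 ?expfz_neq0 // v; split=> /(_ isT) h _; lia.
Qed.

Lemma vgeB n x y : vge n x -> vge n y -> vge n (x - y).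
Proof. by rewrite !vge_shift mulrBl; apply: (dvrB D). Qed.
Lemma vgeD n x y : vge n x -> vge n y -> vge n (x + y).
Proof. by rewrite !vge_shift mulrDl; apply: dvrD. Qed.
Lemma vgeN n x : vge n x -> vge n (- x).
Proof. by rewrite !vge_shift mulNr; apply: dvrN. Qed.
Lemma vgeM n m x y : vge n x -> vge m y -> vge (n + m) (x * y).
Proof.
rewrite /vge => hx hy; rewrite mulf_eq0 negb_or => /andP[x0 y0].
by rewrite valM // lerD ?hx ?hy.
Qed.
Lemma vge_le n m x : n <= m -> vge m x -> vge n x.
Proof. by move=> nm h x0; apply: le_trans nm (h x0). Qed.
Lemma vgeMl n x y : vge n x -> O y -> vge n (x * y).
Proof. by move=> h /vge_integer k; have := vgeM h k; rewrite addr0. Qed.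
Lemma vgeMr n x y : O x -> vge n y -> vge n (x * y).
Proof. by move=> h k; rewrite mulrC; apply: vgeMl. Qed.

(** Isosceles triangle principle. *)
Lemma vge_near n x y : ~ vge n x -> vge n (y - x) -> y != 0 /\ dval y = dval x.
Proof.
move=> nx yx.
have x0 : x != 0 by apply/eqP => x0; apply: nx; rewrite x0; apply: vge0.
have vx : dval x < n by rewrite ltNge; apply/negP => h; apply: nx.
have y0 : y != 0.
  apply/eqP => y0; apply: nx; rewrite -[x]opprK; apply: vgeN.
  by move: yx; rewrite y0 add0r.
split=> //; apply/eqP; rewrite eq_le; apply/andP; split.
  rewrite leNgt; apply/negP => lt.
  have : vge (dval x + 1) (y - (y - x)).
    by apply: vgeB; [move=> _; lia|apply: vge_le yx; lia].
  by rewrite subKr => /(_ x0); lia.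
have : vge (dval x) (x + (y - x)).
  by apply: vgeD; [move=> _|apply: vge_le yx; lia].
by rewrite [x + _]addrC subrK; apply.
Qed.

Lemma ideal_powerE k x : ideal_power O w k x <-> vge k%:Z x.
Proof.
rewrite vge_shift; split=> [[y Oy ->]|h].
  by rewrite mulrC mulKf // expf_neq0.
by exists (x / w ^+ k) => //; rewrite mulrC divfK // expf_neq0.
Qed.

Lemma unitP x : integer_units O x <-> [/\ x != 0 & dval x = 0].
Proof.
split=> [h|[x0 v]]; first by split; [case: h|apply: val_unit].
exact: unitE.
Qed.

Lemma unitP2 x : integer_units O x <-> O x /\ ~ vge 1 x.
Proof.
split=> [|[Ox nv]].
  by move=> /unitP[x0 v]; split; [apply/vge_integer => _; rewrite v|move=> /(_ x0); rewrite v].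
have x0 : x != 0 by apply/eqP => x0; apply: nv; rewrite x0; apply: vge0.
apply/unitP; split => //; have := proj1 (integer_val x0) Ox.
have : ~~ (1 <= dval x) by apply/negP => h; apply: nv => _.
lia.
Qed.

Lemma vgeZ_unit n u x : integer_units O u -> vge n (u * x) <-> vge n x.
Proof.
move=> Uu; have [u0 v] := proj1 (unitP u) Uu; rewrite /vge mulf_eq0 (negPf u0) /=.
by split=> h x0; have := h x0; rewrite valM // v add0r.
Qed.

Lemma units_add u x : integer_units O u -> vge 1 x -> integer_units O (u + x).
Proof.
move=> /unitP2[Ou nu] vx; apply/unitP2; split.
  by apply: dvrD => //; apply/vge_integer/(vge_le _ vx).
by move=> h; apply: nu; rewrite -(addrK x u); apply: vgeB.
Qed.

Lemma unit_filtrationE k u : (0 < k)%N ->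
  unit_filtration O w k u <-> vge k%:Z (u - 1).
Proof.
move=> k0; rewrite /unit_filtration /= ideal_powerE; split=> [[]//|h]; split=> //.
rewrite -(subrK 1 u) addrC; apply: units_add; first exact: units1.
apply: vge_le h; lia.
Qed.

Lemma val_p_gt0 : 0 < dval p%:R.
Proof.
have p0 := dvr_p_neq0 D.
have := proj1 (integer_val p0) (dvr_p D).
rewrite le_eqVlt => /orP[/eqP v0|//]; case: (dvr_pV D).
by apply/integer_val; rewrite ?invr_eq0 // valV // -v0.
Qed.

Lemma ideal_power_pE k x : ideal_power O p%:R k x <-> vge (k%:Z * dval p%:R) x.
Proof.
have pk0 : (p%:R : L) ^+ k != 0 by rewrite expf_neq0 // (dvr_p_neq0 D).
split=> [[y Oy ->]|h].
  by rewrite -valX ?(dvr_p_neq0 D) //; apply: vgeMl.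
exists (x / p%:R ^+ k); last by rewrite mulrC divfK.
apply/vge_integer => y0; rewrite valM ?invr_eq0 //; last first.
  by apply: contraNneq y0 => ->; rewrite mul0r.
have x0 : x != 0 by apply: contraNneq y0 => ->; rewrite mul0r.
by rewrite valV // valX ?(dvr_p_neq0 D) // subr_ge0 h.
Qed.

Lemma ideal_power_p_vge k x : ideal_power O p%:R k x -> vge k%:Z x.
Proof. move=> /ideal_power_pE; apply: vge_le; have := val_p_gt0; nia. Qed.

Lemma vge_ideal_power_p k : exists2 m : nat, (0 < m)%N & forall x, vge m%:Z x -> ideal_power O p%:R k x.
Proof.
exists (k * `|dval p%:R|).+1%N => // x h; apply/ideal_power_pE; apply: vge_le h.
have := val_p_gt0; lia.
Qed.

Lemma unit_filtration_pE k u : (0 < k)%N ->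
  unit_filtration O p%:R k u <-> ideal_power O p%:R k (u - 1).
Proof.
move=> k0; rewrite /unit_filtration /=; split=> [[]//|h]; split=> //.
have := ideal_power_p_vge h => /(unit_filtrationE _ k0)[] //.
Qed.
End Dvr.

(** Residues modulo w^n are covered by those modulo a power of p divisible by
    w^n. *)
Lemma dvr_integers (R : realType) (p : nat) (Qp : padicField R p)
    (L : fieldExtType Qp) (w : L) : uniformizer (integers L) w ->
  dvr (integers L) w p.
Proof.
move=> uw; have Ow := uniformizer_integer uw; split=> //.
- exact: integers1.
- exact: integersB.
- exact: integersM.
- exact: uniformizer_neq0.
- move=> OwV; case: (proj2 (nonunitP uw w)) => [|_]; last by apply; split=> //; apply: uniformizer_neq0.
  by exists 1; rewrite ?mulr1 //; apply: integers1.
- exact: uniformizer_decomposition.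
- exact: p_neq0.
- exact: integers_nat.
- exact: pinv_not_integer.
move=> n; have [N [z Oz pz]] : exists N, exists2 z, integers L z & p%:R ^+ N = w ^+ n * z.
  have p0 : p%:R != 0 :> L by apply: p_neq0.
  have [m [u Uu e']] := integer_decomposition uw (integers_nat L p) p0.
  have m0 : (0 < m)%N.
    case: m e' => // e'; case: (@pinv_not_integer _ _ _ L).
    by rewrite e' expr0 mul1r; case: Uu.
  exists n, (w ^+ ((m - 1) * n) * u ^+ n).
    apply: integersM; first exact: integersX.
    by apply: integersX; case: Uu.
  rewrite e' exprMn -exprM mulrA -exprD; congr (_ ^+ _ * _).
  by rewrite -{1}(subnK m0) mulnDl mul1n addnC.
have [c cP] := finite_residue_pX L N; exists c => x Ox.
have [y yc [t Ot ->]] := cP x Ox; exists y => //; exists (z * t).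
  exact: integersM.
by rewrite pz mulrA.
Qed.

(** K is itself a finite extension of Q_p, with the same integers. *)
Lemma dvr_ext_integers (R : realType) (p : nat) (Qp : padicField R p)
    (F : fieldExtType Qp) (K : fieldExtType F) (w : K) :
  uniformizer (ext_integers K) w -> dvr (ext_integers K) w p.
Proof.
move=> uw.
have E : ext_integers K = integers (baseFieldType K) :> set K.
  rewrite /ext_integers /integers /ring_of_integers.
  suff -> : (in_alg (baseFieldType K) \o @padic_int_val R p Qp : _ -> K) =
      ((in_alg K \o in_alg F) \o @padic_int_val R p Qp) by [].
  by apply/funext => a; apply: baseField_scaleE.
move: uw; rewrite E => uw.
exact: (@dvr_integers _ _ _ (baseFieldType K)).
Qed.

(** * Means over finite sets of classes *)

Section FiniteMean.
Variables (X : Type) (A : set X) (E : X -> X -> Prop) (C : numFieldType).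
Hypotheses (Esym : forall x y, E x y -> E y x)
  (Etrans : forall x y z, E x y -> E y z -> E x z).

Definition transversal n (r : 'I_n -> X) : Prop :=
  [/\ forall i, A (r i), forall i j, E (r i) (r j) -> i = j &
      forall x, A x -> exists i, E x (r i)].

(** Among the given representatives c_i keep those whose class meets A and such
    that no earlier one has the same class, and move them into A. *)
Lemma transversal_exists m (c : 'I_m -> X) :
  (forall x, A x -> exists i, E x (c i)) ->
  exists n, exists r : 'I_n -> X, transversal r.
Proof.
move=> cP.
pose good i x := A x /\ E x (c i).
pose isgood i := `[< exists x, good i x >].
(* The unit summand stands for the indices whose class does not meet A: there
   may be no default element of X. *)
have /choice[a aP] i : exists x : X + unit, isgood i -> if x is inl x then good i x else False.
  case: (pselect (exists x, good i x)) => [[x gx]|ng]; first by exists (inl x).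
  by exists (inr tt) => /asboolP.
have aP' i : isgood i -> exists2 x, a i = inl x & good i x.
  by move/aP; case: (a i) => // x; exists x.
pose S := [set i : 'I_m | isgood i && [forall j : 'I_m, (j < i)%N ==> isgood j ==>
   ~~ `[< exists x y, [/\ a j = inl x, a i = inl y & E x y] >]]]%SET.
have /choice[r rP] (k : 'I_#|S|) : exists x, a (enum_val k) = inl x /\ good (enum_val k) x.
  have := enum_valP k; rewrite inE => /andP[/aP'[x ax gx] _]; by exists x.
exists #|S|, r; split=> [k|k l Ekl|x Ax].
- by have [_ []] := rP k.
- apply: enum_val_inj; apply: ord_inj.
  have [lt|lt|//] := ltngtP (enum_val k) (enum_val l).
    have := enum_valP l; rewrite inE => /andP[_ /forallP/(_ (enum_val k))].
    rewrite lt /=; have [al gl] := rP l; have [ak gk] := rP k.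
    rewrite (_ : isgood _); last by apply/asboolP; exists (r k).
    by move=> /negP; case; apply/asboolP; exists (r k), (r l).
  have := enum_valP k; rewrite inE => /andP[_ /forallP/(_ (enum_val l))].
  rewrite lt /=; have [al gl] := rP l; have [ak gk] := rP k.
  rewrite (_ : isgood _); last by apply/asboolP; exists (r l).
  move=> /negP; case; apply/asboolP; exists (r l), (r k); split => //; exact: Esym.
have [i0 Ei0] := cP x Ax.
pose Q i := isgood i && `[< exists2 y, a i = inl y & E x y >].
have Qi0 : Q i0.
  have g0 : isgood i0 by apply/asboolP; exists x.
  rewrite /Q g0; apply/asboolP; have [y ay [_ Ey]] := aP' _ g0; exists y => //.
  exact/(Etrans Ei0)/Esym.
have [i /andP[gi /asboolP[y ay Exy]] imin] := arg_minnP (fun i : 'I_m => i : nat) Qi0.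
have iS : i \in S.
  rewrite inE gi; apply/forallP => j; apply/implyP => ji; apply/implyP => gj.
  apply/negP => /asboolP[z [y' [az ay' Ezy]]].
  move: ay'; rewrite ay => -[yy]; rewrite -yy in Ezy.
  have : Q j by rewrite /Q gj; apply/asboolP; exists z => //; apply/(Etrans Exy)/Esym.
  by move/imin; rewrite leqNgt ji.
exists (enum_rank_in iS i); have [] := rP (enum_rank_in iS i).
by rewrite enum_rankK_in // ay => -[<-].
Qed.

Definition mean n (r : 'I_n -> X) (f : X -> C) : C :=
  n%:R^-1 * \sum_(i < n) f (r i).

Lemma mean_comb n (r : 'I_n -> X) (a : C) (f g : X -> C) :
  mean r (fun x => a * f x + g x) = a * mean r f + mean r g.
Proof. by rewrite /mean big_split /= -mulr_sumr mulrDr mulrCA. Qed.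

Lemma eq_mean n (r : 'I_n -> X) (f g : X -> C) : transversal r ->
  (forall x, A x -> f x = g x) -> mean r f = mean r g.
Proof. by move=> [Ar _ _] fg; congr (_ * _); apply: eq_bigr => i _; apply: fg. Qed.

Variables (n : nat) (r : 'I_n -> X).
Hypothesis rT : transversal r.

Lemma transversal_gt0 x : A x -> (0 < n)%N.
Proof. by case: rT => _ _ rc /rc[i _]; apply: leq_ltn_trans (ltn_ord i). Qed.

Lemma mean_const x (a : C) : A x -> mean r (fun=> a) = a.
Proof.
move=> /transversal_gt0 n0; rewrite /mean sumr_const card_ord -[a *+ n]mulr_natl.
by rewrite mulKf // pnatr_eq0 -lt0n.
Qed.

(** A map which is injective on classes permutes the finitely many classes. *)
Lemma mean_shift (s : X -> X) (f : X -> C) :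
  (forall x, A x -> A (s x)) ->
  (forall x y, A x -> A y -> E (s x) (s y) -> E x y) ->
  (forall x y, A x -> A y -> E x y -> f x = f y) ->
  mean r (fun x => f (s x)) = mean r f.
Proof.
move=> As Es fE; have [Ar rinj rc] := rT.
have /choice[k kP] i : exists j, E (s (r i)) (r j) by apply/rc/As.
have kinj : injective k.
  move=> i j kij; apply: rinj; apply: Es => //.
  by apply: Etrans (kP i) _; rewrite kij; apply: Esym.
congr (_ * _); rewrite [RHS](reindex_inj kinj).
by apply: eq_bigr => i _; apply: fE (kP i) => //; apply: As.
Qed.

(** The mean of an indicator function is a sum of nonnegative terms, one of
    which is positive. *)
Lemma mean_indicator (f : X -> C) x : (forall x, f x = 0 \/ f x = 1) ->
  (forall x y, A x -> A y -> E x y -> f x = f y) -> A x -> f x = 1 -> mean r f != 0.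
Proof.
move=> f01 fE Ax fx; have [Ar rinj rc] := rT.
rewrite mulf_neq0 ?invr_eq0 ?pnatr_eq0 -?lt0n ?(transversal_gt0 Ax) //.
have f0 y : 0 <= f y by case: (f01 y) => ->.
have [i Ei] := rc x Ax; rewrite (bigD1 i) //= -(fE x (r i)) // fx.
by rewrite gt_eqF // ltr_wpDr ?ltr01 // sumr_ge0.
Qed.
End FiniteMean.

(** * Integration of locally constant functions on the torus modulo scalars *)

Section TorusMean.
Variables (F : fieldType) (K : fieldExtType F) (O : set K) (w : K) (p : nat).
Hypothesis D : dvr O w p.
Variable C : numFieldType.
Implicit Types (x y u : K) (z : F) (h : K -> C).

(** Equality in the quotient of K^* by F^* (1 + p^(n+1) O_K). These subgroups
    shrink to F^*, and the shift of n ensures that the elements 1 + p^(n+1) y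
    are units. *)
Definition torus_eqv (n : nat) x y := exists (z : F) (u : K),
  [/\ z != 0, unit_filtration O p%:R n.+1 u & x = in_alg K z * u * y].

Let vge := vge D.

Lemma unit_filtrationM n x y : unit_filtration O p%:R n.+1 x ->
  unit_filtration O p%:R n.+1 y -> unit_filtration O p%:R n.+1 (x * y).
Proof.
move=> [Ux Ix] [Uy Iy]; split; first exact: (unitsM D).
move: Ix Iy; rewrite !(ideal_power_pE D) => Ix Iy.
have -> : x * y - 1 = x * (y - 1) + (x - 1) by ring.
apply: vgeD => //; apply: vgeMr => //; by case: Ux.
Qed.

Lemma unit_filtrationV n x : unit_filtration O p%:R n.+1 x ->
  unit_filtration O p%:R n.+1 x^-1.
Proof.
move=> [Ux Ix]; split; first exact: (unitsV Ux).
move: Ix; rewrite !(ideal_power_pE D) => Ix; have [_ x0 OV] := Ux.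
have -> : x^-1 - 1 = x^-1 * - (x - 1) by field.
by apply: vgeMr => //; apply: vgeN.
Qed.

Lemma unit_filtration1 n : unit_filtration O p%:R n 1.
Proof.
split; first exact: (units1 D).
by rewrite subrr; exists 0; rewrite ?mulr0 //; apply: (dvr0 D).
Qed.

Lemma unit_filtration_le n m x : (n <= m)%N -> unit_filtration O p%:R m.+1 x ->
  unit_filtration O p%:R n.+1 x.
Proof.
move=> nm [Ux Ix]; split => //; move: Ix; rewrite !(ideal_power_pE D).
apply: vge_le; rewrite ler_pM2r ?val_p_gt0 //; lia.
Qed.

Lemma torus_eqv_sym n x y : torus_eqv n x y -> torus_eqv n y x.
Proof.
move=> [z [u [z0 Uu ->]]]; exists z^-1, u^-1; split; rewrite ?invr_eq0 //.
  exact: unit_filtrationV.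
have [[_ u0 _] _] := Uu; have iz : in_alg K z != 0 by rewrite fmorph_eq0.
rewrite fmorphV; field; exact/andP.
Qed.

Lemma torus_eqv_trans n x y t : torus_eqv n x y -> torus_eqv n y t -> torus_eqv n x t.
Proof.
move=> [z [u [z0 Uu ->]]] [z' [u' [z0' Uu' ->]]]; exists (z * z'), (u * u').
split; rewrite ?mulf_neq0 //; first exact: unit_filtrationM.
rewrite rmorphM; ring.
Qed.

Let nz : set K := [set x | x != 0].

(** The quotient is finite because it suffices to use powers of p, which lies
    in F, to bring the valuation of x into the interval from 0 to e - 1, where
    e is the valuation of p in K; then the residue of x modulo a high power of
    the uniformizer determines its class. *)
Lemma torus_transversal n : exists t : {m : nat & 'I_m -> K},
  transversal nz (torus_eqv n) (tagged t).
Proof.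
set e := dval D p%:R; have e0 : 0 < e := val_p_gt0 D.
(* Dividing by an element of valuation less than e costs at most e, whence the
   additional multiple of e. *)
set N : nat := absz ((n.+1%:Z + 1) * e)%R.
have NE : N%:Z = (n.+1%:Z + 1) * e by rewrite /N; nia.
have [c cP] := dvr_finite D N.
have [|m [r rT]] := @transversal_exists _ nz (torus_eqv n) (@torus_eqv_sym n)
  (@torus_eqv_trans n) (size c) (fun i => c`_i).
  move=> x x0.
  pose q := (dval D x %/ e)%Z; pose z : F := p%:R ^ (- q).
  have pF0 : p%:R != 0 :> F by rewrite -(fmorph_eq0 (in_alg K)) rmorph_nat; apply: (dvr_p_neq0 D).
  have z0 : z != 0 by rewrite expfz_neq0.
  have iz0 : in_alg K z != 0 by rewrite fmorph_eq0.
  have valz : dval D (in_alg K z) = - q * e.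
    have pos k : dval D (in_alg K (p%:R ^+ k)) = k%:Z * e.
      by rewrite rmorphXn rmorph_nat valX // (dvr_p_neq0 D).
    rewrite /z; case: (- q) => k; first exact: pos.
    by rewrite NegzE -invr_expz fmorphV valV ?fmorph_eq0 ?expf_neq0 // pos mulNr.
  set x' := in_alg K z * x; have x'0 : x' != 0 by rewrite mulf_neq0.
  have valx' : dval D x' = (dval D x %% e)%Z.
    by rewrite valM // valz /modz mulNr addrC.
  have x'e : dval D x' < e by rewrite valx' ltz_pmod.
  have [|y yc [t Ot et]] := cP x'.
    by apply/(integer_val D) => //; rewrite valx' modz_ge0 // gt_eqF.
  have vt : vge N%:Z (w ^+ N * t) by apply: vgeMl => //; move=> _; rewrite valwX.
  have y0 : y != 0.
    apply/eqP => y0; move: et; rewrite y0 add0r => et; move: vt; rewrite -et => /(_ x'0).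
    have : n.+1%:Z * e + e = N%:Z by rewrite NE; ring.
    have : 0 <= n.+1%:Z * e by apply: mulr_ge0 => //; apply: ltW.
    lia.
  have vy : dval D y < e.
    rewrite ltNge; apply/negP => vy; move: x'e; rewrite ltNge => /negP; apply.
    apply: (vge_neq0 (D := D) x'0); rewrite et; apply: vgeD; first by move=> _.
    apply: vge_le vt; rewrite NE.
    by rewrite mulrDl mul1r lerDr mulr_ge0 // ltW.
  have yi : (index y c < size c)%N by rewrite index_mem.
  exists (Ordinal yi); rewrite /= nth_index //.
  exists z^-1, (x' / y); split; rewrite ?invr_eq0 //; last first.
    rewrite fmorphV /x'; field; exact/andP.
  apply/(unit_filtration_pE D) => //; apply/(ideal_power_pE D).
  have -> : x' / y - 1 = w ^+ N * t * y^-1 by rewrite et; field.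
  have := vgeM vt (_ : vge (- dval D y) y^-1).
  move=> /(_ _)/(vge_le _); apply; last by move=> _; rewrite valV.
  rewrite NE; move: vy; rewrite -/e; lia.
by exists (Tagged (fun m => 'I_m -> K) r).
Qed.

Definition torus_smooth n h := forall x y, x != 0 -> torus_eqv n x y -> h x = h y.

Lemma torus_smooth_le n m h : (n <= m)%N -> torus_smooth n h -> torus_smooth m h.
Proof.
move=> nm hn x y x0 [z [u [z0 Uu e]]]; apply: hn => //.
exists z, u; split => //; exact: unit_filtration_le Uu.
Qed.

Definition level_mean n h : C := mean (tagged (sval (cid (torus_transversal n)))) h.

Lemma level_transversal n : transversal nz (torus_eqv n) (tagged (sval (cid (torus_transversal n)))).
Proof. by case: cid. Qed.

Lemma torus_smoothE n h : torus_smooth n h ->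
  forall x y, nz x -> nz y -> torus_eqv n x y -> h x = h y.
Proof. by move=> hn x y x0 _; apply: hn. Qed.

Lemma level_mean_shift n h t : t != 0 -> torus_smooth n h ->
  level_mean n (fun x => h (x * t)) = level_mean n h.
Proof.
move=> t0 hn; apply: (mean_shift (A := nz) (E := torus_eqv n)).
- exact: torus_eqv_sym.
- exact: torus_eqv_trans.
- exact: level_transversal.
- by move=> x x0; apply: mulf_neq0.
- move=> x y _ _ [z [u [z0 Uu e]]]; exists z, u; split=> //.
  by apply: (mulIf t0); rewrite e mulrA.
- exact: torus_smoothE.
Qed.

(** Each of the means is invariant under translations, and averaging one over
    the translations appearing in the other gives the same double sum. *)
Lemma level_mean_eq n m h : torus_smooth n h -> torus_smooth m h ->
  level_mean n h = level_mean m h.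
Proof.
move=> hn hm; have nz1 : nz 1 := oner_neq0 K.
have [Ar _ _] := level_transversal m; have [An _ _] := level_transversal n.
rewrite -(mean_const (level_transversal m) (level_mean n h) nz1).
rewrite -[RHS](mean_const (level_transversal n) _ nz1).
transitivity (mean (tagged (sval (cid (torus_transversal m))))
    (fun x => level_mean n (fun y => h (y * x)))).
  by apply: (eq_mean (level_transversal m)) => x x0; rewrite level_mean_shift.
transitivity (mean (tagged (sval (cid (torus_transversal n))))
    (fun y => level_mean m (fun x => h (x * y)))); last first.
  by apply: (eq_mean (level_transversal n)) => x x0; rewrite level_mean_shift.
rewrite /level_mean /mean !mulr_sumr; under eq_bigr do rewrite !mulr_sumr.
rewrite exchange_big /=; apply: eq_bigr => i _; rewrite !mulr_sumr.
by apply: eq_bigr => j _; rewrite mulrCA [X in h X]mulrC.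
Qed.

(** The invariant integral over the compact group K^* / F^*, of total mass 1.
    *)
Definition torus_mean h : C :=
  if pselect (exists n, torus_smooth n h) is left H then level_mean (sval (cid H)) h
  else 0.

Lemma torus_meanE n h : torus_smooth n h -> torus_mean h = level_mean n h.
Proof.
move=> hn; rewrite /torus_mean; case: pselect => [H|[]]; last by exists n.
by apply: level_mean_eq => //; case: cid.
Qed.

Lemma torus_mean_comb n a h h' : torus_smooth n h -> torus_smooth n h' ->
  torus_mean (fun x => a * h x + h' x) = a * torus_mean h + torus_mean h'.
Proof.
move=> hn h'n; rewrite !(@torus_meanE n) //; first exact: mean_comb.
by move=> x y x0 e; rewrite (hn x y) // (h'n x y).
Qed.

Lemma torus_mean_shift n h t : t != 0 -> torus_smooth n h ->
  torus_mean (fun x => h (x * t)) = torus_mean h.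
Proof.
move=> t0 hn; rewrite !(@torus_meanE n) //; first exact: level_mean_shift.
move=> x y x0 [z [u [z0 Uu e]]]; apply: hn; first exact: mulf_neq0.
by exists z, u; split=> //; rewrite e mulrA.
Qed.

Lemma eq_torus_mean n h h' : torus_smooth n h -> torus_smooth n h' ->
  (forall x, x != 0 -> h x = h' x) -> torus_mean h = torus_mean h'.
Proof.
move=> hn h'n e; rewrite !(@torus_meanE n) //.
exact: (eq_mean (level_transversal n)).
Qed.

Lemma torus_mean_indicator n h : torus_smooth n h -> (forall x, h x = 0 \/ h x = 1) ->
  h 1 = 1 -> torus_mean h != 0.
Proof.
move=> hn h01 h1; rewrite (torus_meanE hn).
apply: (mean_indicator (level_transversal n) h01 _ (oner_neq0 K) h1).
exact: torus_smoothE.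
Qed.

(** The invariance of the mean gives that it equals a times itself. *)
Lemma torus_mean_eq0 n h t a : torus_smooth n h -> t != 0 -> a != 1 ->
  (forall x, x != 0 -> h (x * t) = a * h x) -> torus_mean h = 0.
Proof.
move=> hn t0 a1 ht; apply/eqP; have := torus_mean_shift t0 hn.
have nz1 : nz 1 := oner_neq0 K.
have -> : torus_mean (fun x => h (x * t)) = a * torus_mean h.
  have h0 : torus_smooth n (fun=> 0) by [].
  rewrite (torus_meanE hn) -[RHS]addr0 -(mean_const (level_transversal n) 0 nz1).
  rewrite -mean_comb -/(level_mean n _) -(torus_meanE (n := n)).
    apply: (@eq_torus_mean n) => [x y x0 [z [u [z0 Uu e]]]|x y x0 e|x x0].
    - apply: hn; first exact: mulf_neq0.
      by exists z, u; split=> //; rewrite e mulrA.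
    - by rewrite (hn x y).
    - by rewrite addr0 ht.
  by move=> x y x0 e; rewrite (hn x y).
move/eqP; rewrite -subr_eq0 -[X in _ - X]mul1r -mulrBl mulf_eq0 subr_eq0.
by rewrite (negPf a1).
Qed.
Lemma torus_mean0 : torus_mean (fun=> 0) = 0.
Proof.
apply: (@torus_mean_eq0 0 _ 1 0); rewrite ?oner_neq0 //.
  by rewrite eq_sym oner_neq0.
by move=> x _; rewrite mul0r.
Qed.

Lemma torus_meanZ n a h : torus_smooth n h ->
  torus_mean (fun x => a * h x) = a * torus_mean h.
Proof.
move=> hn; have h0 : torus_smooth n (fun=> 0) by [].
rewrite -[RHS]addr0 -torus_mean0 -(torus_mean_comb a hn h0).
apply: (@eq_torus_mean n) => [x y x0 e|x y x0 e|x _]; last by rewrite addr0.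
  by rewrite (hn x y).
by rewrite (hn x y).
Qed.
End TorusMean.

(** * Two by two matrices *)

Lemma I2P (i : 'I_2) : i = 0 \/ i = 1.
Proof. by case: i => [[|[|//]] lt]; [left|right]; apply: val_inj. Qed.

(** Locked, so that products of explicit matrices are not unfolded by
    conversion. *)
HB.lock Definition mx2 (F : fieldType) (a b c d : F) : 'M[F]_2 :=
  \matrix_(i, j) if i == 0 then (if j == 0 then a else b) else (if j == 0 then c else d).

HB.lock Definition gl (F : fieldType) (a b c d : F) : GL2 F :=
  insubd (GL2_one F) (mx2 a b c d).

Arguments gl {F} (a b c d)%_ring_scope.

Section Matrices.
Variable F : fieldType.
Implicit Types (g h k : GL2 F) (a b c d : F).

Lemma mx2E a b c d : ((mx2 a b c d 0 0 = a) * (mx2 a b c d 0 1 = b) *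
  (mx2 a b c d 1 0 = c) * (mx2 a b c d 1 1 = d))%type.
Proof. by rewrite mx2.unlock !mxE. Qed.

Lemma mx2P (A B : 'M[F]_2) : A 0 0 = B 0 0 -> A 0 1 = B 0 1 -> A 1 0 = B 1 0 ->
  A 1 1 = B 1 1 -> A = B.
Proof.
move=> h00 h01 h10 h11; apply/matrixP => i j.
by have [->|->] := I2P i; have [->|->] := I2P j.
Qed.

Lemma mul22 (A B : 'M[F]_2) i j : (A *m B) i j = A i 0 * B 0 j + A i 1 * B 1 j.
Proof.
rewrite mxE !big_ord_recl big_ord0 addr0; congr (_ * _ + A i _ * B _ j); exact: val_inj.
Qed.

Lemma det_mx2 a b c d : \det (mx2 a b c d) = a * d - b * c.
Proof. by rewrite det_mx22 !mx2E. Qed.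

Lemma gl_mx a b c d : a * d - b * c != 0 -> GL2_mx (gl a b c d) = mx2 a b c d.
Proof.
by move=> h; rewrite gl.unlock [LHS]insubdK // -topredE /= unitmxE unitfE det_mx2.
Qed.

Lemma glE a b c d : a * d - b * c != 0 ->
  ((gl a b c d 0 0 = a) * (gl a b c d 0 1 = b) * (gl a b c d 1 0 = c) *
  (gl a b c d 1 1 = d))%type.
Proof. by move=> h; rewrite gl_mx // !mx2E. Qed.

Lemma gmulE g h i j : (g * h)%g i j = g i 0 * h 0 j + g i 1 * h 1 j.
Proof. exact: mul22. Qed.

Lemma gl2P g h : g 0 0 = h 0 0 -> g 0 1 = h 0 1 -> g 1 0 = h 1 0 ->
  g 1 1 = h 1 1 -> g = h.
Proof. by move=> *; apply: val_inj; apply: mx2P. Qed.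

Lemma det_gl g : \det g = g 0 0 * g 1 1 - g 0 1 * g 1 0.
Proof. exact: det_mx22. Qed.

Lemma gl_det_neq0 g : \det g != 0.
Proof. by rewrite -unitfE -unitmxE (valP g). Qed.

Lemma det_gl_neq0 g : g 0 0 * g 1 1 - g 0 1 * g 1 0 != 0.
Proof. by rewrite -det_gl gl_det_neq0. Qed.

Lemma g1E : (((1%g : GL2 F) 0%R 0%R = 1%R) * ((1%g : GL2 F) 0%R 1%R = 0%R) *
  ((1%g : GL2 F) 1%R 0%R = 0%R) * ((1%g : GL2 F) 1%R 1%R = 1%R))%type.
Proof. by rewrite /= !mxE. Qed.

Lemma ginvE g : ((g^-1%g 0%R 0%R = g 1 1 / \det g) *
  (g^-1%g 0%R 1%R = - g 0 1 / \det g) *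
  (g^-1%g 1%R 0%R = - g 1 0 / \det g) * (g^-1%g 1%R 1%R = g 0 0 / \det g))%type.
Proof.
have D0 : \det g != 0 := gl_det_neq0 g; have DE := det_gl g.
have dV : g 1 1 / \det g * (g 0 0 / \det g) -
    - g 0 1 / \det g * (- g 1 0 / \det g) != 0.
  rewrite (_ : _ - _ = (g 0 0 * g 1 1 - g 0 1 * g 1 0) / \det g / \det g); last ring.
  by rewrite -DE divff // mul1r invr_eq0.
suff -> : g^-1%g = gl (g 1 1 / \det g) (- g 0 1 / \det g) (- g 1 0 / \det g)
    (g 0 0 / \det g) by rewrite !(glE dV).
apply: (mulgI g); rewrite mulgV; apply: gl2P; rewrite ?g1E gmulE !(glE dV).
- rewrite -[LHS](divff D0) {1}DE; ring.
- ring.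
- ring.
- rewrite -[LHS](divff D0) {1}DE; ring.
Qed.

End Matrices.

HB.lock Definition lower (F : fieldType) (c : F) : GL2 F := gl 1 0 c 1.
Arguments lower {F} c%_ring_scope.

(** * Iwasawa decomposition and the groups B(s) *)

Section LocalGL2.
Variables (R : realType) (p : nat) (Qp : padicField R p) (F : fieldExtType Qp).
Variable w : F.
Local Notation O := (integers F).
Local Notation unit := (integer_units O).
Hypothesis D : dvr O w p.
Local Notation vge := (vge D).
Local Notation v := (dval D).
Implicit Types (g h k : GL2 F) (x y a b c d e : F).

Lemma unit_mul_l x y : O x -> O y -> unit (x * y) -> unit x.
Proof.
move=> Ox Oy [_]; rewrite mulf_eq0 negb_or => /andP[x0 y0] OV.
split=> //; rewrite (_ : x^-1 = y * (x * y)^-1); first exact: (dvrM D).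
by rewrite invfM mulrCA mulfV ?mulr1.
Qed.

Lemma unit_neq0 x : unit x -> x != 0. Proof. by case. Qed.
Lemma unit_int x : unit x -> O x. Proof. by case. Qed.
Lemma GL2O_int g i j : GL2O g -> O (g i j). Proof. by move=> /(_ i j)[]. Qed.

(** The inverse is integral by the adjugate formula. *)
Lemma GL2OP g : GL2O g <-> (forall i j, O (g i j)) /\ unit (\det g).
Proof.
have det_int h : (forall i j, O (h i j)) -> O (\det h).
  by move=> hO; rewrite det_gl; apply: (dvrB D); apply: (dvrM D).
split=> [gO|[gO [Od d0 OdV]]].
  split=> [i j|]; first by case: (gO i j).
  split; [by apply: det_int => i j; case: (gO i j) | exact: gl_det_neq0 |].
  by rewrite -det_inv; apply: (det_int g^-1%g) => i j; case: (gO i j).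
move=> i j; split; first exact: gO.
have [->|->] := I2P i; have [->|->] := I2P j; rewrite ginvE; apply: (dvrM D) => //;
  exact: (dvrN D).
Qed.

Lemma GL2O_det g : GL2O g -> unit (\det g). Proof. by move=> /GL2OP[]. Qed.

Lemma GL2OV g : GL2O g -> GL2O g^-1%g.
Proof. by move=> gO i j; rewrite invgK; case: (gO i j). Qed.

Lemma GL2O1 : GL2O (1%g : GL2 F).
Proof.
apply/GL2OP; split=> [i j|]; last by rewrite det1; apply: (units1 D).
rewrite mxE; case: (_ == _); [exact: dvr_one D|exact: (dvr0 D)].
Qed.

Lemma GL2OM g h : GL2O g -> GL2O h -> GL2O (g * h)%g.
Proof.
move=> /GL2OP[gO gd] /GL2OP[hO hd]; apply/GL2OP; split=> [i j|].
  by rewrite gmulE; apply: (dvrD D); apply: (dvrM D).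
by rewrite det_mulmx; apply: (unitsM D).
Qed.

Lemma GL2O_gl a b c d : O a -> O b -> O c -> O d -> unit (a * d - b * c) ->
  GL2O (gl a b c d).
Proof.
move=> Oa Ob Oc Od u; have n0 := unit_neq0 u; apply/GL2OP; split.
  by move=> i j; have [->|->] := I2P i; have [->|->] := I2P j; rewrite (glE n0).
by rewrite det_gl !(glE n0).
Qed.

Lemma BgroupP s g : Bgroup w s g <-> GL2O g /\ vge s%:Z (g 1 0).
Proof. by rewrite -(ideal_powerE D). Qed.

Lemma Bgroup_GL2O s g : Bgroup w s g -> GL2O g. Proof. by case. Qed.

Lemma Bgroup_le s t g : (s <= t)%N -> Bgroup w t g -> Bgroup w s g.
Proof.
move=> st /BgroupP[gO h]; apply/BgroupP; split=> //; apply: vge_le h; lia.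
Qed.

Lemma BgroupM s g h : Bgroup w s g -> Bgroup w s h -> Bgroup w s (g * h)%g.
Proof.
move=> /BgroupP[gO gs] /BgroupP[hO hs]; apply/BgroupP; split; first exact: GL2OM.
rewrite gmulE; apply: vgeD; first by apply: vgeMl => //; apply: GL2O_int.
by apply: vgeMr => //; apply: GL2O_int.
Qed.

Lemma BgroupV s g : Bgroup w s g -> Bgroup w s g^-1%g.
Proof.
move=> /BgroupP[gO gs]; apply/BgroupP; split; first exact: GL2OV.
rewrite ginvE; apply: vgeMl; first exact: vgeN.
by case: (GL2O_det gO).
Qed.

Lemma Bgroup_units s g : (0 < s)%N -> Bgroup w s g -> unit (g 0 0) /\ unit (g 1 1).
Proof.
move=> s0 /BgroupP[gO gs]; have ud := GL2O_det gO.
have u : unit (g 0 0 * g 1 1).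
  rewrite -(subrK (g 0 1 * g 1 0) (_ * _)) -det_gl; apply: (units_add (D := D)) => //.
  apply: vgeMr; [exact: GL2O_int|apply: vge_le gs; lia].
by split; [|rewrite mulrC in u]; apply: unit_mul_l u; apply: GL2O_int.
Qed.

Lemma upper_unip_GL2O x : O x -> GL2O (gl 1 x 0 1).
Proof.
by move=> Ox; apply: GL2O_gl; rewrite ?mulr0 ?subr0 ?mulr1 //; (try exact: (dvr_one D));
  (try exact: (dvr0 D)); exact: units1 D.
Qed.


Let lower_det c : 1 * 1 - 0 * c != 0 :> F.
Proof. by rewrite mul0r subr0 mulr1 oner_neq0. Qed.

Lemma lowerE c : ((lower c 0 0 = 1) * (lower c 0 1 = 0) * (lower c 1 0 = c) *
  (lower c 1 1 = 1))%type.
Proof. by rewrite lower.unlock !(glE (lower_det c)). Qed.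

Lemma lower_GL2O c : O c -> GL2O (lower c).
Proof.
move=> Oc; rewrite lower.unlock; apply: GL2O_gl => //; rewrite ?mul0r ?subr0 ?mulr1; (try exact: (dvr_one D));
  (try exact: (dvr0 D)); exact: units1 D.
Qed.

Lemma lower_Bgroup s c : vge s%:Z c -> Bgroup w s (lower c).
Proof.
move=> vc; apply/BgroupP; rewrite lowerE; split=> //; apply: lower_GL2O.
by apply/(vge_integer D)/(vge_le _ vc).
Qed.

(** It suffices to find k in GL_2(O) with the same bottom row as g up to a
    scalar; the scalar makes one entry 1 and the other integral. *)
Lemma iwasawa g : exists h k, [/\ h 1 0 = 0, GL2O k & g = (h * k)%g].
Proof.
suff [k kO e] : exists2 k, GL2O k & (g * k^-1)%g 1 0 = 0.
  by exists (g * k^-1)%g, k; rewrite mulgVK.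
have dg := det_gl_neq0 g.
have [c0|c0] := eqVneq (g 1 0) 0.
  by exists 1%g; [exact: GL2O1 | rewrite invg1 mulg1].
have [d0|d0] := eqVneq (g 1 1) 0.
  have n0 : 0 * 0 - 1 * -1 != 0 :> F by rewrite mulr0 mul1r opprK add0r oner_neq0.
  exists (gl 0 1 (-1) 0).
    apply: GL2O_gl; (try exact: (dvr_one D)); (try exact: (dvr0 D)).
      by apply: (dvrN D); exact: dvr_one D.
    by rewrite mulr0 mul1r opprK add0r; exact: units1 D.
  by rewrite gmulE !ginvE !(glE n0) d0; ring.
have Oc : v (g 1 0) <= v (g 1 1) \/ v (g 1 1) <= v (g 1 0) by lia.
have Odiv x y : x != 0 -> y != 0 -> v x <= v y -> O (y / x).
  by move=> x0 y0 le; apply/(vge_integer D) => _; rewrite valM ?invr_eq0 // valV // subr_ge0.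
case: Oc => le.
  have n0 : 0 * (g 1 1 / g 1 0) - - 1 * 1 = 1 :> F by ring.
  have n1 : 0 * (g 1 1 / g 1 0) - - 1 * 1 != 0 :> F by rewrite n0 oner_neq0.
  exists (gl 0 (-1) 1 (g 1 1 / g 1 0)).
    apply: GL2O_gl; rewrite ?n0; (try exact: (dvr_one D)); (try exact: (dvr0 D)).
    - by apply: (dvrN D); exact: dvr_one D.
    - exact: Odiv.
    - exact: units1 D.
  by rewrite gmulE !ginvE det_gl !(glE n1) n0; field; rewrite c0 oner_neq0.
exists (lower (g 1 0 / g 1 1)); first by apply: lower_GL2O; apply: Odiv.
by rewrite gmulE !ginvE det_gl !lowerE mul0r subr0; field; rewrite ?mulr1 ?oner_neq0 ?d0.
Qed.

End LocalGL2.

(** * Values of a vector of level s *)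

Section LevelVector.
Variables (R : realType) (p : nat) (Qp : padicField R p) (F : fieldExtType Qp).
Variable w : F.
Local Notation O := (integers F).
Local Notation unit := (integer_units O).
Hypothesis D : dvr O w p.
Local Notation vge := (vge D).
Local Notation v := (dval D).
Implicit Types (g h k : GL2 F) (x y a b c d e : F).

Variables (om : F -> R[i]) (r : nat).
Hypotheses (omM : {morph om : x y / x * y}) (om1 : om 1 = 1).
Hypotheses (r_gt0 : (0 < r)%N) (omr : trivial_on (unit_filtration O w r) om).

Lemma om_neq0 x : x != 0 -> om x != 0.
Proof.
move=> x0; apply/eqP => ox; have := om1; rewrite -(mulfV x0) omM ox mul0r => /esym/eqP.
by rewrite oner_eq0.
Qed.

Lemma om_near a x : unit a -> vge r%:Z (x - a) -> om x = om a.
Proof.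
move=> Ua h; have [_ a0 OaV] := Ua.
rewrite -[x](mulfVK a0) omM omr ?mul1r //.
apply/(unit_filtrationE D) => //.
rewrite (_ : x / a - 1 = (x - a) * a^-1); last by field.
exact: vgeMl.
Qed.

(** The upper left entry of a product differs from the product of the upper
    left entries by an element of P^s, and s is at least r: this is why omega
    is a character of B(s). *)
Lemma om_mul s g h : (r <= s)%N -> Bgroup w s g -> Bgroup w s h ->
  om ((g * h)%g 0%R 0%R) = om (g 0 0) * om (h 0 0).
Proof.
move=> rs gB hB; have s0 := leq_trans r_gt0 rs.
have [Ug _] := Bgroup_units D s0 gB; have [Uh _] := Bgroup_units D s0 hB.
rewrite -omM gmulE; apply: om_near; first exact: (unitsM D Ug Uh).
rewrite addrC addKr; apply: vgeMr; first exact: GL2O_int (Bgroup_GL2O gB).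
by have /(BgroupP D)[_] := hB; apply: vge_le; lia.
Qed.

Variables (u : GL2 F -> R[i]) (s : nat).
Hypothesis uB : forall h g, h 1 0 = 0 -> u (h * g)%g = om (h 0 0) *
  (Num.sqrt (normalized_abs (h 0 0 / h 1 1)))%:C%C * u g.
Hypothesis uL : forall h g, Bgroup w s h -> GL2O g ->
  u (h * g)%g = om (h 0 0) * u g.
Hypothesis uR : forall h g, Bgroup w s h -> u (g * h)%g = om (h 0 0) * u g.

(** An element with unit upper left entry is a lower unipotent matrix times an
    upper triangular one, and the latter belongs to all the groups B(s). *)
Lemma level_lower g : GL2O g -> unit (g 0 0) ->
  u g = om (g 0 0) * u (lower (g 1 0 / g 0 0)).
Proof.
move=> gO Ua; have [Oa a0 OaV] := Ua.
pose d := g 1 1 - g 0 1 * g 1 0 / g 0 0.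
have dE : g 0 0 * d - g 0 1 * 0 = \det g by rewrite det_gl /d; field.
have n0 : g 0 0 * d - g 0 1 * 0 != 0 by rewrite dE gl_det_neq0.
pose h := gl (g 0 0) (g 0 1) 0 d.
have e : g = (lower (g 1%R 0%R / g 0%R 0%R) * h)%g.
  apply: gl2P; rewrite gmulE !lowerE !(glE n0) ?mul0r ?mul1r ?mulr0 ?addr0 //.
    by rewrite divfK.
  by rewrite addrC mulrC mulrA subrK.
rewrite {1}e uR; first by rewrite !(glE n0).
apply/(BgroupP D); rewrite (glE n0); split; last exact: vge0.
apply: (GL2O_gl D); rewrite ?dE; try exact: GL2O_int.
- exact: dvr0 D.
- apply: (dvrB D); first exact: GL2O_int.
  by apply: (dvrM D) => //; apply: (dvrM D); exact: GL2O_int.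
- exact: (GL2O_det D gO).
Qed.

(** Conjugate by the diagonal matrix with entries 1 and e, on which omega is
    trivial from both sides. *)
Lemma level_lower_unit c e : O c -> unit e -> u (lower (e * c)) = u (lower c).
Proof.
move=> Oc Ue; have [Oe e0 OeV] := Ue.
have Bd (t : F) : unit t -> Bgroup w s (gl 1 0 0 t).
  move=> Ut; have n0 : 1 * t - 0 * 0 != 0 :> F by rewrite mul1r mulr0 subr0; case: Ut.
  apply/(BgroupP D); rewrite (glE n0); split; last exact: vge0.
  apply: (GL2O_gl D); (try exact: dvr_one D); (try exact: dvr0 D); first exact: unit_int.
  by rewrite mul1r mulr0 subr0.
have n0 (t : F) : t != 0 -> 1 * t - 0 * 0 != 0 :> F by rewrite mul1r mulr0 subr0.
have eV0 : e^-1 != 0 by rewrite invr_eq0.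
have -> : lower (e * c) = (gl 1 0 0 e * lower c * gl 1 0 0 e^-1)%g.
  by apply: gl2P; rewrite gmulE !gmulE !lowerE !(glE (n0 _ e0)) !(glE (n0 _ eV0)); field.
rewrite uR; last exact/Bd/unitsV.
rewrite uL; [|exact: Bd|exact: (lower_GL2O D)].
by rewrite (glE (n0 _ e0)) (glE (n0 _ eV0)) om1 !mul1r.
Qed.

Lemma level_lower_val c e : c != 0 -> e != 0 -> v c = v e -> O c -> u (lower e) = u (lower c).
Proof.
move=> c0 e0 ve Oc; rewrite -(@level_lower_unit c (e / c)) ?divfK //.
apply: (unitE (D := D)); first by rewrite mulf_neq0 ?invr_eq0.
by rewrite valM ?invr_eq0 // valV // ve subrr.
Qed.

Hypothesis ommin : forall t, trivial_on (unit_filtration O w t) om -> (r <= t)%N.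

(** The element t = 1 + yc satisfies n(1, y, t) l(c) = l(c) n(t, y, 1), where
    l(c) is lower unipotent and n(a, y, d) is upper triangular. The two factors
    act by omega(1) and by omega(t) respectively, and t can be chosen with
    omega(t) <> 1 because v(c) is less than the conductor exponent. *)
Lemma level_lower_eq0 c : O c -> ~ vge r%:Z c -> u (lower c) = 0.
Proof.
move=> Oc nc.
have c0 : c != 0 by apply/eqP => c0; apply: nc; rewrite c0; apply: vge0.
have vc0 : 0 <= v c by apply/(integer_val D).
have vcr : v c < r%:Z by rewrite ltNge; apply/negP => h; apply: nc.
(* Minimality of the conductor exponent provides t. *)
have : ~ trivial_on (unit_filtration O w `|v c|%N) om.
  by move/ommin; lia.
move=> /existsNP[t] /not_implyP[[Ut /(ideal_powerE D) It] /eqP omt].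
pose y := (t - 1) / c.
have Oy : O y.
  apply/(vge_integer D) => y0; have t1 : t - 1 != 0.
    by apply: contraNneq y0 => t1; rewrite /y t1 mul0r.
  by rewrite valM ?invr_eq0 // valV // subr_ge0; have := It t1; lia.
have tE : t = 1 + y * c by rewrite /y; field.
have [Ot t0 OtV] := Ut.
have n1 : 1 * t - y * 0 != 0 by rewrite mul1r mulr0 subr0.
have n2 : t * 1 - y * 0 != 0 by rewrite mulr1 mulr0 subr0.
have B1 : Bgroup w s (gl 1 y 0 t).
  apply/(BgroupP D); rewrite (glE n1); split; last exact: vge0.
  apply: (GL2O_gl D); rewrite ?mul1r ?mulr0 ?subr0 //; [exact: dvr_one D|exact: dvr0 D].
have B2 : Bgroup w s (gl t y 0 1).
  apply/(BgroupP D); rewrite (glE n2); split; last exact: vge0.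
  apply: (GL2O_gl D); rewrite ?mulr1 ?mulr0 ?subr0 //; [exact: dvr0 D|exact: dvr_one D].
have e : (gl 1 y 0 t * lower c = lower c * gl t y 0 1)%g.
  apply: gl2P; rewrite !gmulE !lowerE !(glE n1) !(glE n2) ?tE; ring.
have := uL B1 (lower_GL2O D Oc); rewrite e uR // (glE n1) (glE n2) om1 mul1r => /eqP.
rewrite -subr_eq0 -[X in _ - X]mul1r -mulrBl mulf_eq0 subr_eq0 (negPf omt).
by move/eqP.
Qed.

(** Reduction to the lower unipotent case. *)
Lemma level_support g : GL2O g -> ~ vge r%:Z (g 1 0) -> u g = 0.
Proof.
move=> gO ng; have Og i j : O (g i j) := GL2O_int i j gO.
(* If the upper left entry is not a unit, then the lower left one is, and
   adding the bottom row to the top row makes it a unit. *)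
wlog Ua : g gO ng Og / unit (g 0 0).
  move=> H; case: (pselect (unit (g 0 0))) => [|na]; first exact: H.
  have va : vge 1 (g 0 0) by apply: contrapT => va; apply: na; apply/(unitP2 D).
  have n1 : 1 * 1 - 1 * 0 != 0 :> F by rewrite mulr0 subr0 mulr1 oner_neq0.
  have gO' : GL2O (gl 1 1 0 1 * g)%g.
    by apply: (GL2OM D) => //; apply: (upper_unip_GL2O D); exact: dvr_one D.
  have := H (gl 1 1 0 1 * g)%g gO'.
  rewrite uL //; last first.
    apply/(BgroupP D); rewrite (glE n1); split; last exact: vge0.
    by apply: (upper_unip_GL2O D); exact: dvr_one D.
  rewrite (glE n1) om1 mul1r; apply.
  - by rewrite gmulE !(glE n1) mul0r add0r mul1r.
  - by move=> i j; apply: GL2O_int.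
  rewrite gmulE !(glE n1) !mul1r addrC; apply: (units_add (D := D)) => //.
  have : unit (g 1 0 * g 0 1).
    have := units_add (D := D) (GL2O_det D gO) (_ : vge 1 (- (g 0 0 * g 1 1))).
    have -> : \det g + - (g 0 0 * g 1 1) = - (g 1 0 * g 0 1) by rewrite det_gl; ring.
    move=> /(_ _)[|OO n0 OV]; first by apply/vgeN/vgeMl.
    split; first by rewrite -[_ * _]opprK; apply: (dvrN D).
      by rewrite -oppr_eq0.
    by rewrite -[_ * _]opprK invrN; apply: (dvrN D).
  by apply: (unit_mul_l D).
rewrite level_lower // level_lower_eq0 ?mulr0 //.
  by apply: (dvrM D) => //; case: Ua.
move=> h; apply: ng; rewrite -(divfK (unit_neq0 Ua) (g 1 0)).
by apply: vgeMl.
Qed.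

(** Here the bottom row of g is proportional to a row with entries 1 and d/c,
    which belongs to an element of GL_2(O) outside B(r). *)
Lemma level_support_row g : g 1 0 != 0 -> O (g 1 1 / g 1 0) -> u g = 0.
Proof.
move=> c0 Od.
have n0 : 0 * (g 1 1 / g 1 0) - -1 * 1 = 1 :> F by ring.
have n1 : 0 * (g 1 1 / g 1 0) - -1 * 1 != 0 :> F by rewrite n0 oner_neq0.
set k := gl 0 (-1) 1 (g 1 1 / g 1 0).
have kO : GL2O k.
  apply: (GL2O_gl D); rewrite ?n0; (try exact: (dvr_one D)); (try exact: (dvr0 D)) => //.
    by apply: (dvrN D); exact: dvr_one D.
  exact: units1 D.
rewrite -(mulgVK k g) uB; last first.
  by rewrite gmulE !ginvE det_gl !(glE n1) n0; field; rewrite c0 oner_neq0.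
rewrite (level_support kO) ?mulr0 // !(glE n1) => h.
have := h (oner_neq0 _); rewrite val1; lia.
Qed.

Lemma level_eq0 : (s = r)%N -> u 1%g = 0 -> forall g, u g = 0.
Proof.
move=> sr u1 g; have [h [k [h0 kO ->]]] := iwasawa D g.
rewrite uB //; suff -> : u k = 0 by rewrite mulr0.
case: (pselect (vge r%:Z (k 1 0))) => [vk|]; last exact: level_support.
have kB : Bgroup w s k by apply/(BgroupP D); rewrite sr.
by rewrite -[k]mul1g uR // u1 mulr0.
Qed.

Lemma level_Bgroup g : Bgroup w s g -> u g = om (g 0 0) * u 1%g.
Proof. by move=> gB; rewrite -[in LHS](mul1g g) uR. Qed.

Section Drop.
Hypothesis rs : (r < s)%N.
Let t := s.-1.
Let st : s = t.+1. Proof. by rewrite /t; lia. Qed.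

(** Outside B(s) the lower left entry has valuation exactly s - 1. *)
Lemma level_mid g : Bgroup w t g -> ~ Bgroup w s g ->
  u g = om (g 0 0) * u (lower (w ^+ t)).
Proof.
move=> gB ngB; have t0 : (0 < t)%N by rewrite /t; lia.
have [Ua _] := Bgroup_units D t0 gB; have /(BgroupP D)[gO vg] := gB.
have [Oa a0 OaV] := Ua.
have ng : ~ vge s%:Z (g 1 0) by move=> h; apply: ngB; apply/(BgroupP D).
have c0 : g 1 0 != 0 by apply/eqP => c0; apply: ng; rewrite c0; apply: vge0.
have vc : v (g 1 0) = t%:Z.
  have := vg c0; have : ~~ (s%:Z <= v (g 1 0)) by apply/negP => h; apply: ng.
  rewrite st; lia.
rewrite level_lower //; congr (_ * _); apply: level_lower_val.
- by rewrite expf_neq0 // (dvr_neq0 D).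
- by rewrite mulf_neq0 ?invr_eq0.
- by rewrite valwX valM ?invr_eq0 // valV // (val_unit D Ua) subr0 vc.
- by apply: (dvrX D); exact: dvr_w D.
Qed.

(** Multiplication by B(s - 1) from either side keeps a valuation less than s -
    1 of the lower left entry, so that the next two lemmas follow from this
    comparison. *)
Lemma level_same g h : GL2O g -> GL2O h -> vge r%:Z (g 1 0) ->
  ~ vge t%:Z (g 1 0) ->
  v (h 1 0) = v (g 1 0) -> h 1 0 != 0 ->
  om (g 0 0) * u h = om (h 0 0) * u g.
Proof.
move=> gO hO vg ng vhg h0.
have g0 : g 1 0 != 0 by apply/eqP => c0; apply: ng; rewrite c0; apply: vge0.
have Bg : Bgroup w r g by apply/(BgroupP D).
have Bh : Bgroup w r h by apply/(BgroupP D); split=> // _; rewrite vhg; apply: vg.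
have [Ug _] := Bgroup_units D r_gt0 Bg; have [Uh _] := Bgroup_units D r_gt0 Bh.
have [Oa a0 OaV] := Ug; have [Oa' a0' OaV'] := Uh.
rewrite (level_lower gO) // (level_lower hO) // mulrCA; congr (_ * (_ * _)).
apply: level_lower_val; rewrite ?mulf_neq0 ?invr_eq0 //.
  by rewrite !valM ?invr_eq0 // !valV // (val_unit D Ug) (val_unit D Uh) vhg.
by apply: (dvrM D) => //; apply: GL2O_int.
Qed.

Lemma level_right g h : GL2O g -> ~ vge t%:Z (g 1 0) -> Bgroup w t h ->
  u (g * h)%g = om (h 0 0) * u g.
Proof.
move=> gO ng hB; have t0 : (0 < t)%N by rewrite /t; lia.
have /(BgroupP D)[hO vh] := hB; have [Ux _] := Bgroup_units D t0 hB.
have ghO := GL2OM D gO hO; have [Ox x0 OxV] := Ux.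
have near : vge t%:Z ((g * h)%g 1%R 0%R - g 1 0 * h 0 0).
  by rewrite gmulE addrC addKr; apply: vgeMr => //; apply: GL2O_int.
have ngx : ~ vge t%:Z (g 1 0 * h 0 0) by rewrite mulrC vgeZ_unit.
have [c0 vc] := vge_near ngx near.
have g0 : g 1 0 != 0 by apply/eqP => g0; apply: ng; rewrite g0; apply: vge0.
rewrite valM // (val_unit D Ux) addr0 in vc.
case: (pselect (vge r%:Z (g 1 0))) => [vg|nvg]; last first.
  rewrite (level_support gO) // (level_support ghO) ?mulr0 // => H.
  by apply: nvg => _; rewrite -vc; apply: H.
have Bg : Bgroup w r g by apply/(BgroupP D).
have Bh : Bgroup w r h by apply: (Bgroup_le D) hB; rewrite /t; lia.
have [Ug _] := Bgroup_units D r_gt0 Bg.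
apply: (mulfI (om_neq0 (unit_neq0 Ug))).
rewrite (level_same gO ghO) // (om_mul (leqnn r)) //; ring.
Qed.

Lemma level_left g h : GL2O g -> ~ vge t%:Z (g 1 0) -> Bgroup w t h ->
  u (h * g)%g = om (h 0 0) * u g.
Proof.
move=> gO ng hB; have t0 : (0 < t)%N by rewrite /t; lia.
have /(BgroupP D)[hO vh] := hB; have [_ Ux] := Bgroup_units D t0 hB.
have ghO := GL2OM D hO gO; have [Ox x0 OxV] := Ux.
have near : vge t%:Z ((h * g)%g 1%R 0%R - h 1 1 * g 1 0).
  by rewrite gmulE addrK; apply: vgeMl => //; apply: GL2O_int.
have ngx : ~ vge t%:Z (h 1 1 * g 1 0) by rewrite vgeZ_unit.
have [c0 vc] := vge_near ngx near.
have g0 : g 1 0 != 0 by apply/eqP => g0; apply: ng; rewrite g0; apply: vge0.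
rewrite valM // (val_unit D Ux) add0r in vc.
case: (pselect (vge r%:Z (g 1 0))) => [vg|nvg]; last first.
  rewrite (level_support gO) // (level_support ghO) ?mulr0 // => H.
  by apply: nvg => _; rewrite -vc; apply: H.
have Bg : Bgroup w r g by apply/(BgroupP D).
have Bh : Bgroup w r h by apply: (Bgroup_le D) hB; rewrite /t; lia.
have [Ug _] := Bgroup_units D r_gt0 Bg.
apply: (mulfI (om_neq0 (unit_neq0 Ug))).
rewrite (level_same gO ghO) // (om_mul (leqnn r)) //; ring.
Qed.

(** Above valuation s - 1 the hypothesis says that u is omega of the upper left
    entry, up to a constant; below, level_left applies. *)
Lemma level_drop : u (lower (w ^+ t)) = u 1%g ->
  forall h g, Bgroup w t h -> GL2O g -> u (h * g)%g = om (h 0 0) * u g.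
Proof.
move=> ut h g hB gO; have rt : (r <= t)%N by rewrite /t; lia.
case: (pselect (vge t%:Z (g 1 0))) => [vg|ng]; last exact: level_left.
have tE k : Bgroup w t k -> u k = om (k 0 0) * u 1%g.
  move=> kB; case: (pselect (Bgroup w s k)) => [|nk]; first exact: level_Bgroup.
  by rewrite level_mid // ut.
have gB : Bgroup w t g by apply/(BgroupP D).
by rewrite (tE _ (BgroupM D hB gB)) (tE _ gB) (om_mul rt) // mulrA.
Qed.
End Drop.
End LevelVector.

(** * The torus in GL_2(F) *)

(** The matrix of x as an element of the group, and the identity for x = 0. *)
HB.lock Definition torus_GL2 (F : fieldType) (K : fieldExtType F)
    (iota : {lrmorphism K -> 'M[F]_2}) (x : K) : GL2 F :=
  insubd (GL2_one F) (iota x).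

(** The equality of dimensions is propositional because n will be the dimension
    of K, which does not reduce to 2. *)
Lemma det_similar (k : fieldType) n (M : 'M[k]_n) (P : 'M[k]_(n, 2)) (N : 'M[k]_2) :
  n = 2%N -> row_free P -> M *m P = P *m N -> \det M = \det N.
Proof.
move=> n2; subst n; rewrite row_free_unit => Pu e.
have P0 : \det P != 0 by rewrite -unitfE -unitmxE.
by apply: (mulIf P0); rewrite -det_mulmx e det_mulmx mulrC.
Qed.

Section TorusGroup.
Variables (F : fieldType) (K : fieldExtType F) (iota : {lrmorphism K -> 'M[F]_2}).
Local Notation tg := (torus_GL2 iota).
Implicit Types (x y : K) (z : F).

Lemma iota_mul x y : iota (x * y) = iota x *m iota y.
Proof. exact: rmorphM. Qed.

Lemma iota_unit x : x != 0 -> iota x \in unitmx.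
Proof.
move=> x0; have := iota_mul x x^-1; rewrite mulfV // rmorph1 => e.
by case: (mulmx1_unit (esym e)).
Qed.

Lemma tgE x : x != 0 -> GL2_mx (tg x) = iota x.
Proof.
by move=> x0; rewrite torus_GL2.unlock [LHS]insubdK // -topredE /= iota_unit.
Qed.

Lemma tg_eq x (g : GL2 F) : GL2_mx g = iota x -> x != 0 /\ g = tg x.
Proof.
move=> e; have x0 : x != 0.
  apply/eqP => x0; have := gl_det_neq0 g; rewrite e x0 rmorph0 det_mx22 !mxE.
  by rewrite mulr0 subrr eqxx.
by split=> //; apply: val_inj; rewrite /= tgE.
Qed.

Lemma tgM x y : x != 0 -> y != 0 -> tg (x * y) = (tg x * tg y)%g.
Proof.
move=> x0 y0; apply: val_inj; rewrite [LHS]tgE ?mulf_neq0 // iota_mul.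
by rewrite -(tgE x0) -(tgE y0).
Qed.

Lemma tg1 : tg 1 = 1%g.
Proof. by apply: val_inj; rewrite [LHS]tgE ?oner_neq0 // rmorph1. Qed.

Lemma tgV x : x != 0 -> tg x^-1 = ((tg x)^-1)%g.
Proof.
move=> x0; apply: (mulgI (tg x)).
by rewrite -tgM ?invr_eq0 // mulfV // tg1 mulgV.
Qed.

Lemma iota_scal z : iota z%:A = z%:M.
Proof. by rewrite linearZ /= rmorph1 scalemx1. Qed.

Lemma iota_alg z : iota (in_alg K z) = z%:M.
Proof. by rewrite /= iota_scal. Qed.

Lemma tg_algE z : z != 0 -> ((tg (in_alg K z) 0 0 = z) * (tg (in_alg K z) 0 1 = 0) *
  (tg (in_alg K z) 1 0 = 0) * (tg (in_alg K z) 1 1 = z))%type.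
Proof. by move=> z0; rewrite !tgE ?fmorph_eq0 // !iota_alg !mxE. Qed.

Lemma tg_alg_mulE z (g : GL2 F) i j : z != 0 ->
  (tg (in_alg K z) * g)%g i j = z * g i j.
Proof.
move=> z0; have [->|->] := I2P i; rewrite gmulE !(tg_algE z0) mul0r ?addr0 ?add0r //.
Qed.

(** A triangular matrix has an eigenvalue a in F, and then x - a is not
    invertible in the field K. *)
Lemma tg_lower_eq0 x : x != 0 -> tg x 1 0 = 0 -> exists2 z, z != 0 & x = in_alg K z.
Proof.
move=> x0 c0; have a0 : iota (x - in_alg K (iota x 0 0)) \notin unitmx.
  rewrite rmorphB /= iota_scal unitmxE det_mx22 !mxE /= mulr1n mulr0n subrr mul0r.
  by rewrite -(tgE x0) c0 !(subr0, sub0r, mulr0, oppr0) unitr0.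
have e : x = in_alg K (iota x 0 0).
  by apply/eqP; rewrite -subr_eq0; apply: contraNT a0 => /iota_unit.
exists (iota x 0 0) => //; apply: contraNneq x0 => z0; by rewrite e z0 rmorph0.
Qed.

(** Taking bottom rows is injective on K, since nonzero elements of K are
    invertible. *)
Lemma iota_row_eq0 x : row 1 (iota x) = 0 -> x = 0.
Proof.
move=> r0; apply/eqP; apply: contraT => x0; have := gl_det_neq0 (tg x); rewrite det_gl.
have e j : tg x 1 j = 0.
  by rewrite tgE //; have /rowP/(_ j) := r0; rewrite !mxE.
by rewrite !e !mulr0 subrr eqxx.
Qed.

(** Taking bottom rows is an injective linear map from K to F^2, hence
    bijective by dimensions; multiplying g by the inverse of the torus element
    with the same bottom row gives an upper triangular matrix. *)
Lemma torus_borel (dK : \dim {:K} = 2%N) (g : GL2 F) :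
  exists (b : GL2 F) (x : K), [/\ x != 0, b 1 0 = 0, b 1 1 = 1 & g = (b * tg x)%g].
Proof.
pose phi x : 'rV[F]_2 := row 1 (iota x).
have phi_lin : linear phi by move=> a x y; rewrite /phi linearP /= linearP.
pose Phi : {linear K -> 'rV[F]_2} := HB.pack phi (GRing.isLinear.Build F K 'rV[F]_2 _ phi phi_lin).
have phiE x : linfun Phi x = row 1 (iota x) by rewrite lfunE.
have ker0 : lker (linfun Phi) = 0%VS.
  apply/eqP; rewrite -subv0; apply/subvP => x.
  by rewrite memv_ker phiE memv0 => /eqP/iota_row_eq0 ->.
have lim : limg (linfun Phi) = fullv.
  apply/eqP; rewrite eqEdim subvf /= dimvf /= /dim /=.
  have := limg_ker_dim (linfun Phi) fullv; rewrite capfv ker0 dimv0 add0n => ->.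
  by rewrite dK.
have /memv_imgP[x _ ex] : row 1 (GL2_mx g) \in limg (linfun Phi) by rewrite lim memvf.
rewrite phiE in ex.
have rowE j : g 1 j = iota x 1 j.
  by have /rowP/(_ j) := ex; rewrite !mxE.
have x0 : x != 0.
  apply/eqP => x0; have := gl_det_neq0 g; rewrite det_gl !rowE x0 rmorph0 !mxE !mulr0.
  by rewrite subrr eqxx.
exists (g * (tg x)^-1)%g, x; split=> //; last by rewrite mulgVK.
  rewrite gmulE !ginvE !rowE -!(tgE x0); field; exact: gl_det_neq0.
rewrite gmulE !ginvE !rowE -!(tgE x0) -[RHS](divff (gl_det_neq0 (tg x))).
rewrite [X in _ = X / _]det_gl; field; exact: gl_det_neq0.
Qed.

(** Taking bottom rows identifies K with F^2 and multiplication by x with the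
    right action of iota x. *)
Lemma det_iota (dK : \dim {:K} = 2%N) x : \det (iota x) = field_norm x.
Proof.
pose e := vbasis {:K}; have eb : basis_of {:K} e := vbasisP {:K}.
pose P : 'M[F]_(\dim {:K}, 2) := \matrix_(i, j) iota e`_i 1 j.
have phiE (u : 'rV_(\dim {:K})) : u *m P = row 1 (iota (passmx.vecof e u)).
  apply/rowP => j; rewrite !mxE /passmx.vecof linear_sum summxE.
  by apply: eq_bigr => i _; rewrite linearZ !mxE.
apply/esym/(det_similar (P := P)); first exact: dK.
  apply: inj_row_free => u; rewrite phiE => /iota_row_eq0 v0.
  by apply/eqP; rewrite -(passmx.vecof_eq0 eb) v0.
apply/row_matrixP => i; rewrite !row_mul ![row i _]rowE.
rewrite passmx.mul_mxof !phiE passmx.rVofK //.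
by rewrite lfunE /= iota_mul row_mul.
Qed.
End TorusGroup.

(** * Levels of torus elements and a criterion of nonvanishing *)

Section IntegralTorus.
Variables (R : realType) (p : nat) (Qp : padicField R p) (F : fieldExtType Qp).
Variables (K : fieldExtType F) (w : F) (wK : K).
Local Notation OF := (integers F).
Local Notation OK := (ext_integers K).
Local Notation C := R[i].
Hypotheses (D : dvr OF w p) (DK : dvr OK wK p).
Variable iota : {lrmorphism K -> 'M[F]_2}.
Local Notation tg := (torus_GL2 iota).
Local Notation vgeK := (vge DK).
Local Notation vge := (vge D).
Local Notation v := (dval D).
Local Notation vK := (dval DK).
Local Notation jK := (in_alg K).
Implicit Types (x y u : K) (z : F) (g k : GL2 F).

Lemma jK_neq0 z : z != 0 -> jK z != 0. Proof. by rewrite fmorph_eq0. Qed.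

Lemma integers_jK z : OF z -> OK (jK z).
Proof. exact: (@integral_rmorph _ _ _ (in_alg F \o @padic_int_val R p Qp) jK). Qed.

Lemma units_jK z : integer_units OF z -> integer_units OK (jK z).
Proof.
move=> [Oz z0 OzV]; split; rewrite ?jK_neq0 // -?fmorphV; exact: integers_jK.
Qed.

(** The ramification index of K/F. *)
Definition ram_index : int := vK (jK w).

(** Units of F remain units in K. *)
Lemma valK_jK z : z != 0 -> vK (jK z) = ram_index * v z.
Proof.
move=> z0; have [u Uu e] := valE D z0; have [_ u0 _] := Uu.
have w0 := dvr_neq0 D.
have vwz (n : int) : vK (jK (w ^ n)) = n * ram_index.
  have pos (m : nat) : vK (jK (w ^+ m)) = m%:Z * ram_index.
    by rewrite rmorphXn valX // jK_neq0.
  case: n => m; first exact: pos.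
  by rewrite NegzE -invr_expz fmorphV valV ?jK_neq0 ?expf_neq0 // pos mulNr.
rewrite {1}e rmorphM valM ?jK_neq0 ?expfz_neq0 // vwz.
by rewrite (val_unit DK (units_jK Uu)) addr0 mulrC.
Qed.

Lemma ram_index_gt0 : 0 < ram_index.
Proof.
have h := val_p_gt0 DK; have h' := val_p_gt0 D; move: h.
by rewrite -(rmorph_nat jK) valK_jK ?(dvr_p_neq0 D) // pmulr_lgt0.
Qed.

Lemma vgeK_jK (n : int) z : vge n z -> vgeK (ram_index * n) (jK z).
Proof.
move=> h jz0; have z0 : z != 0 by move: jz0; rewrite fmorph_eq0.
rewrite valK_jK //.
by rewrite ler_pM2l ?ram_index_gt0 // h.
Qed.

Lemma integers_jKE z : OK (jK z) <-> OF z.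
Proof.
split; last exact: integers_jK.
move=> h; apply/(vge_integer D) => z0; have := proj2 (vge_integer DK _) h.
by move=> /(_ (jK_neq0 z0)); rewrite valK_jK // pmulr_rge0 // ram_index_gt0.
Qed.

Hypothesis iO : forall x, OK x -> forall i j, OF (iota x i j).

Lemma tg_GL2O x : integer_units OK x -> GL2O (tg x).
Proof.
move=> [Ox x0 OxV] i j; rewrite -tgV // !tgE ?invr_eq0 //.
by split; apply: iO.
Qed.

Lemma tg_congruence n u : unit_filtration OK p%:R n u -> congruence_subgroup n (tg u).
Proof.
move=> [Uu [y Oy e]]; split; first exact: tg_GL2O.
move=> i j; have [_ u0 _] := Uu; rewrite tgE //.
exists (iota y i j); first exact: iO.
have -> : u = 1 + p%:R ^+ n * y by rewrite -e addrC subrK.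
rewrite rmorphD rmorph1 -(rmorph_nat jK) -rmorphXn /= mulr_algl linearZ /=.
by rewrite !mxE addrAC subrr add0r.
Qed.

Lemma congruence_Bgroup n g : congruence_subgroup n g -> Bgroup w n g.
Proof.
move=> [gO gn]; apply/(BgroupP D); split=> //.
by have /(ideal_power_p_vge D) := gn 1 0; rewrite !mxE subr0.
Qed.

Section Smooth.
Variables (chi : K -> C) (om : F -> C).
Hypotheses (chiM : {morph chi : x y / x * y}) (chi1 : chi 1 = 1).
Hypothesis chi_om : forall z, z != 0 -> chi (jK z) = om z.

Lemma chi_neq0 x : x != 0 -> chi x != 0.
Proof.
move=> x0; apply/eqP => ox; have := chi1; rewrite -(mulfV x0) chiM ox mul0r => /esym/eqP.
by rewrite oner_eq0.
Qed.

Lemma om_chi_neq0 z : z != 0 -> om z != 0.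
Proof. by move=> z0; rewrite -chi_om // chi_neq0 // jK_neq0. Qed.

(** Small elements of 1 + p^n O_K fix f and have chi equal to 1, and elements
    of F^* act on f by omega, which is the restriction of chi. *)
Lemma torus_quotient_smooth (f : GL2 F -> C) n m :
  (forall z g, z != 0 -> f (tg (jK z) * g)%g = om z * f g) ->
  (forall k g, congruence_subgroup n k -> f (g * k)%g = f g) ->
  trivial_on (unit_filtration OK p%:R m) chi ->
  exists N, torus_smooth OK p N (fun x => f (tg x) / chi x).
Proof.
move=> fz fk chim; exists (maxn n m) => x y x0 [z [u [z0 Uu e]]].
have [[_ u0 _] _] := Uu.
have y0 : y != 0 by apply: contraNneq x0 => y0; rewrite e y0 mulr0.
have Uk (k : nat) : (k <= maxn n m)%N -> unit_filtration OK p%:R k u.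
  case: k => [|k] le; last exact: (unit_filtration_le DK (ltnW le) Uu).
  case: Uu => Uu _; split=> //; exists (u - 1); rewrite ?expr0 ?mul1r //.
  by apply: (dvrB DK); [case: Uu | exact: dvr_one DK].
have Uun := Uk n (leq_maxl _ _); have Uum := Uk m (leq_maxr _ _).
have -> : tg x = (tg (jK z) * (tg y * tg u))%g.
  by rewrite e -!tgM ?mulf_neq0 ?jK_neq0 // -mulrA [u * y]mulrC.
rewrite fz // fk; last exact: tg_congruence.
rewrite e !chiM chi_om // [chi u]chim // mulr1.
by field; rewrite chi_neq0 // om_chi_neq0.
Qed.

Variable r : nat.
Hypotheses (omM : {morph om : x y / x * y}) (om1 : om 1 = 1).
Hypotheses (r_gt0 : (0 < r)%N) (omr : trivial_on (unit_filtration OF w r) om).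
Hypothesis ommin : forall t, trivial_on (unit_filtration OF w t) om -> (r <= t)%N.
Variables (u : GL2 F -> C) (s n m : nat).
Hypothesis uB : forall (h : GL2 F) g, h 1 0 = 0 -> u (h * g)%g = om (h 0 0) *
  (Num.sqrt (normalized_abs (h 0 0 / h 1 1)))%:C%C * u g.
Hypothesis uL : forall (h : GL2 F) g, Bgroup w s h -> GL2O g ->
  u (h * g)%g = om (h 0 0) * u g.
Hypothesis uR : forall (h : GL2 F) g, Bgroup w s h -> u (g * h)%g = om (h 0 0) * u g.
Hypothesis uK : forall k g, congruence_subgroup n k -> u (g * k)%g = u g.
Hypothesis chim : trivial_on (unit_filtration OK p%:R m) chi.
Hypothesis rs : (r <= s)%N.

(** The class of x modulo F^* meets B(t). *)
Definition in_level t x := exists2 z, z != 0 & Bgroup w t (tg (jK z * x)).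

Hypothesis u_supp : forall x, x != 0 -> u (tg x) != 0 -> in_level r x.
Hypothesis psi_s : forall x, x != 0 -> Bgroup w s (tg x) -> om (tg x 0 0) = chi x.

Lemma u_scal z g : z != 0 -> u (tg (jK z) * g)%g = om z * u g.
Proof.
move=> z0; rewrite uB ?(tg_algE iota z0) // divff // normalized_abs1 Num.Theory.sqrtr1.
by rewrite [(1)%:C%C](_ : _ = 1) // mulr1.
Qed.

Let h x := u (tg x) / chi x.

Let h_smooth : exists N, torus_smooth OK p N h.
Proof. exact: torus_quotient_smooth u_scal uK chim. Qed.

Definition indicator x : C := if `[< x != 0 /\ in_level s x >] then 1 else 0.

Lemma in_level_units t z y x : z != 0 -> y != 0 -> x != 0 -> Bgroup w t (tg y) ->
  in_level t x -> in_level t (jK z * y * x).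
Proof.
move=> z0 y0 x0 By [z1 z10 B1]; exists (z1 / z); first by rewrite mulf_neq0 ?invr_eq0.
have -> : jK (z1 / z) * (jK z * y * x) = y * (jK z1 * x).
  by rewrite rmorphM fmorphV; field; rewrite jK_neq0.
by rewrite tgM ?mulf_neq0 ?jK_neq0 //; apply: (BgroupM D).
Qed.

Lemma indicator_smooth : torus_smooth OK p s indicator.
Proof.
move=> x y x0 [z [t [z0 Ut e]]]; have [[_ t0 _] _] := Ut.
have y0 : y != 0 by apply: contraNneq x0 => y0; rewrite e y0 mulr0.
have Bt : Bgroup w s (tg t).
  by apply: (Bgroup_le D (leqnSn s)); apply: congruence_Bgroup; apply: tg_congruence.
congr (if _ then _ else _); apply: asbool_equiv_eq; split=> -[_ H]; split=> //.
  have -> : y = jK z^-1 * t^-1 * x.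
    by rewrite e fmorphV; field; rewrite t0 jK_neq0.
  apply: in_level_units; rewrite ?invr_eq0 // tgV //; exact: (BgroupV D).
by rewrite e; apply: in_level_units.
Qed.

Lemma indicator_mean : torus_mean DK indicator != 0.
Proof.
apply: (torus_mean_indicator DK indicator_smooth).
  by move=> x; rewrite /indicator; case: ifP; [right|left].
rewrite /indicator ifT //; apply/asboolP; split; first exact: oner_neq0.
exists 1; first exact: oner_neq0.
rewrite rmorph1 mulr1 tg1; apply/(BgroupP D); split; first exact: (GL2O1 D).
by rewrite g1E; apply: vge0.
Qed.

(** Comparing determinants, the scalar which moves x into B(t) is a unit. *)
Lemma in_level_Bgroup t x : x != 0 -> GL2O (tg x) -> in_level t x -> Bgroup w t (tg x).
Proof.
move=> x0 gO [z z0 /(BgroupP D)[zgO h0]]; apply/(BgroupP D); split=> //.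
have := h0; rewrite tgM ?jK_neq0 // tg_alg_mulE // vgeZ_unit //.
have := GL2O_det D zgO; rewrite tgM ?jK_neq0 // det_mulmx => Ud.
have Uz2 : integer_units OF (z * z).
  have <- : \det (tg (jK z)) = z * z by rewrite det_gl !(tg_algE iota z0) mul0r subr0.
  rewrite -[\det _](mulfK (gl_det_neq0 (tg x))).
  by apply: (unitsM D) => //; apply: unitsV; apply: (GL2O_det D).
by apply: (unitE (D := D)) => //; have := val_unit D Uz2; rewrite valM //; lia.
Qed.

Lemma h_scal z x : z != 0 -> x != 0 -> h (jK z * x) = h x.
Proof.
move=> z0 x0; rewrite /h tgM ?jK_neq0 // u_scal // chiM chi_om //.
by field; rewrite chi_neq0 // om_chi_neq0.
Qed.

Lemma h_level x : x != 0 -> in_level s x -> h x = u 1%g.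
Proof.
move=> x0 [z z0 zB]; rewrite -(h_scal z0) // /h -[tg _]mul1g uR //.
have zx0 : jK z * x != 0 by rewrite mulf_neq0 ?jK_neq0.
by rewrite psi_s // mulrAC divff ?mul1r // chi_neq0.
Qed.

Lemma in_level_le t t' x : (t <= t')%N -> in_level t' x -> in_level t x.
Proof. by move=> tt' [z z0 B]; exists z => //; apply: (Bgroup_le D tt'). Qed.

(** The difference of h and a times the indicator function has mean 0, because
    translation by t multiplies it by b <> 1; so the mean of h is a times that
    of the indicator function. *)
Lemma nonvanishing_aux a b t : a != 0 -> t != 0 -> b != 1 ->
  (forall x, x != 0 -> h (x * t) - a * indicator (x * t) = b * (h x - a * indicator x)) ->
  torus_mean DK h != 0.
Proof.
move=> a0 t0 b1 ht; have [N hN] := h_smooth.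
have hN' := torus_smooth_le DK (leq_maxl N s) hN.
have iN' := torus_smooth_le DK (leq_maxr N s) indicator_smooth.
have e := torus_mean_comb DK (- a) iN' hN'.
have h1N : torus_smooth OK p (maxn N s) (fun x => - a * indicator x + h x).
  by move=> x y x0 xy; rewrite (iN' x y) // (hN' x y).
move: e; rewrite (@torus_mean_eq0 _ _ _ _ _ DK _ _ _ t b h1N) //; last first.
  by move=> x x0; rewrite !mulNr ![- _ + _]addrC ht.
move/esym/eqP; rewrite mulNr addrC subr_eq0 => /eqP ->.
by rewrite mulf_neq0 // indicator_mean.
Qed.

Lemma indicatorT x : x != 0 -> in_level s x -> indicator x = 1.
Proof. by move=> x0 lx; rewrite /indicator ifT //; apply/asboolP. Qed.

Lemma indicatorF x : ~ in_level s x -> indicator x = 0.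
Proof. by move=> lx; rewrite /indicator ifF //; apply/asboolP => -[]. Qed.

(** For s = r the function h is supported on level s and is constant there. *)
Lemma nonvanishing_minimal : s = r -> u 1%g != 0 -> torus_mean DK h != 0.
Proof.
(* The remainder is zero, so that it is multiplied by 0 under the trivial
   translation. *)
move=> sr u1; apply: (nonvanishing_aux (b := 0) u1 (oner_neq0 _)).
  by rewrite eq_sym oner_neq0.
move=> x x0; rewrite mulr1 mul0r.
case: (pselect (in_level s x)) => lx.
  by rewrite indicatorT // mulr1 h_level // subrr.
rewrite indicatorF // mulr0 subr0 /h; have [->|ux] := eqVneq (u (tg x)) 0.
  by rewrite mul0r.
by case: lx; rewrite sr; apply: u_supp.
Qed.

(** On level s - 1 the remainder is a multiple of psi, which y0 multiplies by
    psi(y0); outside this level u is multiplied by omega under right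
    translation by B(s - 1), so that the remainder is multiplied by the same
    constant. *)
Lemma nonvanishing_drop y0 : (r < s)%N -> u (lower (w ^+ s.-1)) != u 1%g ->
  y0 != 0 -> Bgroup w s.-1 (tg y0) -> om (tg y0 0 0) != chi y0 ->
  torus_mean DK h != 0.
Proof.
move=> lrs ul y00 By0 psi_y0; set t := s.-1 in ul By0 *.
have rt : (r <= t)%N by rewrite /t; lia.
have ts : (t <= s)%N by rewrite /t; lia.
pose psi x := om (tg x 0 0) / chi x.
have psiM x y : x != 0 -> y != 0 -> Bgroup w t (tg x) -> Bgroup w t (tg y) ->
    psi (x * y) = psi x * psi y.
  move=> x0 y1 Bx By; rewrite /psi tgM // (om_mul D omM r_gt0 omr rt) // chiM.
  by field; rewrite !chi_neq0.
set f1 := u (lower _) in ul.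
have a0 : u 1%g - f1 != 0 by rewrite subr_eq0 eq_sym.
apply: (nonvanishing_aux (b := psi y0) a0 y00).
  by apply: contraNneq psi_y0 => e; rewrite -[X in _ == X]mul1r -e /psi divfK // chi_neq0.
(* On level s - 1 the remainder is phi(s - 1) psi(x), where phi(s - 1) is f1.
   *)
have in_t x : x != 0 -> Bgroup w t (tg x) -> h x - (u 1%g - f1) * indicator x = f1 * psi x.
  move=> x0 Bx; case: (pselect (in_level s x)) => lx.
    rewrite indicatorT // h_level // mulr1 subKr /psi psi_s ?divff ?mulr1 ?chi_neq0 //.
    by apply: in_level_Bgroup => //; apply: Bgroup_GL2O Bx.
  rewrite indicatorF // mulr0 subr0 /h (level_mid D om1 r_gt0 uL uR lrs) //.
    by rewrite /psi /f1 mulrAC mulrC.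
  move=> Bs; apply: lx; exists 1; rewrite ?oner_neq0 // rmorph1 mul1r //.
have scal z x : z != 0 -> x != 0 ->
    h (jK z * x) - (u 1%g - f1) * indicator (jK z * x) = h x - (u 1%g - f1) * indicator x.
  move=> z0 x0; rewrite h_scal //; congr (_ - _ * _).
  apply: indicator_smooth; first by rewrite mulf_neq0 ?jK_neq0.
  by exists z, 1; split; rewrite ?mulr1 //; apply: (unit_filtration1 DK).
move=> x x0; have xy0 : x * y0 != 0 by rewrite mulf_neq0.
case: (pselect (in_level t x)) => lx.
  have [z z0 Bzx] := lx; have zx0 : jK z * x != 0 by rewrite mulf_neq0 ?jK_neq0.
  have Bxy : Bgroup w t (tg (jK z * x * y0)) by rewrite tgM //; apply: (BgroupM D).
  rewrite -(scal z) // mulrA -[in RHS](scal z) // (in_t _ _ Bxy) ?mulf_neq0 ?jK_neq0 //.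
  by rewrite (in_t _ zx0 Bzx) psiM // mulrA mulrC.
have lxy : ~ in_level t (x * y0).
  move=> [z z0 B]; apply: lx; exists z => //.
  have -> : jK z * x = jK z * (x * y0) * y0^-1 by rewrite mulrA mulfK.
  rewrite tgM ?mulf_neq0 ?jK_neq0 ?invr_eq0 // tgV //.
  by apply: (BgroupM D) => //; apply: (BgroupV D).
have nls y : ~ in_level t y -> ~ in_level s y by move=> H /(in_level_le ts).
rewrite !indicatorF ?mulr0 ?subr0; try exact: nls.
(* Between the levels r and s - 1 the right action of B(s - 1) is known;
   outside level r the function h vanishes. *)
case: (pselect (in_level r x)) => [[z z0 Bzx]|nr].
  have zx0 : jK z * x != 0 by rewrite mulf_neq0 ?jK_neq0.
  rewrite -(h_scal z0) // mulrA -[in RHS](h_scal z0) //.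
  rewrite /h tgM // (level_right (D := D) omM om1 r_gt0 omr uL uR ommin lrs) //.
  - by rewrite chiM /psi; field; rewrite !chi_neq0.
  - exact: Bgroup_GL2O Bzx.
  - move=> vt; apply: lx; exists z => //; apply/(BgroupP D); split=> //.
    exact: Bgroup_GL2O Bzx.
have -> : h x = 0.
  by rewrite /h; have [->|/u_supp-/(_ x0)//] := eqVneq (u (tg x)) 0; rewrite mul0r.
rewrite mulr0 /h; have [->|/u_supp] := eqVneq (u (tg (x * y0))) 0; first by rewrite mul0r.
move=> /(_ xy0)[z z0 B]; case: nr; exists z => //.
have -> : jK z * x = jK z * (x * y0) * y0^-1 by rewrite mulrA mulfK.
rewrite tgM ?mulf_neq0 ?jK_neq0 ?invr_eq0 // tgV //.
apply: (BgroupM D) => //; apply: (BgroupV D); exact: (Bgroup_le D rt).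
Qed.

End Smooth.
End IntegralTorus.

(** * Coordinates of integers of the quadratic extension *)

Section Generator.
Variables (R : realType) (p : nat) (Qp : padicField R p) (F : fieldExtType Qp).
Variables (K : fieldExtType F) (w : F) (wK : K).
Local Notation OF := (integers F).
Local Notation OK := (ext_integers K).
Local Notation C := R[i].
Hypotheses (D : dvr OF w p) (DK : dvr OK wK p).
Variable iota : {lrmorphism K -> 'M[F]_2}.
Local Notation tg := (torus_GL2 iota).
Local Notation vgeK := (vge DK).
Local Notation vge := (vge D).
Local Notation v := (dval D).
Local Notation vK := (dval DK).
Local Notation jK := (in_alg K).
Local Notation ram := (ram_index w DK).
Hypothesis iO : forall x, OK x -> forall i j, OF (iota x i j).
Implicit Types (x y u : K) (z : F) (g k : GL2 F).

Lemma iota_lin z x i j : iota (jK z * x) i j = z * iota x i j.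
Proof. by rewrite mulr_algl linearZ mxE. Qed.

Lemma scale_integer x : exists2 z, z != 0 & OK (jK z * x).
Proof.
have [->|x0] := eqVneq x 0.
  by exists 1; [exact: oner_neq0|rewrite mulr0; exact: dvr0 DK].
exists (p%:R ^+ `|vK x|%N); first by rewrite expf_neq0 // (dvr_p_neq0 D).
apply/(vge_integer DK) => _; rewrite rmorphXn rmorph_nat.
rewrite valM ?expf_neq0 ?(dvr_p_neq0 DK) // valX ?(dvr_p_neq0 DK) //.
move: (vK x) (vK _) (val_p_gt0 DK) => a e e0.
have : 0 <= `|a|%N%:Z * (e - 1) by apply: mulr_ge0; lia.
rewrite mulrBr mulr1; move: (_ * e) => b; lia.
Qed.

(** An integer of K for which the valuation of the lower left entry is least;
    some entry is not 0 because the torus contains elements with any prescribed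
    bottom row. *)
Lemma exists_generator (dK : \dim {:K} = 2%N) : exists th, [/\ OK th, iota th 1 0 != 0 &
  forall x, OK x -> vge (v (iota th 1 0)) (iota x 1 0)].
Proof.
pose P n := `[< exists x, [/\ OK x, iota x 1 0 != 0 & v (iota x 1 0) = n%:Z] >].
have PP : exists n, P n.
  have n0 : 0 * 0 - -1 * 1 != 0 :> F by rewrite mulr0 sub0r mulN1r opprK oner_neq0.
  have [b [x [x0 b0 b1 e]]] := torus_borel iota dK (gl 0 (-1) 1 0).
  have cx : iota x 1 0 = 1.
    by have := glE n0 => -[[_ <-] _]; rewrite e gmulE b0 b1 mul0r add0r mul1r tgE.
  have [z z0 Oz] := scale_integer x.
  have c0 : iota (jK z * x) 1 0 != 0 by rewrite iota_lin cx mulr1.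
  have := proj1 (integer_val D c0) (iO Oz 1 0) => vc.
  exists (absz (v (iota (jK z * x) 1 0)%R)); apply/asboolP; exists (jK z * x).
  by split=> //; rewrite gez0_abs.
have [n /asboolP[th [Oth c0 vth]] min] := ex_minnP PP.
exists th; split=> // x Ox cx0; rewrite vth.
have vc := proj1 (integer_val D cx0) (iO Ox 1 0).
suff : (n <= absz (v (iota x 1%R 0%R)))%N by lia.
by apply: min; apply/asboolP; exists x; split=> //; rewrite gez0_abs.
Qed.

Lemma iota10_eq0 x : iota x 1 0 = 0 -> exists z, x = jK z.
Proof.
move=> c0; have [->|x0] := eqVneq x 0; first by exists 0; rewrite rmorph0.
by have [|z _ ->] := tg_lower_eq0 x0 (iota := iota); [rewrite tgE|exists z].
Qed.

Lemma iota_jK z i j : iota (jK z) i j = z *+ (i == j).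
Proof. by rewrite iota_alg !mxE. Qed.

Variable th : K.
Hypothesis c0 : iota th 1 0 != 0.

Lemma coordinates x : exists z, x = jK z + jK (iota x 1 0 / iota th 1 0) * th.
Proof.
set y := _ / _; have [|z e] := @iota10_eq0 (x - jK y * th).
  by rewrite rmorphB !mxE iota_lin divfK // subrr.
by exists z; rewrite -e subrK.
Qed.

(** By minimality the coefficient y of theta is integral, and then so is the
    other one: O_K = O + O theta. *)
Lemma integer_coordinates (Oth : OK th) :
  (forall x, OK x -> vge (v (iota th 1 0)) (iota x 1 0)) ->
  forall x, OK x -> exists z (y : F), [/\ OF z, OF y & x = jK z + jK y * th].
Proof.
move=> min x Ox; have [z e] := coordinates x; set y := _ / _ in e.
have Oy : OF y.
  apply/(vge_integer D) => y0.
  have cx0 : iota x 1 0 != 0 by apply: contraNneq y0 => c; rewrite /y c mul0r.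
  by rewrite valM ?invr_eq0 // valV // subr_ge0 (min x Ox).
exists z, y; split=> //; apply/(integers_jKE D DK).
have -> : jK z = x - jK y * th by rewrite e addrK.
by apply: (dvrB DK) => //; apply: (dvrM DK) => //; apply: integers_jK.
Qed.

(** Divide by the coefficient of smaller valuation. *)
Lemma primitive_multiple x : x != 0 -> exists (a : F) z (y : F), [/\ a != 0, OF z, OF y,
  integer_units OF z \/ integer_units OF y & jK a * x = jK z + jK y * th].
Proof.
move=> x0; have [z e] := coordinates x; set y := _ / _ in e.
have w0 := dvr_neq0 D.
have main (a b : F) (n : int) : a != 0 -> v a = n -> vge n b ->
    integer_units OF (w ^ (- n) * a) /\ OF (w ^ (- n) * b).
  move=> a0 va vb; split.
    apply: (unitE (D := D)); first by rewrite mulf_neq0 ?expfz_neq0.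
    by rewrite valM ?expfz_neq0 // valwz va addNr.
  by apply/(vge_integer D); rewrite -(addNr n); apply: vgeM => // _; rewrite valwz.
have fin (n : int) : jK (w ^ (- n)) * x = jK (w ^ (- n) * z) + jK (w ^ (- n) * y) * th.
  by rewrite e !rmorphM mulrDr mulrA.
have [y0|y0] := eqVneq y 0.
  have z0 : z != 0 by apply: contraNneq x0 => z0; rewrite e y0 z0 !rmorph0 mul0r addr0.
  exists (w ^ (- v z)), (w ^ (- v z) * z), (w ^ (- v z) * y).
  have [Uz Oy] : integer_units OF (w ^ (- v z) * z) /\ OF (w ^ (- v z) * y).
    by apply: main => //; rewrite y0; apply: vge0.
  by split; rewrite ?expfz_neq0 //; [case: Uz|left].
case: (pselect (vge (v y) z)) => vz.
  have [Uy Oz] := main y z _ y0 erefl vz.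
  exists (w ^ (- v y)), (w ^ (- v y) * z), (w ^ (- v y) * y).
  by split; rewrite ?expfz_neq0 //; [case: Uy|right].
have z0 : z != 0 by apply: contra_notN vz => /eqP ->; apply: vge0.
have [Uz Oy] : integer_units OF (w ^ (- v z) * z) /\ OF (w ^ (- v z) * y).
  apply: main => // _; rewrite leNgt; apply/negP => lt; apply: vz => _; exact: ltW.
exists (w ^ (- v z)), (w ^ (- v z) * z), (w ^ (- v z) * y).
by split; rewrite ?expfz_neq0 //; [case: Uz|left].
Qed.

Section Verify.
Variables (chi : K -> C) (om : F -> C).
Hypotheses (chiM : {morph chi : x y / x * y}) (chi1 : chi 1 = 1).
Hypothesis chi_om : forall z, z != 0 -> chi (jK z) = om z.
Variable r : nat.
Hypotheses (omM : {morph om : x y / x * y}) (om1 : om 1 = 1).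
Hypotheses (r_gt0 : (0 < r)%N) (omr : trivial_on (unit_filtration OF w r) om).
Hypothesis ommin : forall t, trivial_on (unit_filtration OF w t) om -> (r <= t)%N.
Variables (u : GL2 F -> C) (s : nat).
Hypothesis uB : forall (h : GL2 F) g, h 1 0 = 0 -> u (h * g)%g = om (h 0 0) *
  (Num.sqrt (normalized_abs (h 0 0 / h 1 1)))%:C%C * u g.
Hypothesis uL : forall (h : GL2 F) g, Bgroup w s h -> GL2O g ->
  u (h * g)%g = om (h 0 0) * u g.
Hypothesis uR : forall (h : GL2 F) g, Bgroup w s h -> u (g * h)%g = om (h 0 0) * u g.
Hypothesis rs : (r <= s)%N.

(** Up to a scalar, x is z + y theta with z or y a unit. If x is a unit of O_K
    then iota x is in GL_2(O), where u is supported on B(r); if its bottom row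
    is divisible by the lower left entry then u vanishes. *)
Lemma support_from_primitive :
  (forall z (y : F), OF z -> OF y -> integer_units OF z \/ integer_units OF y ->
     let x := jK z + jK y * th in integer_units OK x \/
     (iota x 1 0 != 0 /\ OF (iota x 1 1 / iota x 1 0))) ->
  forall x, x != 0 -> u (tg x) != 0 -> in_level w iota r x.
Proof.
move=> prim x x0 ux; have [a [z [y [a0 Oz Oy zy e]]]] := primitive_multiple x0.
have ux' : u (tg (jK a * x)) != 0.
  rewrite tgM ?jK_neq0 // (u_scal iota uB) // mulf_neq0 //.
  by rewrite -chi_om // (chi_neq0 chiM chi1) // jK_neq0.
exists a => //; have ax0 : jK a * x != 0 by rewrite mulf_neq0 ?jK_neq0.
have := prim z y Oz Oy zy; rewrite /= -e => -[Ux|[n0 Od]].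
  have gO : GL2O (tg (jK a * x)) by apply: (tg_GL2O iO).
  apply/(BgroupP D); split=> //; apply: contrapT => nv.
  by move: ux'; rewrite (level_support om1 r_gt0 uL uR ommin gO nv) eqxx.
move: ux'; rewrite (level_support_row D om1 r_gt0 uB uL uR ommin) ?eqxx //; rewrite tgE //.
Qed.

(** Elements of level s are x = z (1 + y theta / z) with z a unit of F and y so
    small that omega sees only z and that chi is trivial on the second factor.
    *)
Lemma psi_trivial N : (0 < N)%N -> trivial_on (unit_filtration OK wK N) chi ->
  (forall y : F, vge s%:Z (y * iota th 1 0) -> vge r%:Z (y * iota th 0 0) /\
     vgeK N%:Z (jK y * th)) ->
  forall x, x != 0 -> Bgroup w s (tg x) -> om (tg x 0 0) = chi x.
Proof.
move=> N0 chiN H x x0 B; have [z e] := coordinates x; set y := _ / _ in e.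
have s0 : (0 < s)%N := leq_trans r_gt0 rs.
have [Ua _] := Bgroup_units D s0 B; have /(BgroupP D)[gO vc] := B.
have [|vra vK1] := H y; first by rewrite divfK // -tgE.
have ax : tg x 0 0 = z + y * iota th 0 0.
  by rewrite tgE // {1}e rmorphD mxE iota_lin iota_jK mulr1n.
have Uz : integer_units OF z.
  rewrite -(addrK (y * iota th 0 0) z) -ax; apply: (units_add (D := D)) => //.
  by apply: vgeN; apply: vge_le vra; lia.
have [_ z0 OzV] := Uz.
rewrite (om_near (D := D) omM r_gt0 omr Uz (x := tg x 0 0)); last by rewrite ax addrC addKr.
have -> : x = jK z * (1 + jK z^-1 * (jK y * th)).
  by rewrite {1}e mulrDr mulr1 mulrA -rmorphM mulfV // rmorph1 mul1r.
rewrite chiM chi_om // [chi (1 + _)]chiN ?mulr1 //.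
apply/(unit_filtrationE DK) => //; rewrite addrC addKr.
by apply: vgeMr => //; apply: integers_jK.
Qed.

(** An element congruent to 1 modulo w^(s-1), at which chi is not 1 although
    omega is, as s - 1 is at least r. *)
Lemma psi_nontrivial : (r < s)%N ->
  (exists2 y, OK y & chi (1 + jK (w ^+ s.-1) * y) != 1) ->
  exists y0, [/\ y0 != 0, Bgroup w s.-1 (tg y0) & om (tg y0 0 0) != chi y0].
Proof.
move=> lrs [y Oy chiy]; set t := s.-1 in chiy *.
have rt : (r <= t)%N by rewrite /t; lia.
have t0 : (0 < t)%N := leq_trans r_gt0 rt.
have vt : vge t%:Z (w ^+ t) by move=> _; rewrite valwX.
have Ux : integer_units OK (1 + jK (w ^+ t) * y).
  apply: (units_add (D := DK)); first exact: units1 DK.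
  apply: vgeMl => //; apply: vge_le (vgeK_jK DK vt).
  have := ram_index_gt0 D DK; nia.
have [_ x0 _] := Ux; exists (1 + jK (w ^+ t) * y).
have iE i j : tg (1 + jK (w ^+ t) * y) i j = (i == j)%:R + w ^+ t * iota y i j.
  by rewrite tgE // rmorphD rmorph1 !mxE iota_lin.
split=> //.
  apply/(BgroupP D); split; first exact: (tg_GL2O iO).
  by rewrite iE add0r; apply: vgeMl => //; apply: iO.
rewrite iE (om_near (D := D) omM r_gt0 omr (units1 D)) ?om1 1?eq_sym //.
rewrite addrC addKr; apply: vgeMl; last exact: iO.
by apply: vge_le vt; lia.
Qed.
End Verify.
End Generator.

(** * Unramified and ramified extensions *)

Section Cases.
Variables (R : realType) (p : nat) (Qp : padicField R p) (F : fieldExtType Qp).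
Variables (K : fieldExtType F) (w : F) (wK : K).
Local Notation OF := (integers F).
Local Notation OK := (ext_integers K).
Local Notation C := R[i].
Hypotheses (D : dvr OF w p) (DK : dvr OK wK p).
Local Notation vgeK := (vge DK).
Local Notation vge := (vge D).
Local Notation v := (dval D).
Local Notation vK := (dval DK).
Local Notation jK := (in_alg K).
Local Notation ram := (ram_index w DK).
Implicit Types (x y u : K) (z : F) (g k : GL2 F).

Lemma unramified_ram_index : uniformizer OK wK -> unramified_ext K w <-> ram = 1.
Proof.
move=> [_ eK]; have ip x : ideal_power OK (jK w) 1 x <-> vgeK ram x.
  rewrite (vge_shift DK); split=> [[y Oy ->]|h].
    rewrite expr1 mulrAC.
    have : integer_units OK (jK w / wK ^ ram).
      apply: (unitE (D := DK)).
        by rewrite mulf_neq0 ?invr_eq0 ?expfz_neq0 ?(dvr_neq0 DK) ?jK_neq0 ?(dvr_neq0 D).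
      rewrite valM ?valV ?invr_eq0 ?expfz_neq0 ?(dvr_neq0 DK) ?jK_neq0 ?(dvr_neq0 D) //.
      by rewrite valwz subrr.
    by case=> O1 _ _; apply: (dvrM DK).
  exists (x / jK w); last by rewrite expr1 mulrC divfK // jK_neq0 ?(dvr_neq0 D).
  apply/(vge_integer DK) => y0; have x0 : x != 0 by apply: contraNneq y0 => ->; rewrite mul0r.
  rewrite valM ?invr_eq0 ?jK_neq0 ?(dvr_neq0 D) // valV ?jK_neq0 ?(dvr_neq0 D) //.
  rewrite subr_ge0; have := proj2 (vge_shift DK ram x) h x0; exact.
have eq1 : ideal_power OK wK 1 = [set x | vgeK 1 x].
  by apply/seteqP; split=> x /=; rewrite (ideal_powerE DK).
have eqr : ideal_power OK (jK w) 1 = [set x | vgeK ram x].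
  by apply/seteqP; split=> x /=; rewrite ip.
rewrite /unramified_ext /uniformizer eK eq1 eqr; split.
  move=> [_ e]; have : [set x | vgeK 1 x] wK by move=> _ /=; rewrite valw.
  rewrite e /= => /(_ (dvr_neq0 DK)); rewrite valw => h.
  have := ram_index_gt0 D DK; lia.
by move=> ->; rewrite jK_neq0 // (dvr_neq0 D).
Qed.

Variable iota : {lrmorphism K -> 'M[F]_2}.
Local Notation tg := (torus_GL2 iota).
Hypothesis iO : forall x, OK x -> forall i j, OF (iota x i j).

Lemma val_det_unit x : integer_units OK x -> v (\det (iota x)) = 0.
Proof.
move=> Ux; have [_ x0 _] := Ux; rewrite -(tgE iota x0).
exact: (val_unit D (GL2O_det D (tg_GL2O iO Ux))).
Qed.

Lemma det_iota_neq0 x : x != 0 -> \det (iota x) != 0.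
Proof. by move=> x0; rewrite -(tgE iota x0) gl_det_neq0. Qed.

(** A power of the uniformizer of K with exponent the ramification index is w
    up to a unit, and the determinant of iota w is w^2. *)
Lemma val_det_iota : ram * v (\det (iota wK)) = 2.
Proof.
have [y Uy e] := valE DK (jK_neq0 K (dvr_neq0 D)).
have [n rn] : exists n : nat, ram = n%:Z.
  by exists `|ram|%N; have := ram_index_gt0 D DK; lia.
have : v (\det (iota (jK w))) = 2.
  rewrite iota_alg det_scalar valX ?(dvr_neq0 D) // valw; lia.
rewrite e -/ram rn -exprnP rmorphM det_mulmx rmorphXn.
have -> : \det (iota wK ^+ n) = \det (iota wK) ^+ n.
  by elim: n {rn} => [|n IH]; rewrite ?expr0 ?det1 // !exprS det_mulmx IH.
have [_ y0 _] := Uy.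
rewrite valM ?expf_neq0 ?det_iota_neq0 ?(dvr_neq0 DK) // (val_det_unit Uy) addr0.
by rewrite valX // det_iota_neq0 // (dvr_neq0 DK).
Qed.

Lemma ram_index_2 : ram <> 1 -> ram = 2 /\ v (\det (iota wK)) = 1.
Proof.
move: val_det_iota (ram_index_gt0 D DK); move: ram (v _) => a b.
move=> ab a0 a1; have b0 : 0 < b by nia.
have : a <= 2 by nia.
move=> a2; have a22 : a = 2 by lia.
by split=> //; move: ab; rewrite a22; lia.
Qed.

Section RamifiedUniformizer.
Hypothesis rc : ram = 2.
Hypothesis iR : forall x, OK x -> vge 1 (iota x 1 0).

(** The square of the uniformizer of K is w times a unit, so that its matrix M
    satisfies M^2 = 0 modulo w; as M is upper triangular modulo w, its diagonal
    vanishes modulo w. Since det M has valuation 1, so has the product of the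
    other two entries. *)
Lemma iota_uniformizer : [/\ vge 1 (iota wK 0 0), vge 1 (iota wK 1 1),
  iota wK 1 0 != 0, v (iota wK 1 0) = 1 & integer_units OF (iota wK 0 1)].
Proof.
have Ow := dvr_w DK.
have [|_ vd] := ram_index_2; first by rewrite rc.
have [e Ue we] : exists2 e, integer_units OK e & wK * wK = jK w * e.
  have jw0 : jK w != 0 by rewrite jK_neq0 // (dvr_neq0 D).
  exists (wK * wK / jK w); last by rewrite [RHS]mulrC divfK.
  apply: (unitE (D := DK)); first by rewrite !mulf_neq0 ?invr_eq0 // (dvr_neq0 DK).
  by rewrite !valM ?mulf_neq0 ?invr_eq0 ?(dvr_neq0 DK) // valV // valw -/ram rc.
have sqE i j : vge 1 ((iota wK *m iota wK) i j).
  rewrite -iota_mul we iota_lin; apply: vgeMl; first by move=> _; rewrite valw.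
  by apply: iO; case: Ue.
have bc i j : vge 1 (iota wK i j * iota wK 1 0).
  by apply: vgeMr; [apply: iO|apply: iR].
have sqr (x : F) : OF x -> vge 1 (x * x) -> vge 1 x.
  move=> Ox h x0; have := h (mulf_neq0 x0 x0); rewrite valM //.
  have := proj1 (integer_val D x0) Ox; lia.
have va : vge 1 (iota wK 0 0).
  apply: sqr; first exact: iO.
  have := sqE 0 0; rewrite mul22 => h; rewrite -(addrK (iota wK 0 1 * iota wK 1 0) (_ * _)).
  exact: vgeB.
have vdd : vge 1 (iota wK 1 1).
  apply: sqr; first exact: iO.
  have := sqE 1 1; rewrite mul22 addrC [iota wK 1 0 * _]mulrC => h.
  by rewrite -(addrK (iota wK 0 1 * iota wK 1 0) (_ * _)); apply: vgeB.
have d0 : \det (iota wK) != 0 by rewrite det_iota_neq0 // (dvr_neq0 DK).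
have dE := det_mx22 (iota wK).
have ad : vge 2 (iota wK 0 0 * iota wK 1 1) by apply: (vgeM va vdd).
have nd : ~ vge 2 (- \det (iota wK)).
  by move=> /(vgeN (D := D)); rewrite opprK => /(_ d0); rewrite vd.
have near : vge 2 (iota wK 0 1 * iota wK 1 0 - (- \det (iota wK))).
  by rewrite dE opprK addrC subrK.
have [bc0 vbc] := vge_near nd near.
have [b0 c0] : iota wK 0 1 != 0 /\ iota wK 1 0 != 0.
  by move: bc0; rewrite mulf_eq0 negb_or => /andP.
have vN : v (- \det (iota wK)) = 1.
  rewrite -mulN1r valM ?oppr_eq0 ?oner_neq0 // vd.
  rewrite (val_unit D (_ : integer_units OF (-1))) //.
  split; rewrite ?oppr_eq0 ?oner_neq0 // ?invrN1; apply: (dvrN D); exact: dvr_one D.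
rewrite valM // vN in vbc.
have vc := iR Ow c0; have vb := proj1 (integer_val D b0) (iO Ow 0 1).
split=> //; first by lia.
apply: (unitE (D := D)) => //; lia.
Qed.

End RamifiedUniformizer.

Hypothesis dK : \dim {:K} = 2%N.

(** If all the lower left entries were divisible by w, then theta - a(theta)
    would have a nonunit determinant, hence be divisible by w in O_K, which
    contradicts the minimality of the valuation at theta. *)
Lemma unramified_generator : ram = 1 -> exists2 th, OK th & integer_units OF (iota th 1 0).
Proof.
move=> r1; have [th [Oth c0 min]] := exists_generator D DK iO dK.
exists th => //; apply: (unitE (D := D)) => //.
have e0 := proj1 (integer_val D c0) (iO Oth 1 0).
apply/eqP; rewrite eq_le e0 andbT leNgt; apply/negP => e1.
pose a := iota th 0 0; pose th' := th - jK a.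
have thE i j : iota th' i j = iota th i j - a *+ (i == j).
  by rewrite rmorphB !mxE iota_jK.
have cth' : iota th' 1 0 = iota th 1 0 by rewrite thE subr0.
have th'0 : th' != 0.
  by apply/eqP => th'0; move: c0; rewrite -cth' th'0 rmorph0 mxE eqxx.
have Oth' : OK th' by apply: (dvrB DK) => //; apply: integers_jK; apply: iO.
have vth' : vgeK 1 th'.
  apply: contrapT => nv; have Uth' : integer_units OK th' by apply/(unitP2 DK).
  have := val_det_unit Uth'; rewrite det_mx22 [iota th' 0 0]thE subrr mul0r sub0r.
  have n0 : - (iota th' 0 1 * iota th' 1 0) != 0.
    by have := det_iota_neq0 th'0; rewrite det_mx22 [iota th' 0 0]thE subrr mul0r sub0r.
  have : vge 1 (- (iota th' 0 1 * iota th' 1 0)).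
    apply: vgeN; apply: vgeMr; first exact: iO.
    by rewrite cth' => _.
  by move=> /(_ n0) h1 h2; move: h1; rewrite h2.
have Ow : OK (th' / jK w).
  apply/(vge_integer DK) => y0; rewrite valM ?invr_eq0 ?jK_neq0 ?(dvr_neq0 D) //.
  by rewrite valV ?jK_neq0 ?(dvr_neq0 D) // -/ram r1 subr_ge0 vth'.
have := min _ Ow; rewrite mulrC -fmorphV iota_lin cth'.
rewrite /vge; have cw0 : w^-1 * iota th 1 0 != 0 by rewrite mulf_neq0 ?invr_eq0 ?(dvr_neq0 D).
move=> /(_ cw0); rewrite valM ?invr_eq0 ?(dvr_neq0 D) // valV ?(dvr_neq0 D) // valw; lia.
Qed.

(** If the lower left entry of theta were not a unit, then w^(s-1) theta would
    lie in the Eichler order of level s, hence in O + P^s O_K; its lower left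
    entry would have too large a valuation, by minimality. *)
Lemma conductor_order_generator s : (0 < s)%N ->
  (forall x, (forall i j, OF (iota x i j)) -> vge s%:Z (iota x 1 0) ->
     conductor_order w s x) ->
  exists2 th, OK th & integer_units OF (iota th 1 0).
Proof.
move=> s0 H; have [th [Oth c0 min]] := exists_generator D DK iO dK.
exists th => //; apply: (unitE (D := D)) => //.
have e0 := proj1 (integer_val D c0) (iO Oth 1 0).
apply/eqP; rewrite eq_le e0 andbT leNgt; apply/negP => e1.
have wn0 (l : nat) : w ^+ l != 0 by rewrite expf_neq0 // (dvr_neq0 D).
pose x := jK (w ^+ s.-1) * th.
have [||a [y [Oa [y' Oy' ->] e]]] := H x.
- move=> i j; rewrite iota_lin; apply: (dvrM D); last exact: iO.
  by apply: (dvrX D); exact: dvr_w D.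
- rewrite iota_lin => n0; rewrite valM // valwX; lia.
have ec : iota x 1 0 = iota (jK a + jK (w ^+ s) * y') 1 0 by rewrite rmorphXn -e.
move: ec; rewrite iota_lin rmorphD mxE iota_jK add0r iota_lin => ec.
have cy0 : iota y' 1 0 != 0.
  apply/eqP => cy; move: ec; rewrite cy mulr0 => /eqP.
  by rewrite mulf_eq0 (negPf c0) (negPf (wn0 _)).
have := congr1 v ec; rewrite !valM // !valwX; have := min _ Oy' cy0; lia.
Qed.

Section Nonvanishing.
Variables (chi : K -> C) (om : F -> C).
Hypotheses (chiM : {morph chi : x y / x * y}) (chi1 : chi 1 = 1).
Hypothesis chi_om : forall z, z != 0 -> chi (jK z) = om z.
Variable r : nat.
Hypotheses (omM : {morph om : x y / x * y}) (om1 : om 1 = 1).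
Hypotheses (r_gt0 : (0 < r)%N) (omr : trivial_on (unit_filtration OF w r) om).
Hypothesis ommin : forall t, trivial_on (unit_filtration OF w t) om -> (r <= t)%N.
Variables (u : GL2 F -> C) (s n m : nat).
Hypothesis uB : forall (h : GL2 F) g, h 1 0 = 0 -> u (h * g)%g = om (h 0 0) *
  (Num.sqrt (normalized_abs (h 0 0 / h 1 1)))%:C%C * u g.
Hypothesis uL : forall (h : GL2 F) g, Bgroup w s h -> GL2O g ->
  u (h * g)%g = om (h 0 0) * u g.
Hypothesis uR : forall (h : GL2 F) g, Bgroup w s h -> u (g * h)%g = om (h 0 0) * u g.
Hypothesis uK : forall k g, congruence_subgroup n k -> u (g * k)%g = u g.
Hypothesis chim : trivial_on (unit_filtration OK p%:R m) chi.
Hypothesis rs : (r <= s)%N.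
Hypothesis u_min : s = r -> u 1%g != 0.
Hypothesis u_drop : (r < s)%N -> u (lower (w ^+ s.-1)) != u 1%g.

(** Here x = z + y theta is in level t exactly when t is at most v(y), for z a
    unit, so that the filtration by levels is the one by O + P^t O_K. *)
Lemma nonvanishing_unit_generator th N : OK th -> integer_units OF (iota th 1 0) ->
  N%:Z = ram * s%:Z -> conductor_exponent OK wK chi N ->
  torus_mean DK (fun x => u (tg x) / chi x) != 0.
Proof.
move=> Oth Uc NE [chiN chimin]; have [Oc c0 OcV] := Uc.
have ram0 := ram_index_gt0 D DK.
have s0 : (0 < s)%N := leq_trans r_gt0 rs.
have supp : forall x, x != 0 -> u (tg x) != 0 -> in_level w iota r x.
  apply: (support_from_primitive D iO c0 chiM chi1 chi_om om1 r_gt0 ommin uB uL uR).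
  move=> z y Oz Oy zy /=.
  have xE i j : iota (jK z + jK y * th) i j = z *+ (i == j) + y * iota th i j.
    by rewrite rmorphD mxE iota_jK iota_lin.
  case: (pselect (integer_units OF y)) => [Uy|ny].
    right; have [_ y0 OyV] := Uy; rewrite !xE add0r mulf_neq0 //; split=> //.
    apply: (dvrM D); last by rewrite invfM; apply: (dvrM D).
    by apply: (dvrD D) => //; apply: (dvrM D) => //; apply: iO.
  left; case: zy => // Uz; apply: (units_add (D := DK)); first exact: units_jK.
  apply: vgeMl => //; have vy : vge 1 y by apply: contrapT => vy; apply: ny; apply/(unitP2 D).
  by apply: vge_le (vgeK_jK DK vy); lia.
have psi : forall x, x != 0 -> Bgroup w s (tg x) -> om (tg x 0 0) = chi x.
  apply: (psi_trivial (D := D) (DK := DK) c0 chiM chi_om omM r_gt0 omr rs _ chiN).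
    have : 0 < N%:Z by rewrite NE mulr_gt0 // ltz_nat.
    by [].
  move=> y vy; have vy' : vge s%:Z y by move: vy; rewrite mulrC vgeZ_unit.
  split.
    apply: vgeMl; last exact: iO.
    by apply: vge_le vy'; lia.
  by apply: vgeMl => //; rewrite NE; apply: (vgeK_jK DK).
have [sr|lrs] : s = r \/ (r < s)%N by lia.
  apply: (nonvanishing_minimal D DK iO chiM chi1 chi_om uB uR uK chim supp psi sr).
  exact: u_min.
have Hy : exists2 y, OK y & chi (1 + jK (w ^+ s.-1) * y) != 1.
  (* The conductor exponent of chi is that of P^s, so chi is not trivial on 1 +
     P^(s-1) O_K. *)
  pose N' := absz (ram * s.-1%:Z).
  have N'E : N'%:Z = ram * s.-1%:Z by rewrite gez0_abs // mulr_ge0 // ltW.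
  have ltN : ~ (N <= N')%N.
    move=> h; have : N%:Z <= N'%:Z by [].
    rewrite NE N'E ler_pM2l //; lia.
  have : ~ trivial_on (unit_filtration OK wK N') chi by move/chimin.
  move=> /existsNP[t] /not_implyP[[Ut /(ideal_powerE DK) It] /eqP chit].
  have wn0 : jK (w ^+ s.-1) != 0 by rewrite jK_neq0 // expf_neq0 // (dvr_neq0 D).
  exists ((t - 1) / jK (w ^+ s.-1)); last by rewrite mulrC divfK // addrC subrK.
  apply/(vge_integer DK) => y0.
  have t1 : t - 1 != 0 by apply: contraNneq y0 => ->; rewrite mul0r.
  rewrite valM ?invr_eq0 // valV // (valK_jK D) ?expf_neq0 ?(dvr_neq0 D) // valwX.
  by rewrite subr_ge0 -N'E It.
have [y0 [y00 By0 psi0]] :=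
  psi_nontrivial D DK iO c0 omM om1 r_gt0 omr rs lrs Hy.
exact: (nonvanishing_drop D DK iO chiM chi1 chi_om omM om1 r_gt0 omr ommin uB uL uR
  uK chim rs supp psi lrs (u_drop lrs) y00 By0 psi0).
Qed.

Hypothesis rc : ram = 2.
Hypothesis iR : forall x, OK x -> vge 1 (iota x 1 0).

(** With the uniformizer of K in the place of theta, z + y wK has level r when
    y has valuation at least r - 1, and then y wK has valuation at least 2 r -
    1 in K. *)
Lemma nonvanishing_odd : s = r -> conductor_exponent OK wK chi (2 * r - 1)%N ->
  torus_mean DK (fun x => u (tg x) / chi x) != 0.
Proof.
move=> sr [chiN _]; have [va vdd c0 vc Ub] := iota_uniformizer rc iR.
have supp : forall x, x != 0 -> u (tg x) != 0 -> in_level w iota r x.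
  apply: (support_from_primitive D iO c0 chiM chi1 chi_om om1 r_gt0 ommin uB uL uR).
  move=> z y Oz Oy zy /=.
  have xE i j : iota (jK z + jK y * wK) i j = z *+ (i == j) + y * iota wK i j.
    by rewrite rmorphD mxE iota_jK iota_lin.
  case: (pselect (integer_units OF z)) => [Uz|nz].
    left; apply: (units_add (D := DK)); first exact: units_jK.
    apply: vgeMr; first exact: integers_jK.
    by move=> _; rewrite valw.
  right; case: zy => // Uy; have [_ y0 OyV] := Uy; rewrite !xE add0r mulf_neq0 //; split=> //.
  apply/(vge_integer D); have vz : vge 1 z by apply: contrapT => vz; apply: nz; apply/(unitP2 D).
  rewrite -[0](subrr 1); apply: vgeM.
    by rewrite mulr1n; apply: vgeD => //; apply: vgeMr.
  by move=> _; rewrite valV ?mulf_neq0 // valM // vc (val_unit D Uy).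
have psi : forall x, x != 0 -> Bgroup w s (tg x) -> om (tg x 0 0) = chi x.
  apply: (psi_trivial (D := D) (DK := DK) c0 chiM chi_om omM r_gt0 omr rs _ chiN).
    by lia.
  move=> y vy; have vy' : vge (r%:Z - 1) y.
    move=> y0; have := vy (mulf_neq0 y0 c0); rewrite valM // vc sr; lia.
  split.
    by rewrite -(subrK 1 r%:Z); apply: vgeM.
  have := vgeM (vgeK_jK DK vy') (_ : vgeK 1 wK); rewrite rc => /(_ _)/(vge_le _); apply.
    by lia.
  by move=> _; rewrite valw.
apply: (nonvanishing_minimal D DK iO chiM chi1 chi_om uB uR uK chim supp psi sr).
exact: u_min.
Qed.
End Nonvanishing.
End Cases.

(** * Conjugate embeddings *)

Section ConjugateEmbedding.
Variables (F : fieldType) (K : fieldExtType F) (iota : {lrmorphism K -> 'M[F]_2}).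
Variable k : GL2 F.

Definition conj_embedding (x : K) : 'M[F]_2 :=
  GL2_mx k^-1%g *m iota x *m GL2_mx k.

Let kVk : GL2_mx k^-1%g *m GL2_mx k = 1%:M.
Proof. by have /(congr1 (@GL2_mx F)) /= -> := mulVg k. Qed.
Let kkV : GL2_mx k *m GL2_mx k^-1%g = 1%:M.
Proof. by have /(congr1 (@GL2_mx F)) /= -> := mulgV k. Qed.

Fact conj_embedding_linear : linear conj_embedding.
Proof.
move=> a x y; rewrite /conj_embedding linearP mulmxDr mulmxDl.
by rewrite -scalemxAr -scalemxAl.
Qed.

Fact conj_embedding_monoid : monoid_morphism conj_embedding.
Proof.
split=> [|x y]; rewrite /conj_embedding ?rmorph1 ?mulmx1 ?kVk //.
rewrite iota_mul -[RHS]/((GL2_mx k^-1%g *m iota x *m GL2_mx k) *m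
  (GL2_mx k^-1%g *m iota y *m GL2_mx k)).
by rewrite !mulmxA -(mulmxA _ (GL2_mx k) (GL2_mx k^-1%g)) kkV mulmx1.
Qed.

HB.instance Definition _ := GRing.isLinear.Build F K 'M[F]_2 _ conj_embedding
  conj_embedding_linear.
HB.instance Definition _ := GRing.isMonoidMorphism.Build K 'M[F]_2 conj_embedding
  conj_embedding_monoid.

Definition conj_iota : {lrmorphism K -> 'M[F]_2} := conj_embedding.

Lemma conj_iotaE x : conj_iota x = GL2_mx k^-1%g *m iota x *m GL2_mx k.
Proof. by []. Qed.

Lemma iota_conjE x : iota x = GL2_mx k *m conj_iota x *m GL2_mx k^-1%g.
Proof. by rewrite conj_iotaE !mulmxA kkV mul1mx -mulmxA kkV mulmx1. Qed.

Lemma tg_conj x : x != 0 ->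
  torus_GL2 conj_iota x = (k^-1 * torus_GL2 iota x * k)%g.
Proof. by move=> x0; apply: val_inj; rewrite [LHS]tgE //= tgE. Qed.

Lemma conj_tg x : x != 0 ->
  (torus_GL2 iota x * k)%g = (k * torus_GL2 conj_iota x)%g.
Proof. by move=> x0; rewrite tg_conj // !mulgA mulgV mul1g. Qed.
End ConjugateEmbedding.

(** * The equivariant functional *)

Section Functional.
Variables (R : realType) (p : nat) (Qp : padicField R p) (F : fieldExtType Qp).
Variables (K : fieldExtType F) (w : F) (wK : K).
Local Notation OF := (integers F).
Local Notation OK := (ext_integers K).
Local Notation C := R[i].
Local Notation jK := (in_alg K).
Hypotheses (D : dvr OF w p) (DK : dvr OK wK p).
Hypothesis dK : \dim {:K} = 2%N.
Variable iota : {lrmorphism K -> 'M[F]_2}.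
Local Notation tg := (torus_GL2 iota).
Hypothesis iO : forall x, OK x -> forall i j, OF (iota x i j).
Variables nu1 nu2 : F -> C.
Local Notation Pi := (principal_series nu1 nu2).
Implicit Types (x y : K) (z : F) (g : GL2 F) (f : Pi).

Lemma ps_B f (b : GL2 F) g : b 1 0 = 0 -> ps_fun f (b * g)%g =
  nu1 (b 0 0) * nu2 (b 1 1) * (Num.sqrt (normalized_abs (b 0 0 / b 1 1)))%:C%C * ps_fun f g.
Proof. by move: (valP f) => /asboolP[H _]; apply: H. Qed.

Lemma ps_K f : exists n : nat, forall k g, congruence_subgroup n k ->
  ps_fun f (g * k)%g = ps_fun f g.
Proof. by move: (valP f) => /asboolP[_]. Qed.

Lemma ps_actE g f h : ps_fun (rep_act g f : Pi) h = ps_fun f (h * g)%g.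
Proof. by []. Qed.

Lemma ps_lin a f f' g : ps_fun (a *: f + f' : Pi) g = a * ps_fun f g + ps_fun f' g.
Proof. by []. Qed.

Lemma ps_0 g : ps_fun (0 : Pi) g = 0. Proof. by []. Qed.
Lemma ps_Z a f g : ps_fun (a *: f : Pi) g = a * ps_fun f g. Proof. by []. Qed.

Lemma ps_sum (I : Type) (r : seq I) (P : pred I) (f_ : I -> Pi) g :
  ps_fun (\sum_(i <- r | P i) f_ i : Pi) g = \sum_(i <- r | P i) ps_fun (f_ i) g.
Proof. by apply: (big_morph (fun f : Pi => ps_fun f g)). Qed.

Lemma ps_eqP f f' : (forall g, ps_fun f g = ps_fun f' g) -> f = f'.
Proof. by move=> e; apply: val_inj; apply/funext. Qed.

Variable chi : character OK p C.
Hypothesis central : forall z, z != 0 -> chi (jK z) = nu1 z * nu2 z.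

Lemma ps_scal f z g : z != 0 -> ps_fun f (tg (jK z) * g)%g = nu1 z * nu2 z * ps_fun f g.
Proof.
move=> z0; rewrite ps_B ?(tg_algE iota z0) // divff // normalized_abs1 Num.Theory.sqrtr1.
by rewrite [(1)%:C%C](_ : _ = 1) // mulr1.
Qed.

Lemma matrix_coefficient_smooth f :
  exists N, torus_smooth OK p N (fun x => ps_fun f (tg x) / chi x).
Proof.
have [n fn] := ps_K f; have [m chim] := char_smooth chi.
apply: (torus_quotient_smooth DK iO (om := fun z => nu1 z * nu2 z) (charM chi)
  (char1 chi) central _ fn chim) => z g; exact: ps_scal.
Qed.

Definition torus_integral f : C := torus_mean DK (fun x => ps_fun f (tg x) / chi x).

Lemma torus_integral_linear : linear (torus_integral : Pi -> C^o).
Proof.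
move=> a f f'; have [n sf] := matrix_coefficient_smooth f.
have [n' sf'] := matrix_coefficient_smooth f'.
have [n'' sff] := matrix_coefficient_smooth (a *: f + f' : Pi).
pose N := maxn n (maxn n' n'').
have s1 := torus_smooth_le DK (leq_maxl n (maxn n' n'')) sf.
have s2 := torus_smooth_le DK (leq_trans (leq_maxl n' n'') (leq_maxr n _)) sf'.
have s3 := torus_smooth_le DK (leq_trans (leq_maxr n' n'') (leq_maxr n _)) sff.
rewrite /torus_integral -[RHS]/(a * _ + _) -(torus_mean_comb DK a s1 s2).
apply: (eq_torus_mean DK s3).
  by move=> x y x0 e; rewrite (s1 x y) // (s2 x y).
by move=> x x0; rewrite ps_lin; ring.
Qed.

Lemma torus_integral_act x f : x != 0 ->
  torus_integral (rep_act (tg x) f) = chi x * torus_integral f.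
Proof.
move=> x0; have [n sf] := matrix_coefficient_smooth f.
have [n' sf'] := matrix_coefficient_smooth (rep_act (tg x) f).
have cx0 : chi x != 0 by apply: (chi_neq0 (charM chi) (char1 chi)).
have s1 := torus_smooth_le DK (leq_maxl n n') sf.
have s2 := torus_smooth_le DK (leq_maxr n n') sf'.
rewrite /torus_integral -(torus_mean_shift DK x0 s1).
have s3 : torus_smooth OK p (maxn n n') (fun y => ps_fun f (tg (y * x)) / chi (y * x)).
  move=> y y' y0 [z [u [z_0 Uu e]]]; apply: s1; first exact: mulf_neq0.
  by exists z, u; split=> //; rewrite e mulrA.
rewrite -(torus_meanZ DK (chi x) s3); apply: (eq_torus_mean DK s2).
  by move=> y y' y0 e; rewrite (s3 y y').
move=> y y0; rewrite ps_actE -tgM // charM.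
by field; rewrite cx0 (chi_neq0 (charM chi) (char1 chi)).
Qed.

(** GL_2(F) = B T. *)
Lemma ps_torus_eq0 f : (forall x, x != 0 -> ps_fun f (tg x) = 0) -> f = 0.
Proof.
move=> f0; apply: ps_eqP => g; rewrite ps_0.
have [b [x [x0 b0 _ ->]]] := torus_borel iota dK g.
by rewrite ps_B // f0 // mulr0.
Qed.

(** If the mean of f vanishes, so does the restriction to T of the average of f
    over the torus, which is therefore 0; but l takes the same value at f and
    at this average, up to the number of terms. *)
Lemma equivariant_kernel (l : {linear Pi -> C^o}) f :
  equivariant_functional iota chi l -> torus_integral f = 0 -> l f = 0.
Proof.
move=> l_eq f0; have [n sf] := matrix_coefficient_smooth f.
have rT := level_transversal DK n.
have n0 : (0 < tag (sval (cid (torus_transversal (F := F) DK n))))%N.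
  by apply: (transversal_gt0 rT (x := 1)); apply: oner_neq0.
move: f0; rewrite /torus_integral (torus_meanE DK sf).
have shift x (x0 : x != 0) := level_mean_shift DK x0 sf.
move=> f0; rewrite /level_mean in f0 shift.
have [rn _ _] := rT.
move: (tagged _) n0 rn shift f0 => r n0 rn shift f0.
set m := tag _ in r n0 rn shift f0.
have mC : (m%:R : C) != 0 by rewrite pnatr_eq0 -lt0n.
have r0 i : chi (r i) != 0 by apply: (chi_neq0 (charM chi) (char1 chi)); apply: rn.
pose f' : Pi := \sum_(i < m) (chi (r i))^-1 *: rep_act (tg (r i)) f.
have f'0 : f' = 0.
  apply: ps_torus_eq0 => x x0; have := shift x x0; rewrite f0 /mean => /eqP.
  rewrite mulf_eq0 invr_eq0 (negPf mC) /= => /eqP e.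
  rewrite -[LHS](mulVKf (chi_neq0 (charM chi) (char1 chi) x0)) [X in _ * X](_ : _ = 0) ?mulr0 //.
  rewrite mulrC -[RHS]e /f' ps_sum mulr_suml; apply: eq_bigr => i _.
  rewrite ps_Z ps_actE -tgM ?rn // [r i * x]mulrC charM invfM.
  ring.
have : l f' = m%:R * l f.
  rewrite /f' linear_sum /= -[RHS]/(m%:R * l f) mulr_natl.
  rewrite -[in RHS](card_ord m) -sumr_const; apply: eq_bigr => i _.
  rewrite linearZ /= (l_eq (r i)) ?tgE ?rn //.
  by rewrite -[LHS]/(_ * _) mulKf.
rewrite f'0 linear0 => /esym/eqP; rewrite mulf_eq0 (negPf mC) /=.
by move/eqP.
Qed.

(** Multiplicity one follows since every equivariant functional vanishes on the
    kernel of the integral. *)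
Lemma test_vector_torus_integral f : torus_integral f != 0 -> test_vector iota chi f.
Proof.
move=> lf.
pose l : {linear Pi -> C^o} := HB.pack torus_integral
  (GRing.isLinear.Build C Pi C^o _ torus_integral torus_integral_linear).
have l_eq : equivariant_functional iota chi l.
  move=> t g v e; have [t0 ->] := tg_eq e; exact: torus_integral_act.
exists l; split=> // l' l'eq; exists (l' f / l f) => x.
have : l' (x - (l x / l f) *: f) = 0.
  apply: equivariant_kernel => //; rewrite -[LHS]/(l _) linearB linearZ /=.
  by rewrite -[X in _ - X]/(_ * _) divfK // subrr.
rewrite linearB linearZ /= => /eqP; rewrite subr_eq0 => /eqP ->.
rewrite -[LHS]/(_ * _); ring.
Qed.
End Functional.

(** * Vectors of level s in the principal series *)

Section LevelVectorFacts.
Variables (R : realType) (p : nat) (Qp : padicField R p) (F : fieldExtType Qp).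
Variable w : F.
Local Notation OF := (integers F).
Local Notation C := R[i].
Hypothesis D : dvr OF w p.
Variables (om : F -> C) (r : nat).
Hypotheses (omM : {morph om : x y / x * y}) (om1 : om 1 = 1).
Hypotheses (r_gt0 : (0 < r)%N) (omr : trivial_on (unit_filtration OF w r) om).
Hypothesis ommin : forall t, trivial_on (unit_filtration OF w t) om -> (r <= t)%N.
Local Notation Pi := (principal_series om (fun=> 1)).
Implicit Types (f u : Pi) (g h : GL2 F).

Lemma ps_om_B f h g : h 1 0 = 0 -> ps_fun f (h * g)%g =
  om (h 0 0) * (Num.sqrt (normalized_abs (h 0 0 / h 1 1)))%:C%C * ps_fun f g.
Proof. by move=> h0; rewrite ps_B // mulr1. Qed.

Lemma IndB0 s : IndB w s (0 : Pi).
Proof. by move=> h g _ _; rewrite !ps_0 mulr0. Qed.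

Lemma IndB_sum0 s : IndB_sum w r s (0 : Pi).
Proof. by exists (fun=> 0) => [t _|]; [exact: IndB0|rewrite big1]. Qed.

Lemma IndB_sum_pred s f : (r < s)%N -> IndB w s.-1 f -> IndB_sum w r s f.
Proof.
case: s => // s lrs fs; exists (fun t => if t == s then f else 0) => [t _|].
  by case: eqP => [->|_] //; apply: IndB0.
rewrite big_nat_recr //= eqxx big_nat big1 ?add0r // => t /andP[_ ts].
by rewrite (ltn_eqF ts).
Qed.

(** A vector of Ind_B(s) which lies in Ind_B(s-1) is in the sum of the lower
    levels, to which the space containing u is complementary. *)
Lemma level_vector_properties s u : (r <= s)%N -> level_vector w r s u -> [/\
  forall h g, Bgroup w s h -> GL2O g -> ps_fun u (h * g)%g = om (h 0 0) * ps_fun u g,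
  forall h g, Bgroup w s h -> ps_fun u (g * h)%g = om (h 0 0) * ps_fun u g,
  s = r -> ps_fun u 1%g != 0 &
  (r < s)%N -> ps_fun u (lower (w ^+ s.-1)) != ps_fun u 1%g].
Proof.
move=> rs [W [[Wsub Wst Wcap Wsum] Wu u0 uB]].
have uL h g : Bgroup w s h -> GL2O g -> ps_fun u (h * g)%g = om (h 0 0) * ps_fun u g.
  have : IndB w s u.
    by rewrite Wsum; exists u, 0; split; rewrite ?addr0 //; apply: IndB_sum0.
  by move=> H; apply: H.
have uR h g : Bgroup w s h -> ps_fun u (g * h)%g = om (h 0 0) * ps_fun u g.
  by move=> hB; rewrite -ps_actE uB.
split=> // [sr|lrs]; apply/eqP => e.
  move/eqP: u0; apply; apply: ps_eqP => g; rewrite ps_0.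
  exact: (level_eq0 D om1 r_gt0 (@ps_om_B u) uL uR ommin sr e).
have : (W `&` IndB_sum w r s) u.
  split=> //; apply: IndB_sum_pred => // h g hB gO.
  exact: (level_drop D omM om1 r_gt0 omr uL uR ommin lrs e).
by rewrite Wcap => /eqP; rewrite (negPf u0).
Qed.
End LevelVectorFacts.

(** * Nonvanishing at the test vectors *)

Section MainPart.
Variables (R : realType) (p : nat) (Qp : padicField R p) (F : fieldExtType Qp).
Variables (K : fieldExtType F) (w : F) (wK : K).
Local Notation OF := (integers F).
Local Notation OK := (ext_integers K).
Local Notation C := R[i].
Local Notation jK := (in_alg K).
Hypotheses (D : dvr OF w p) (DK : dvr OK wK p).
Hypothesis dK : \dim {:K} = 2%N.
Variable iota : {lrmorphism K -> 'M[F]_2}.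
Local Notation ctg k := (torus_GL2 (conj_iota iota k)).
Local Notation tg := (torus_GL2 iota).
Local Notation ram := (ram_index w DK).
Hypothesis iO : forall x, OK x -> forall i j, OF (iota x i j).
Variables (nu1 nu2 : character OF p C) (chi : character OK p C).
Hypothesis central : forall z, z != 0 -> chi (jK z) = nu1 z * nu2 z.
Let om (x : F) : C := nu1 x / nu2 x.
Let chi' (t : K) : C := chi t / nu2 (field_norm t).
Implicit Types (x y : K) (z : F) (g : GL2 F).

Lemma quotient_characterM : {morph om : x y / x * y}.
Proof. by move=> x y; rewrite /om !charM invfM mulrACA. Qed.

Lemma quotient_character1 : om 1 = 1.
Proof. by rewrite /om !char1 divff ?oner_neq0. Qed.

Lemma twisted_charM : {morph chi' : x y / x * y}.
Proof. by move=> x y; rewrite /chi' field_normM !charM invfM mulrACA. Qed.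

Lemma twisted_char1 : chi' 1 = 1.
Proof. by rewrite /chi' field_norm1 !char1 divff ?oner_neq0. Qed.

(** The norm of an element z of F is z^2. *)
Lemma twisted_char_central z : z != 0 -> chi' (jK z) = om z.
Proof.
move=> z0; rewrite /chi' central // -(det_iota iota dK) iota_alg det_scalar expr2 charM.
by rewrite /om; field; apply: character_neq0.
Qed.

Lemma twisted_char_smooth : exists n, trivial_on (unit_filtration OK p%:R n) chi'.
Proof.
have [n nu2n] := char_smooth nu2; have [m chim] := char_smooth chi.
exists (maxn n m).+1 => t Ut; have [[_ t0 _] _] := Ut.
have Un k : (k <= maxn n m)%N -> unit_filtration OK p%:R k t.
  case: k => [|k] le; last exact: (unit_filtration_le DK (ltnW le) Ut).
  case: Ut => Ut _; split=> //; exists (t - 1); rewrite ?expr0 ?mul1r //.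
  by apply: (dvrB DK); [case: Ut | exact: dvr_one DK].
rewrite /chi' [chi t]chim; last exact/Un/leq_maxr.
rewrite -(det_iota iota dK) -(tgE iota t0) [nu2 _]nu2n ?divr1 //.
apply: congruence_subgroup_det; apply: (tg_congruence iO); exact/Un/leq_maxl.
Qed.

Definition twisted_character : character OK p C.
Proof.
refine (@Character _ _ _ _ chi' _ twisted_char1 twisted_charM twisted_char_smooth).
by rewrite /chi' char0 mul0r.
Defined.

Variable r : nat.
Hypothesis omc : conductor_exponent OF w om r.
Hypothesis om_ram : ramified_char OF om.

Lemma ramified_conductor_gt0 : (0 < r)%N.
Proof.
case: r omc => // -[om0 _]; case: om_ram => t Ut; apply: om0; split=> //.
exists (t - 1); rewrite ?expr0 ?mul1r //; apply: (dvrB D); [by case: Ut|exact: dvr_one D].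
Qed.

(** The restriction of chi' to F^* is omega', so that the conductor of chi'
    bounds that of omega'. *)
Lemma trivial_on_base N t : trivial_on (unit_filtration OK wK N) chi' ->
  N%:Z <= ram * t%:Z -> (r <= t)%N.
Proof.
move=> chiN Nt; apply: (proj2 omc) => x [Ux /(ideal_powerE D) Ix].
have [_ x0 _] := Ux; rewrite -twisted_char_central //; apply: chiN; split.
  exact: units_jK.
apply/(ideal_powerE DK); have := vgeK_jK DK Ix; rewrite rmorphB rmorph1.
exact: vge_le.
Qed.

Local Notation Pi' := (principal_series om (fun=> 1)).

(** The twist multiplies f(iota x) by nu_2(N x), and so does the passage from
    chi' to chi. *)
Lemma twist_torus_integral (v : Pi') :
  torus_mean DK (fun x => ps_fun v (tg x) / chi' x) != 0 ->
  test_vector iota chi (twist v : principal_series nu1 nu2).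
Proof.
move=> mv; apply: (test_vector_torus_integral (DK := DK) dK iO central).
have cen z : z != 0 -> twisted_character (jK z) = om z * 1.
  by move=> z0; rewrite mulr1; apply: twisted_char_central.
have [n sv] := matrix_coefficient_smooth DK iO cen v.
have [m st] := matrix_coefficient_smooth DK iO central (twist v : principal_series nu1 nu2).
rewrite /torus_integral (_ : torus_mean _ _ =
   torus_mean DK (fun x => ps_fun v (tg x) / chi' x)) //.
apply: (eq_torus_mean DK (n := maxn m n)).
- exact: (torus_smooth_le DK (leq_maxl m n) st).
- exact: (torus_smooth_le DK (leq_maxr m n) sv).
move=> x x0; rewrite /chi' /= -(det_iota iota dK) -(tgE iota x0).
have n0 : nu2 (\det (tg x)) != 0 by apply: character_neq0; apply: gl_det_neq0.
have c0 : chi x != 0 by apply: (chi_neq0 (charM chi) (char1 chi)).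
by field; rewrite c0 n0.
Qed.

(** iota(x) k = k iota'(x) for the conjugate embedding iota', and k = b
    iota'(x0) with b upper triangular; so the integral of k u is a nonzero
    multiple of the integral of u along the conjugate torus, by invariance. *)
Lemma nonvanishing_translate (k : GL2 F) (u : Pi') :
  torus_mean DK (fun x => ps_fun u (ctg k x) / chi' x) != 0 ->
  (forall x, OK x -> forall i j, OF (conj_iota iota k x i j)) ->
  torus_mean DK (fun x => ps_fun (rep_act k u) (tg x) / chi' x) != 0.
Proof.
move=> mu iO'; have cen z : z != 0 -> twisted_character (jK z) = om z * 1.
  by move=> z0; rewrite mulr1; apply: twisted_char_central.
have [n sv0] := matrix_coefficient_smooth DK iO cen (rep_act k u).
have sv : torus_smooth OK p n (fun x => ps_fun (rep_act k u) (tg x) / chi' x) := sv0.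
have [m su0] := matrix_coefficient_smooth DK iO' cen u.
have [b [x0 [x00 b0 b1 ek]]] := torus_borel (conj_iota iota k) dK k.
have bb0 : b 0 0 != 0.
  by have := gl_det_neq0 b; rewrite det_gl b0 mulr0 subr0 mulf_eq0 negb_or => /andP[].
pose B : C := om (b 0 0) * (Num.sqrt (normalized_abs (b 0 0 / b 1 1)))%:C%C * chi' x0.
have c_neq0 x : x != 0 -> chi' x != 0.
  exact: (chi_neq0 twisted_charM twisted_char1).
have B0 : B != 0.
  have omb0 : om (b 0 0) != 0.
    exact: (om_neq0 quotient_characterM quotient_character1).
  rewrite mulf_neq0 ?c_neq0 // (mulf_neq0 omb0) //.
  rewrite fmorph_eq0 b1 divr1 gt_eqF // Num.Theory.sqrtr_gt0.
  exact: normalized_abs_gt0.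
pose h x := ps_fun u (ctg k x) / chi' x.
have su : torus_smooth OK p m h := su0.
have su' : torus_smooth OK p m (fun x => h (x * x0)).
  move=> x y y0 [z [t [z0 Ut e]]]; apply: su; first exact: mulf_neq0.
  by exists z, t; split=> //; rewrite e mulrA.
rewrite (_ : torus_mean _ _ = B * torus_mean DK h); first exact: mulf_neq0 B0 mu.
rewrite -(torus_mean_shift DK x00 su) -(torus_meanZ DK B su').
have s1 := torus_smooth_le DK (leq_maxl n m) sv.
have s2 := torus_smooth_le DK (leq_maxr n m) su'.
apply: (eq_torus_mean DK s1) => [x y xn0 e|x xn0]; first by rewrite (s2 x y).
rewrite ps_actE conj_tg // {1}ek -mulgA -tgM // ps_om_B // /h /B [x0 * x]mulrC.
rewrite twisted_charM; move: (c_neq0 _ xn0) (c_neq0 _ x00).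
move: (chi' x) (chi' x0) (om _) (_%:C%C) (ps_fun u _) => c c' a e t cn0 c'n0.
by field; rewrite cn0 c'n0.
Qed.

Hypothesis uK : uniformizer OK wK.
Hypothesis compat : torus_compatible iota w.

(** The hypotheses on the conductor and on the embedding are matched with the
    two criteria above; in the even ramified case they hold for the conjugate
    embedding. *)
Lemma level_test_vector_mean s (v : Pi') : level_test_vector iota w wK chi' r s v ->
  torus_mean DK (fun x => ps_fun v (tg x) / chi' x) != 0.
Proof.
have r0 := ramified_conductor_gt0; have [omr ommin] := omc.
have [m chim] := twisted_char_smooth.
have unram := unramified_ram_index D DK uK.
have ram0 := ram_index_gt0 D DK.
case=> [[un [cs lv]]|[[nun [cs [_ lv]]]|[nun [cs [rs [k [u [kO lv Sk ->]]]]]]]].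
- have r1 : ram = 1 by apply/unram.
  have rs : (r <= s)%N by apply: (trivial_on_base (proj1 cs)); rewrite r1 mul1r.
  have [uL uR umin udrop] := level_vector_properties D quotient_characterM
    quotient_character1 r0 omr ommin rs lv.
  have [n vK] := ps_K v.
  have [th Oth Uth] := unramified_generator D iO dK r1.
  apply: (nonvanishing_unit_generator D iO dK twisted_charM twisted_char1
    twisted_char_central quotient_characterM quotient_character1 r0 omr ommin
    (@ps_om_B _ _ _ _ _ v) uL uR vK chim rs umin udrop Oth Uth _ cs).
  by rewrite r1 mul1r.
- have [r2 _] : ram = 2 /\ _ := ram_index_2 D iO (fun e => nun (proj2 unram e)).
  have [uL uR umin udrop] := level_vector_properties D quotient_characterM
    quotient_character1 r0 omr ommin (leqnn r) lv.
  have [n vK] := ps_K v.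
  have iR x : OK x -> vge D 1 (iota x 1 0).
    by move=> Ox; apply/(ideal_powerE D); case: ((proj2 compat) nun x Ox).
  exact: (nonvanishing_odd iO dK twisted_charM twisted_char1
    twisted_char_central quotient_characterM quotient_character1 r0 omr ommin
    (@ps_om_B _ _ _ _ _ v) uL uR vK chim (leqnn r) umin udrop r2 iR erefl cs).
have [r2 _] : ram = 2 /\ _ := ram_index_2 D iO (fun e => nun (proj2 unram e)).
have iO' x : OK x -> forall i j, OF (conj_iota iota k x i j).
  move=> Ox i j; rewrite conj_iotaE !mul22.
  have Ok i' j' : OF (k i' j') by apply: GL2O_int.
  have OkV i' j' : OF (GL2_mx k^-1%g i' j') by apply: GL2O_int; apply: GL2OV.
  by apply: (dvrD D); apply: (dvrM D) => //; apply: (dvrD D);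
    apply: (dvrM D) => //; apply: iO.
apply: nonvanishing_translate => //.
have [uL uR umin udrop] := level_vector_properties D quotient_characterM
    quotient_character1 r0 omr ommin rs lv.
have [n vK] := ps_K u.
have s0 := leq_trans r0 rs.
have [th Oth Uth] : exists2 th, OK th & integer_units OF (conj_iota iota k th 1 0).
  apply: (conductor_order_generator (D := D) DK iO' dK s0) => x Ox vx; rewrite -Sk.
  exists (conj_iota iota k x); last by rewrite -iota_conjE.
  by split=> //; apply/(ideal_powerE D).
apply: (nonvanishing_unit_generator D iO' dK twisted_charM twisted_char1
    twisted_char_central quotient_characterM quotient_character1 r0 omr ommin
    (@ps_om_B _ _ _ _ _ u) uL uR vK chim rs umin udrop Oth Uth _ cs).
by rewrite r2; lia.
Qed.
End MainPart.

(** In the unramified case only the units of O_K are assumed to have integral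
    matrices; a nonunit x is the difference of the units 1 + x and 1. *)
Lemma torus_compatible_integral (R : realType) (p : nat) (Qp : padicField R p)
    (F : fieldExtType Qp) (K : fieldExtType F) (w : F) (wK : K)
    (iota : {lrmorphism K -> 'M[F]_2}) :
  dvr (integers F) w p -> dvr (ext_integers K) wK p -> torus_compatible iota w ->
  forall x, ext_integers K x -> forall i j, integers F (iota x i j).
Proof.
move=> D DK [Hu Hr]; case: (pselect (unramified_ext K w)) => [un|nun]; last first.
  by move=> x Ox i j; case: (Hr nun x Ox).
have unit_int x : integer_units (ext_integers K) x -> forall i j, integers F (iota x i j).
  move=> Ux i j; have [_ x0 _] := Ux; have e := tgE iota x0.
  by rewrite -e; case: (Hu un x _ Ux e i j).
move=> x Ox i j; case: (pselect (integer_units (ext_integers K) x)) => [Ux|nx].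
  exact: unit_int.
have vx : vge DK 1 x by apply: contrapT => h; apply: nx; apply/(unitP2 DK).
have U1 := units_add (units1 DK) vx.
have -> : iota x i j = iota (1 + x) i j - (i == j)%:R.
  by rewrite rmorphD rmorph1 !mxE addrAC subrr add0r.
apply: (dvrB D); first exact: unit_int.
by case: (i == j); [exact: dvr_one D|exact: dvr0 D].
Qed.

(** * Existence of vectors of level s *)

Section LevelVectorExists.
Variables (R : realType) (p : nat) (Qp : padicField R p) (F : fieldExtType Qp).
Variable w : F.
Local Notation OF := (integers F).
Local Notation C := R[i].
Hypothesis D : dvr OF w p.
Variables (om : F -> C) (r : nat).
Hypotheses (omM : {morph om : x y / x * y}) (om1 : om 1 = 1).
Hypotheses (r_gt0 : (0 < r)%N) (omr : trivial_on (unit_filtration OF w r) om).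
Local Notation Pi := (principal_series om (fun=> 1)).
Implicit Types (f e : Pi) (g h k b : GL2 F).

Let om_n0 := om_neq0 omM om1.

Lemma upper_Bgroup s b : GL2O b -> b 1 0 = 0 -> Bgroup w s b.
Proof. by move=> bO b0; apply/(BgroupP D); split=> //; rewrite b0; apply: vge0. Qed.

Lemma ps_eq_GL2O f e : (forall g, GL2O g -> ps_fun f g = ps_fun e g) -> f = e.
Proof.
move=> fe; apply: ps_eqP => g; have [h [k [h0 kO ->]]] := iwasawa D g.
by rewrite !ps_B // fe.
Qed.

Section Extension.
Variable phi : GL2 F -> C.
Hypothesis phiB : forall b g, GL2O b -> b 1 0 = 0 -> GL2O g ->
  phi (b * g)%g = om (b 0 0) * phi g.
Hypothesis phiK : exists n : nat, forall k g, congruence_subgroup n k -> GL2O g ->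
  phi (g * k)%g = phi g.

Let modulus h : C := om (h 0 0) * (Num.sqrt (normalized_abs (h 0 0 / h 1 1)))%:C%C.

Lemma upper_mulE b h : b 1 0 = 0 -> h 1 0 = 0 ->
  ((b * h)%g 1%R 0%R = 0) * ((b * h)%g 0%R 0%R = b 0 0 * h 0 0) *
  ((b * h)%g 1%R 1%R = b 1 1 * h 1 1).
Proof. by move=> b0 h0; rewrite !gmulE b0 h0 !(mulr0, mul0r) ?addr0 ?add0r. Qed.

Let modulusM b h : b 1 0 = 0 -> h 1 0 = 0 -> modulus (b * h)%g = modulus b * modulus h.
Proof.
move=> b0 h0; rewrite /modulus !(upper_mulE b0 h0) omM invfM mulrACA normalized_absM.
by rewrite Num.Theory.sqrtrM ?normalized_abs_ge0 // rmorphM; ring.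
Qed.

Let modulusO b : GL2O b -> b 1 0 = 0 -> modulus b = om (b 0 0).
Proof.
move=> bO b0; have [U0 U1] := Bgroup_units D (isT : (0 < 1)%N) (upper_Bgroup 1 bO b0).
rewrite /modulus normalized_abs_unit ?Num.Theory.sqrtr1.
  by rewrite [(1)%:C%C](_ : _ = 1) // mulr1.
by apply: (unitsM D) => //; apply: unitsV.
Qed.

Let dec g : {hk : GL2 F * GL2 F |
  [/\ hk.1 1 0 = 0, GL2O hk.2 & g = (hk.1 * hk.2)%g]}.
Proof. by apply: cid; have [h [k H]] := iwasawa D g; exists (h, k). Qed.

Let ext g : C := modulus (sval (dec g)).1 * phi (sval (dec g)).2.

Let extE g h k : h 1 0 = 0 -> GL2O k -> g = (h * k)%g -> ext g = modulus h * phi k.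
Proof.
rewrite /ext; case: (dec g) => -[h' k'] /= [h'0 k'O ->] h0 kO e.
set b := (h'^-1 * h)%g.
have bE : b = (k' * k^-1)%g.
  by rewrite /b -[h](mulgK k) -e mulgA mulgA mulVg mul1g.
have bO : GL2O b by rewrite bE; apply: (GL2OM D) => //; apply: GL2OV.
have b0 : b 1 0 = 0 by rewrite gmulE ginvE h'0 h0 oppr0 !(mul0r, mulr0) addr0.
have e1 : h = (h' * b)%g by rewrite /b mulgA mulgV mul1g.
have e2 : k' = (b * k)%g by rewrite bE mulgVK.
by rewrite [in RHS]e1 [in LHS]e2 modulusM // (modulusO bO) // phiB // mulrA.
Qed.

(** Restriction to GL_2(O) identifies the principal series with a space of
    functions on GL_2(O): by the Iwasawa decomposition an extension is
    determined, and it is well defined because the modulus is trivial on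
    integral upper triangular matrices. *)
Lemma extend_from_GL2O : exists f : Pi, forall g, GL2O g -> ps_fun f g = phi g.
Proof.
have extP : ext \in principal_series_pred om (fun=> 1).
  apply/asboolP; split=> [b g b0|].
    have [h [k [h0 kO e]]] := iwasawa D g.
    rewrite (extE h0 kO e) (@extE _ (b * h)%g k) ?(upper_mulE b0 h0) ?e ?mulgA //.
    by rewrite modulusM // -mulrA; congr (_ * _); rewrite mulr1.
  have [n phin] := phiK; exists n => k g kn; have [h [k' [h0 k'O e]]] := iwasawa D g.
  rewrite (extE h0 k'O e) (@extE _ h (k' * k)%g) ?e ?mulgA ?phin //.
  by apply: (GL2OM D) => //; case: kn.
exists (PrincipalSeriesVector extP) => g gO.
rewrite /= (@extE g 1%g g) ?mul1g ?g1E // modulusO ?g1E ?om1 ?mul1r //.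
exact: (GL2O1 D).
Qed.
End Extension.

Lemma IndB_le s t f : (s <= t)%N -> IndB w s f -> IndB w t f.
Proof. by move=> st fs b g bB gO; apply: fs => //; apply: (Bgroup_le D st). Qed.

Lemma IndB_D s a f e : IndB w s f -> IndB w s e -> IndB w s (a *: f + e).
Proof. by move=> fs es b g bB gO; rewrite !ps_lin fs // es //; ring. Qed.

Lemma IndB_sum_IndB s f : (r < s)%N -> IndB_sum w r s f -> IndB w s.-1 f.
Proof.
move=> lrs [h hP ->]; rewrite big_nat.
elim/big_ind: _ => [|x y xI yI|i /[dup] ri /andP[_ i_s]]; first exact: IndB0.
  by have := IndB_D 1 xI yI; rewrite scale1r.
by apply: IndB_le (hP i ri); lia.
Qed.

Lemma congruence_om s k g : (r <= s)%N -> Bgroup w s g -> congruence_subgroup s k ->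
  om ((g * k)%g 0%R 0%R) = om (g 0 0).
Proof.
move=> rs gB kS; rewrite (om_mul D omM r_gt0 omr rs gB); last exact: (congruence_Bgroup D).
rewrite (om_near (D := D) omM r_gt0 omr (units1 D) (x := k 0 0)) ?om1 ?mulr1 //.
case: kS => _ /(_ 0 0)/(ideal_power_p_vge D); rewrite !mxE mulr1n; apply: vge_le; lia.
Qed.

(** It exists because omega of the upper left entry is a character of B(s). *)
Lemma exists_standard_vector s : (r <= s)%N -> exists f : Pi, [/\ IndB w s f,
  forall b, Bgroup w s b -> rep_act b f = om (b 0 0) *: f,
  ps_fun f 1%g = 1 & forall g, GL2O g -> ~ Bgroup w s g -> ps_fun f g = 0].
Proof.
move=> rs; pose phi g : C := if `[< Bgroup w s g >] then om (g 0 0) else 0.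
have phiT g : Bgroup w s g -> phi g = om (g 0 0).
  by move=> gB; rewrite /phi ifT //; apply/asboolP.
have phiF g : ~ Bgroup w s g -> phi g = 0.
  by move=> gB; rewrite /phi ifF //; apply/asboolP.
have phil b g : Bgroup w s b -> phi (b * g)%g = om (b 0 0) * phi g.
  move=> bB; case: (pselect (Bgroup w s g)) => gB.
    by rewrite !phiT ?(om_mul D omM r_gt0 omr rs) //; apply: (BgroupM D).
  rewrite !phiF ?mulr0 // => bgB; apply: gB.
  by rewrite -(mulKg b g); apply: (BgroupM D) => //; apply: (BgroupV D).
have phir b g : Bgroup w s b -> phi (g * b)%g = om (b 0 0) * phi g.
  move=> bB; case: (pselect (Bgroup w s g)) => gB.
    by rewrite !phiT ?(om_mul D omM r_gt0 omr rs) 1?mulrC //; apply: (BgroupM D).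
  rewrite !phiF ?mulr0 // => bgB; apply: gB.
  by rewrite -(mulgK b g); apply: (BgroupM D) => //; apply: (BgroupV D).
have [||f fE] := @extend_from_GL2O phi.
- by move=> b g bO b0 gO; apply: phil; apply: upper_Bgroup.
- exists s => k g kS gO; rewrite phir; last exact: (congruence_Bgroup D).
  have B1 : Bgroup w s (1%g : GL2 F) by apply: upper_Bgroup; [exact: (GL2O1 D)|rewrite g1E].
  by have := congruence_om rs B1 kS; rewrite mul1g g1E om1 => ->; rewrite mul1r.
have B1 : Bgroup w s (1%g : GL2 F) by apply: upper_Bgroup; [exact: (GL2O1 D)|rewrite g1E].
exists f; split.
- move=> b g bB gO; rewrite !fE //; first exact: phil.
  by apply: (GL2OM D) => //; apply: Bgroup_GL2O bB.
- move=> b bB; apply: ps_eq_GL2O => g gO; rewrite ps_actE ps_Z !fE //; first exact: phir.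
  by apply: (GL2OM D) => //; apply: Bgroup_GL2O bB.
- by rewrite fE; [rewrite phiT // g1E om1|exact: (GL2O1 D)].
- by move=> g gO ngB; rewrite fE // phiF.
Qed.

Section Averaging.
Variable s : nat.
Hypothesis rs : (r < s)%N.
Let t := s.-1.
Let rt : (r <= t)%N. Proof. by rewrite /t; lia. Qed.
Let ts : (t <= s)%N. Proof. by rewrite /t; lia. Qed.
Let t0 : (0 < t)%N := leq_trans r_gt0 rt.

(** Equality of right cosets of B(s). *)
Definition coset_eqv b b' := Bgroup w s (b * b'^-1)%g.

Lemma coset_eqv_sym b b' : coset_eqv b b' -> coset_eqv b' b.
Proof. by move=> /(BgroupV D); rewrite /coset_eqv invgM invgK. Qed.

Lemma coset_eqv_trans b b' b'' : coset_eqv b b' -> coset_eqv b' b'' -> coset_eqv b b''.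
Proof. by move=> h h'; have := BgroupM D h h'; rewrite mulgA mulgVK. Qed.

(** The lower unipotent matrices represent all the cosets, and the residues of
    their entries modulo w^s are finite in number. *)
Lemma coset_transversal : exists n (c : 'I_n -> GL2 F),
  transversal (Bgroup w t) coset_eqv c.
Proof.
have [ys ysP] := dvr_finite D s.
apply: (transversal_exists coset_eqv_sym coset_eqv_trans
  (c := fun i : 'I_(size ys) => lower ys`_i)) => b bB.
have [_ U11] := Bgroup_units D t0 bB; have [O11 n11 OV11] := U11.
have /(BgroupP D)[bO vb] := bB.
have [|y yys [z Oz e]] := ysP (b 1 0 / b 1 1).
  by apply: (dvrM D) => //; apply: GL2O_int.
have yi : (index y ys < size ys)%N by rewrite index_mem.
exists (Ordinal yi); rewrite /= nth_index //; apply/(BgroupP D).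
have Oy : OF y.
  have -> : y = b 1 0 / b 1 1 - w ^+ s * z by rewrite e addrK.
  apply: (dvrB D); first by apply: (dvrM D) => //; apply: GL2O_int.
  by apply: (dvrM D) => //; apply: (dvrX D); exact: dvr_w D.
split; first by apply: (GL2OM D) => //; apply: GL2OV; apply: (lower_GL2O D).
rewrite gmulE !ginvE det_gl !lowerE mul0r subr0 mulr1 !divr1 mulr1.
have -> : b 1 0 + b 1 1 * - y = w ^+ s * (z * b 1 1).
  by rewrite -[b 1 0](divfK n11) e; ring.
by apply: vgeMl; [move=> _; rewrite valwX|apply: (dvrM D)].
Qed.

Variables (n : nat) (c : 'I_n -> GL2 F).
Hypothesis cT : transversal (Bgroup w t) coset_eqv c.

(** The projection of Ind_B(s) onto Ind_B(s-1), on functions on GL_2(O). *)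
Definition average f g : C := mean c (fun b => (om (b 0 0))^-1 * ps_fun f (b * g)%g).

Let B1 : Bgroup w t (1%g : GL2 F).
Proof. by apply: upper_Bgroup; [exact: (GL2O1 D)|rewrite g1E]. Qed.

Lemma average_lin a f e g : average (a *: f + e) g = a * average f g + average e g.
Proof.
rewrite /average -mean_comb; congr (_ * _); apply: eq_bigr => i _.
by rewrite ps_lin mulrDr mulrCA.
Qed.

Lemma average_act h f g : average (rep_act h f) g = average f (g * h)%g.
Proof.
by rewrite /average /mean; congr (_ * _); apply: eq_bigr => i _; rewrite ps_actE mulgA.
Qed.

Lemma average_left f b g : IndB w s f -> Bgroup w t b -> GL2O g ->
  average f (b * g)%g = om (b 0 0) * average f g.
Proof.
move=> fs bB gO; have b0 := unit_neq0 (proj1 (Bgroup_units D t0 bB)).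
pose q h := (om (h 0 0))^-1 * ps_fun f (h * g)%g.
have -> : average f g = mean c (fun h => q (h * b)%g).
  rewrite [RHS](mean_shift coset_eqv_sym coset_eqv_trans cT (s := fun h => (h * b)%g)) //.
  - by move=> h hB; apply: (BgroupM D).
  - by move=> h h' _ _; rewrite /coset_eqv invgM mulgA mulgK.
  move=> h h' hB h'B hh'; rewrite /q.
  have -> : h = ((h * h'^-1) * h')%g by rewrite mulgVK.
  rewrite -(mulgA _ h' g) (fs _ (h' * g)%g hh'); last first.
    by apply: (GL2OM D) => //; apply: Bgroup_GL2O h'B.
  have hhn := unit_neq0 (proj1 (Bgroup_units D (leq_trans t0 ts) hh')).
  have h'n := unit_neq0 (proj1 (Bgroup_units D t0 h'B)).
  rewrite (om_mul D omM r_gt0 omr rt (Bgroup_le D ts hh') h'B).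
  by field; rewrite !om_n0.
rewrite /average /mean mulrCA; congr (_ * _); rewrite mulr_sumr; apply: eq_bigr => i _.
have [cB _ _] := cT; have cn := unit_neq0 (proj1 (Bgroup_units D t0 (cB i))).
rewrite /q mulgA (om_mul D omM r_gt0 omr rt) //.
by field; rewrite !om_n0.
Qed.

Lemma average_id f g : IndB w t f -> GL2O g -> average f g = ps_fun f g.
Proof.
move=> ft gO; rewrite -[RHS](mean_const cT _ B1); apply: (eq_mean cT) => b bB.
rewrite ft // mulKf // om_n0 //; exact: (unit_neq0 (proj1 (Bgroup_units D t0 bB))).
Qed.

Lemma exists_average f : IndB w s f -> exists e : Pi, IndB w t e /\
  forall g, GL2O g -> ps_fun e g = average f g.
Proof.
move=> fs; have [||e eE] := @extend_from_GL2O (average f).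
- by move=> b g bO b0 gO; apply: average_left => //; apply: upper_Bgroup.
- have [m fm] := ps_K f; exists m => k g km gO.
  rewrite /average /mean; congr (_ * _); apply: eq_bigr => i _.
  by rewrite mulgA (fm _ _ km).
exists e; split=> // b g bB gO; rewrite !eE ?average_left //.
by apply: (GL2OM D) => //; apply: Bgroup_GL2O bB.
Qed.

Definition average_kernel : set Pi :=
  [set f | IndB w s f /\ forall g, GL2O g -> average f g = 0].

Lemma average_complement f e : IndB w s f -> IndB w t e ->
  (forall g, GL2O g -> ps_fun e g = average f g) -> average_kernel (f - e).
Proof.
move=> fs et eE; have -> : f - e = (-1) *: e + f by rewrite scaleN1r addrC.
split; first by apply: IndB_D => //; apply: IndB_le et.
by move=> g gO; rewrite average_lin average_id // eE // mulN1r addNr.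
Qed.

(** The kernel of a projection is a complement of its image, and the image
    Ind_B(s-1) is the sum of all the lower levels. *)
Lemma average_kernel_level_space : level_space w r s average_kernel.
Proof.
split.
- split; first by split; [exact: IndB0|move=> g gO; rewrite average_id //; exact: IndB0].
  move=> a f e [fs f0] [es e0]; split; first exact: IndB_D.
  by move=> g gO; rewrite average_lin f0 // e0 // mulr0 addr0.
- move=> h f hO [fs f0]; split=> [b g bB gO|g gO].
    by rewrite !ps_actE -mulgA (fs _ _ bB) //; apply: (GL2OM D).
  by rewrite average_act f0 //; apply: (GL2OM D).
- apply/seteqP; split=> f /=; last first.
    move=> ->; split; last exact: IndB_sum0.
    by split; [exact: IndB0|move=> g gO; rewrite average_id //; exact: IndB0].
  move=> [[fs f0] fsum]; apply: ps_eq_GL2O => g gO.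
  by rewrite ps_0 -(f0 g gO) average_id //; apply: IndB_sum_IndB.
apply/seteqP; split=> f /=.
  move=> fs; have [e [et eE]] := exists_average fs.
  exists (f - e), e; split; rewrite ?subrK //; first exact: average_complement.
  exact: IndB_sum_pred.
move=> [x [y [[xs _] ysum ->]]]; rewrite -[x]scale1r; apply: IndB_D => //.
by apply: IndB_le ts _; apply: IndB_sum_IndB.
Qed.
End Averaging.

(** For s > r, subtract from the standard vector u0 its projection e to
    Ind_B(s-1). The projection commutes with right translations, so that B(s)
    still acts by omega, and u0 itself is not in Ind_B(s-1), as its support is
    only B(s). *)
Lemma exists_level_vector s : (r <= s)%N -> exists u : Pi, level_vector w r s u.
Proof.
move=> rs; have [u0 [u0I u0R u01 u0F]] := exists_standard_vector rs.
have [sr|lrs] : s = r \/ (r < s)%N by lia.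
  subst s; exists u0, (IndB w r); split=> //; last first.
    by apply/eqP => e; move: u01; rewrite e ps_0 => /esym/eqP; rewrite oner_eq0.
  have sum0 f : IndB_sum w r r f -> f = 0.
    by move=> [h _ ->]; rewrite big_geq.
  split.
  - by split; [exact: IndB0|move=> a f e; apply: IndB_D].
  - by move=> h f hO fs b g bB gO; rewrite !ps_actE -mulgA (fs _ _ bB) //; apply: (GL2OM D).
  - apply/seteqP; split=> f /=; first by move=> [_ /sum0].
    by move=> ->; split; [exact: IndB0|exact: IndB_sum0].
  apply/seteqP; split=> f /=.
    by move=> fs; exists f, 0; split; rewrite ?addr0 //; exact: IndB_sum0.
  by move=> [x [y [xs /sum0 -> ->]]]; rewrite addr0.
have [n [c cT]] := coset_transversal lrs.
have [e [et eE]] := exists_average lrs cT u0I.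
exists (u0 - e), (average_kernel s c); split.
- exact: average_kernel_level_space.
- exact: average_complement.
- apply/eqP => ue; have u0e : u0 = e by apply/eqP; rewrite -subr_eq0 ue.
  have Bl : Bgroup w s.-1 (lower (w ^+ s.-1)) by apply: (lower_Bgroup (D := D)) => _; rewrite valwX.
  have := et _ 1%g Bl (GL2O1 D); rewrite mulg1 -u0e u01 mulr1 lowerE om1.
  rewrite u0F => [/esym/eqP||]; first by rewrite oner_eq0.
    exact: Bgroup_GL2O Bl.
  move=> /(BgroupP D)[_]; rewrite lowerE => /(_ _); rewrite valwX => H.
  have := H (expf_neq0 _ (dvr_neq0 D)); lia.
move=> b bB; apply: ps_eq_GL2O => g gO; rewrite ps_actE ps_Z.
have gbO : GL2O (g * b)%g by apply: (GL2OM D) => //; apply: Bgroup_GL2O bB.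
have -> : u0 - e = (-1) *: e + u0 by rewrite scaleN1r addrC.
rewrite !ps_lin !eE // -average_act u0R // -ps_actE u0R // ps_Z.
have -> : average c (om (b 0 0) *: u0) g = om (b 0 0) * average c u0 g.
  rewrite -[om _ *: _]addr0 average_lin [X in _ + X](_ : _ = 0) ?addr0 //.
  by rewrite /average /mean big1 ?mulr0 // => i _; rewrite ps_0 mulr0.
ring.
Qed.
End LevelVectorExists.

(** * Conductors of characters and the Weyl element *)

(** The powers of p and those of a uniformizer define the same topology. *)
Lemma conductor_exists (L : fieldType) (O : set L) (w : L) (p : nat) (C : fieldType)
    (mu : L -> C) : dvr O w p ->
  (exists n, trivial_on (unit_filtration O p%:R n) mu) ->
  exists N, conductor_exponent O w mu N.
Proof.
move=> D [n mun]; pose P N := `[< trivial_on (unit_filtration O w N) mu >].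
have PN : exists N, P N.
  have [m m0 mn] := vge_ideal_power_p D n; exists m; apply/asboolP => u [Uu Iu].
  by apply: mun; split=> //; apply: mn; apply/(ideal_powerE D).
have [N /asboolP muN min] := ex_minnP PN.
by exists N; split=> // t mut; apply: min; apply/asboolP.
Qed.

Section Ramified.
Variables (R : realType) (p : nat) (Qp : padicField R p) (F : fieldExtType Qp).
Variables (K : fieldExtType F) (w : F) (wK : K).
Local Notation OF := (integers F).
Local Notation OK := (ext_integers K).
Local Notation C := R[i].
Local Notation jK := (in_alg K).
Hypotheses (D : dvr OF w p) (DK : dvr OK wK p).
Local Notation vgeK := (vge DK).
Local Notation vge := (vge D).
Local Notation ram := (ram_index w DK).
Variable iota : {lrmorphism K -> 'M[F]_2}.
Hypothesis iO : forall x, OK x -> forall i j, OF (iota x i j).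
Hypothesis r2 : ram = 2.
Hypothesis iR : forall x, OK x -> vge 1 (iota x 1 0).
Implicit Types (x y : K) (z : F).

Lemma vge_mulw (n : nat) x : OK x -> vgeK (ram * n%:Z) (jK (w ^+ n) * x).
Proof.
by move=> Ox; apply: vgeMl => //; apply: (vgeK_jK DK) => _; rewrite valwX.
Qed.

Lemma vge_divw (n : nat) x : vgeK (ram * n%:Z) x -> OK (x / jK (w ^+ n)).
Proof.
move=> vx; have w0 : w ^+ n != 0 by rewrite expf_neq0 // (dvr_neq0 D).
apply/(vge_integer DK) => y0.
have x0 : x != 0 by apply: contraNneq y0 => ->; rewrite mul0r.
rewrite valM ?invr_eq0 ?jK_neq0 // valV ?jK_neq0 // (valK_jK D) // valwX subr_ge0.
exact: vx.
Qed.

Lemma ramified_coordinates x : OK x -> exists z (y : F),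
  [/\ OF z, OF y & x = jK z + jK y * wK].
Proof.
have [_ _ c0 vc _] := iota_uniformizer iO r2 iR.
apply: (integer_coordinates (D := D) DK c0 (dvr_w DK)) => y Oy.
by rewrite vc; apply: iR.
Qed.

(** An element of 1 + wK^(2j) O_K is the product of an element of 1 + w^j O, on
    which chi is omega, hence trivial, and of an element of 1 + wK^(2j+1) O_K,
    since the residue fields agree. *)
Lemma no_odd_conductor (chi : K -> C) (om : F -> C) r j :
  {morph chi : x y / x * y} -> (forall z, z != 0 -> chi (jK z) = om z) ->
  trivial_on (unit_filtration OF w r) om -> (0 < r <= j)%N ->
  trivial_on (unit_filtration OK wK (2 * j).+1) chi ->
  trivial_on (unit_filtration OK wK (2 * j)) chi.
Proof.
move=> chiM chi_om omr /andP[r0 rj] chij t [Ut /(ideal_powerE DK) vt].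
have w0 : w ^+ j != 0 by rewrite expf_neq0 // (dvr_neq0 D).
have [|z [y [Oz Oy e]]] := @ramified_coordinates ((t - 1) / jK (w ^+ j)).
  by apply: vge_divw; rewrite r2; apply: vge_le vt; lia.
have vw : vge j%:Z (w ^+ j) by move=> _; rewrite valwX.
pose a := 1 + w ^+ j * z.
have Ua : integer_units OF a.
  apply: (units_add (D := D)); first exact: (units1 D).
  by apply: vgeMl => //; apply: vge_le vw; lia.
have [_ a0 OaV] := Ua.
have tE : t = jK a * (1 + jK a^-1 * (jK (w ^+ j) * jK y * wK)).
  rewrite mulrDr mulr1 mulrA -rmorphM mulfV // rmorph1 mul1r.
  rewrite /a rmorphD rmorph1 rmorphM -addrA -!mulrA -mulrDr -e mulrC divfK ?jK_neq0 //.
  by rewrite addrC subrK.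
rewrite tE chiM chi_om // omr; last first.
  split=> //; apply/(ideal_powerE D); rewrite /a addrC addKr; apply: vgeMl => //.
  by apply: vge_le vw; lia.
rewrite mul1r chij //; apply/(unit_filtrationE DK) => //.
rewrite addrC addKr; apply: vgeMr; first exact: integers_jK.
have vwK : vgeK 1 wK by move=> _; rewrite valw.
have := vgeM (@vge_mulw j _ (integers_jK K Oy)) vwK; apply: vge_le; rewrite r2; lia.
Qed.

Definition weyl : GL2 F := gl 0 1 1 0.

Let weyl0 : 0 * 0 - 1 * 1 != 0 :> F.
Proof. by rewrite mulr0 sub0r mulr1 oppr_eq0 oner_neq0. Qed.

Lemma weyl_GL2O : GL2O weyl.
Proof.
apply: (GL2O_gl D); (try exact: (dvr_one D)); (try exact: (dvr0 D)).
rewrite mulr0 sub0r mulr1; split; rewrite ?oppr_eq0 ?oner_neq0 // ?invrN1;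
  apply: (dvrN D); exact: dvr_one D.
Qed.

Lemma conj_weylE x : [/\ conj_iota iota weyl x 0 0 = iota x 1 1,
  conj_iota iota weyl x 0 1 = iota x 1 0, conj_iota iota weyl x 1 0 = iota x 0 1 &
  conj_iota iota weyl x 1 1 = iota x 0 0].
Proof.
have dW : \det weyl = -1 by rewrite det_gl !(glE weyl0) mulr0 sub0r mulr1.
rewrite conj_iotaE !mul22 !ginvE dW !(glE weyl0).
by split; rewrite !(mulr0, mul0r, addr0, add0r, oppr0) ?mulr1 ?invrN1 ?mulrNN ?mulr1 ?mul1r.
Qed.

(** By iota_uniformizer the upper right entry of the matrix of wK is a unit;
    conjugation by the Weyl element moves it to the lower left corner, where it
    detects the coefficient of wK in O_K = O + O wK. *)
Lemma weyl_conductor_order s :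
  iota @^-1` conj_Eichler_order w weyl s = conductor_order w s.
Proof.
have [_ _ _ _ Ub] := iota_uniformizer iO r2 iR.
set iw := conj_iota iota weyl.
have memE x : (iota @^-1` conj_Eichler_order w weyl s) x <->
    (forall i j, OF (iw x i j)) /\ vge s%:Z (iw x 1 0).
  split=> [[M [OM IM] e]|[Ox vx]].
    have -> : iw x = M.
      rewrite /iw conj_iotaE -e !mulmxA.
      have /(congr1 (@GL2_mx F)) /= -> := mulVg weyl.
      rewrite mul1mx -mulmxA.
      by have /(congr1 (@GL2_mx F)) /= -> := mulVg weyl; rewrite mulmx1.
    by split=> //; apply/(ideal_powerE D).
  exists (iw x); last by rewrite /iw -iota_conjE.
  by split=> //; apply/(ideal_powerE D).
have iwO x : OK x -> forall i j, OF (iw x i j).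
  move=> Ox i j; have [e00 e01 e10 e11] := conj_weylE x.
  by have [->|->] := I2P i; have [->|->] := I2P j; rewrite ?e00 ?e01 ?e10 ?e11; apply: iO.
have cw : iw wK 1 0 = iota wK 0 1 by have [] := conj_weylE wK.
have [Ob b0 ObV] := Ub.
have cw0 : iw wK 1 0 != 0 by rewrite cw.
apply/seteqP; split=> x.
  move=> /memE[Ox vx]; have [z e] := coordinates (iota := iw) cw0 x.
  set y := _ / _ in e.
  have vy : vge s%:Z y by apply: vgeMl => //; rewrite cw.
  exists z, (jK y * wK); split=> //.
    have zE : iw x 0 0 = z + y * iw wK 0 0.
      by rewrite {1}e rmorphD mxE iota_lin iota_jK mulr1n.
    rewrite -(addrK (y * iw wK 0 0) z) -zE; apply: (dvrB D) => //.
    apply: (dvrM D); last by apply: iwO; exact: dvr_w DK.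
    by rewrite /y cw; apply: (dvrM D).
  exists (jK y * wK / jK (w ^+ s)).
    apply: vge_divw; apply: vgeMl; last exact: dvr_w DK.
    exact: (vgeK_jK DK).
  by rewrite -rmorphXn [RHS]mulrC divfK // jK_neq0 // expf_neq0 // (dvr_neq0 D).
move=> [a [y [Oa [y' Oy' ->] ->]]]; apply/memE; rewrite -rmorphXn.
have E i j : iw (jK a + jK (w ^+ s) * y') i j = a *+ (i == j) + w ^+ s * iw y' i j.
  by rewrite rmorphD mxE iota_jK iota_lin.
split=> [i j|].
  rewrite E; apply: (dvrD D).
    by case: (i == j); rewrite ?mulr1n ?mulr0n //; exact: dvr0 D.
  by apply: (dvrM D); [apply: (dvrX D); exact: dvr_w D|apply: iwO].
rewrite E mulr0n add0r; apply: vgeMl; last exact: iwO.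
by move=> _; rewrite valwX.
Qed.
End Ramified.

Theorem theorem2p19 (R : realType) (p : nat) (Qp : padicField R p)
  (F : fieldExtType Qp) (K : fieldExtType F)
  (w : F) (wK : K)
  (nu1 nu2 : character (integers F) p R[i])
  (chi : character (ext_integers K) p R[i])
  (iota : {lrmorphism K -> 'M[F]_2})
  (r1 r2 r' : nat) :
  let omega' : F -> R[i] := fun x => nu1 x / nu2 x in
  let chi' : K -> R[i] := fun t => chi t / nu2 (field_norm t) in
  uniformizer (integers F) w ->
  \dim {:K} = 2%N ->
  uniformizer (ext_integers K) wK ->
  (exists2 x : F, x != 0 & nu1 x != 1) ->
  (exists2 x : F, x != 0 & nu2 x != 1) ->
  irreducible_rep (principal_series nu1 nu2) ->
  conductor_exponent (integers F) w nu1 r1 ->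
  conductor_exponent (integers F) w nu2 r2 ->
  (r2 <= r1)%N ->
  ramified_char (integers F) omega' ->
  conductor_exponent (integers F) w omega' r' ->
  (forall x : F, x != 0 -> chi (in_alg K x) = nu1 x * nu2 x) ->
  torus_compatible iota w ->
  (exists (s : nat) (v' : principal_series omega' (fun=> 1)),
     level_test_vector iota w wK chi' r' s v') /\
  (forall (s : nat) (v' : principal_series omega' (fun=> 1)),
     level_test_vector iota w wK chi' r' s v' ->
     test_vector iota chi (twist v')).
Proof.
move=> omega' chi' uw dK uK _ _ _ _ _ _ om_ram omc central compat.
have D := dvr_integers uw; have DK := dvr_ext_integers uK.
have iO := torus_compatible_integral D DK compat.
split; last first.
  move=> s v' lv; apply: (twist_torus_integral (DK := DK) dK iO central).
  exact: (level_test_vector_mean D DK dK iO central omc om_ram uK compat lv).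
have r0 := ramified_conductor_gt0 D omc om_ram.
have [omr ommin] := omc.
have omM := quotient_characterM nu1 nu2; have om1 := quotient_character1 nu1 nu2.
have chi'M := twisted_charM nu2 chi.
have [N cN] := conductor_exists DK (twisted_char_smooth DK dK iO nu2 chi).
have rN t := trivial_on_base (t := t) D dK iota central omc (proj1 cN).
have level s : (r' <= s)%N ->
    exists u : principal_series omega' (fun=> 1), level_vector w r' s u.
  exact: (exists_level_vector D omM om1 r0 omr).
case: (pselect (unramified_ext K w)) => [un|nun].
  have ram1 := proj1 (unramified_ram_index D DK uK) un.
  have [|u lu] := level N; first by apply: rN; rewrite ram1 mul1r.
  by exists N, u; left.
have [ram2 _] := ram_index_2 D iO (fun e => nun (proj2 (unramified_ram_index D DK uK) e)).
have iR x : ext_integers K x -> vge D 1 (iota x 1 0).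
  by move=> Ox; apply/(ideal_powerE D); case: ((proj2 compat) nun x Ox).
(* The conductor exponent N of chi' is at least 2 r' - 1, by restriction to
   F^*. *)
have rh : (r' <= uphalf N)%N.
  by apply: rN; rewrite ram2; have := leq_uphalf_double N N; lia.
have [oN|eN] := boolP (odd N).
  have NE : N = (2 * N./2).+1 by have := odd_double_half N; rewrite oN; lia.
  have [Nr|ltr] : N = (2 * r' - 1)%N \/ (r' <= N./2)%N.
    by move: rh; rewrite uphalf_half oN; lia.
    have [u lu] := level r' (leqnn _).
    by exists r', u; right; left; rewrite -Nr.
  (* An odd N greater than 2 r' - 1 would contradict the minimality of N. *)
  suff : (N <= 2 * N./2)%N by move: NE; lia.
  apply: (proj2 cN).
  apply: (no_odd_conductor iO ram2 iR (twisted_charM nu2 chi)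
    (twisted_char_central dK iota central) omr); first by rewrite r0 ltr.
  by rewrite -NE; case: cN.
have NE : N = (2 * N./2)%N by have := odd_double_half N; rewrite (negPf eN); lia.
have rs : (r' <= N./2)%N by move: rh; rewrite uphalf_half (negPf eN).
have [u lu] := level N./2 rs.
exists N./2, (rep_act (weyl F) u); right; right; rewrite -NE; do 3 split=> //.
exists (weyl F), u; split=> //; first exact: (weyl_GL2O D).
exact: (weyl_conductor_order iO ram2 iR).
Qed.
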